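(* Let $M$ be a compact manifold of dimension $n\ge2$. There exists on $M$ a one-parameter family of Riemannian metrics $g_\varepsilon$, $\varepsilon>0$, of volume $1$, such that for all $k$ and all $\varepsilon>0$, $$\mu_k^{**}(M,g_\varepsilon)\le C\,k^2\,\varepsilon^{2\frac{n-1}n},$$ where $C$ is a constant which depends only on $n$.
   Context: $M$ may have nonempty boundary; $k$ ranges over nonnegative integers. $v_g$ is the Riemannian volume element and $|M|_g$ the volume of $M$ with respect to $g$. For positive functions $\rho,\sigma$ on $M$ and $k\ge0$, $$\mu_k^g(\rho,\sigma)=\inf_{E\in S_{k+1}}\sup_{u\in E\setminus\{0\}}\frac{\int_M|\nabla u|^2\sigma\,v_g}{\int_Mu^2\rho\,v_g},$$ where $S_k$ is the set of $k$-dimensional vector subspaces of $H^1(M)$. The extremal eigenvalue is $\mu_k^{**}(M,g)=\sup\{\mu_k^g(1,\sigma):\sigma>0 \text{ a density with } \frac1{|M|_g}\int_M\sigma\,v_g=1\}$, densities being positive continuous functions on $M$. *)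

(* Defs.v *)
From HB Require Import structures.
From mathcomp Require Import all_boot all_order all_algebra.
From mathcomp Require Import all_classical all_reals all_analysis.

Set Implicit Arguments.
Unset Strict Implicit.
Unset Printing Implicit Defensive.
Import Order.TTheory GRing.Theory Num.Theory.
Import numFieldNormedType.Exports.

Local Open Scope classical_set_scope.
Local Open Scope ring_scope.

(* Defined as a set function; the integral of the library takes a bare set
   function as its measure argument. *)
Fixpoint lebesgue_tuple (R : realType) (n : nat) :
    set (n.-tuple (measurableTypeR R)) -> \bar R :=
  match n with
  | 0 => dirac [tuple]
  | m.+1 => pushforward (lebesgue_measure \x @lebesgue_tuple R m)%E
              (fun xt => [the m.+1.-tuple (measurableTypeR R) of xt.1 :: xt.2])
  end.

Definition borel (T : ptopologicalType) := g_sigma_algebraType (@open T).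

Section Smoothness.
Context {R : realType} {n : nat}.
Implicit Types (f F : 'rV[R]_n -> R) (x : 'rV[R]_n) (i : 'I_n).

Definition tuple_row (t : n.-tuple R) : 'rV[R]_n := \row_i tnth t i.

Definition halfspace : set 'rV[R]_n :=
  [set x | forall i, i = 0%N :> nat -> 0 <= x 0 i].

Definition basis_vector i : 'rV[R]_n := delta_mx 0 i.

Definition partial i f x : R := 'D_(basis_vector i) f x.

Definition C_infinity (V : set 'rV[R]_n) F : Prop :=
  forall s : seq 'I_n, let G := foldr partial F s in
  forall x, V x ->
    {for x, continuous G} /\ forall i, derivable G x (basis_vector i).

(* For A relatively open in the half-space this is smoothness up to the
   boundary: locally f extends smoothly to an open set of R^n. *)
Definition smooth_on (A : set 'rV[R]_n) f : Prop :=
  forall x, A x -> exists V, exists F,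
    [/\ open V, V x, C_infinity V F & forall y, A y -> V y -> F y = f y].

(* Right derivatives are taken because x + h e_i stays in the half-space for
   h > 0, so that the derivatives of a function that is smooth up to the
   boundary make sense at boundary points; in the interior they are the usual
   ones. *)
Definition rpartial i f x : R :=
  lim (h^-1 * (f (x + h *: basis_vector i) - f x) @[h --> 0^'+]).

End Smoothness.
Arguments halfspace : clear implicits.

(* A boundaryless manifold is covered too: its charts can be taken with values
   in the open half-space. *)
Record chart (R : realType) (n : nat) (M : topologicalType) := Chart {
  dom : set M;
  coord : M -> 'rV[R]_n;
  param : 'rV[R]_n -> M;
  dom_open : open dom;
  image_open : exists2 V : set 'rV[R]_n,
    open V & coord @` dom = V `&` halfspace R n;
  coordK : forall p, dom p -> param (coord p) = p;
  coord_continuous : {within dom, continuous coord};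
  param_continuous : {within coord @` dom, continuous param}
}.

Record smooth_structure (R : realType) (n : nat) (M : topologicalType) := {
  atlas : set (chart R n M);
  atlas_cover : forall p, exists2 c, atlas c & dom c p;
  atlas_compatible : forall c d, atlas c -> atlas d -> forall i : 'I_n,
    smooth_on (coord c @` (dom c `&` dom d))
              (fun x => coord d (param c x) 0 i)
}.

(* The tangent space at p is identified with R^n (row vectors), and the
   cotangent space with column vectors, through the coordinates of a chosen
   chart chart_at S p around p. *)
Definition chart_at (R : realType) (n : nat) (M : topologicalType)
    (S : smooth_structure R n M) (p : M) : chart R n M :=
  projT1 (cid2 (atlas_cover S p)).

Definition jacobian (R : realType) (n : nat) (M : topologicalType)
    (S : smooth_structure R n M) (c : chart R n M) (p : M) : 'M[R]_n :=
  \matrix_(i, j)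
    rpartial i (fun x => coord (chart_at S p) (param c x) 0 j) (coord c p).

(* The matrix in the chart c of a bilinear form on tangent spaces. *)
Definition in_chart (R : realType) (n : nat) (M : topologicalType)
    (S : smooth_structure R n M) (b : M -> 'M[R]_n) (c : chart R n M) (p : M) :
    'M[R]_n :=
  jacobian S c p *m b p *m (jacobian S c p)^T.

Record riemannian_metric (R : realType) (n : nat) (M : topologicalType)
    (S : smooth_structure R n M) := {
  tensor :> M -> 'M[R]_n;
  metric_symmetric : forall p, (tensor p)^T = tensor p;
  metric_positive : forall p (v : 'rV[R]_n), v != 0 ->
    0 < (v *m tensor p *m v^T) 0 0;
  metric_smooth : forall c, atlas S c -> forall i j : 'I_n,
    smooth_on (coord c @` dom c)
              (fun x => in_chart S tensor c (param c x) i j)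
}.

Section Spectrum.
Context {R : realType} {n : nat} {M : ptopologicalType}.
Variables (S : smooth_structure R n M) (g : riemannian_metric S).
Variable v : {measure set (borel M) -> \bar R}.

(* There is exactly one Borel measure with this property. *)
Definition is_volume : Prop :=
  forall c, atlas S c ->
  forall A : set (borel M), measurable A -> A `<=` dom c ->
  v A = (\int[@lebesgue_tuple R n]_(t in
           [set t | (coord c @` A) (tuple_row t)])
           (Num.sqrt (\det (in_chart S g c (param c (tuple_row t)))))%:E)%E.

Definition smooth_function (f : M -> R) : Prop :=
  forall c, atlas S c -> smooth_on (coord c @` dom c) (f \o param c).

Definition differential (f : M -> R) (p : M) : 'cV[R]_n :=
  \col_i rpartial i (f \o param (chart_at S p)) (coord (chart_at S p) p).

Definition sqnorm (w : M -> 'cV[R]_n) (p : M) : R :=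
  ((w p)^T *m invmx (g p) *m w p) 0 0.

Definition measurable_covector (w : M -> 'cV[R]_n) : Prop :=
  forall c, atlas S c -> forall i : 'I_n,
  measurable_fun (dom c : set (borel M))
    (fun p => (jacobian S c p *m w p) i 0 : measurableTypeR R).

(* H^1(M) is the completion of the smooth functions for the H^1 norm, realised
   as the closure of the graph of the differential in L^2 functions times L^2
   covector fields: (u, w) is an H^1 function u with its weak differential w,
   so that |grad u|^2 is sqnorm w. *)
Definition H1 : set ((M -> R) * (M -> 'cV[R]_n)) :=
  [set uw | [/\ measurable_fun [set: borel M] (uw.1 : _ -> measurableTypeR R),
      measurable_covector uw.2 &
      exists f : nat -> M -> R,
      [/\ forall k, smooth_function (f k),
          (\int[v]_p ((f k p - uw.1 p) ^+ 2)%:E)%E @[k --> \oo] --> 0%E &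
          (\int[v]_p (sqnorm (fun q => differential (f k) q - uw.2 q) p)%:E)%E
            @[k --> \oo] --> 0%E]]].

Definition lincomb (m : nat) (e : 'I_m -> (M -> R) * (M -> 'cV[R]_n))
    (a : 'I_m -> R) : (M -> R) * (M -> 'cV[R]_n) :=
  (fun p => \sum_i a i * (e i).1 p, fun p => \sum_i a i *: (e i).2 p).

Definition null (uw : (M -> R) * (M -> 'cV[R]_n)) : Prop :=
  {ae v, forall p, uw.1 p = 0}.

(* S_m: the spans of m elements of H^1(M) that are linearly independent modulo
   equality almost everywhere. *)
Definition subspaces (m : nat) : set (set ((M -> R) * (M -> 'cV[R]_n))) :=
  [set E | exists e : 'I_m -> (M -> R) * (M -> 'cV[R]_n),
     [/\ forall i, H1 (e i),
         forall a : 'I_m -> R, null (lincomb e a) -> forall i, a i = 0 &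
         E = range (lincomb e)]].

Definition rayleigh (rho sigma : M -> R) (uw : (M -> R) * (M -> 'cV[R]_n)) :
    \bar R :=
  ((\int[v]_p (sqnorm uw.2 p * sigma p)%:E) /
   (\int[v]_p (uw.1 p ^+ 2 * rho p)%:E))%E.

Definition mu (k : nat) (rho sigma : M -> R) : \bar R :=
  ereal_inf [set ereal_sup (rayleigh rho sigma @` (E `\` [set uw | null uw]))
            | E in subspaces k.+1].

Definition density (sigma : M -> R) : Prop :=
  continuous sigma /\ forall p, 0 < sigma p.

Definition mu_extremal (k : nat) : \bar R :=
  ereal_sup [set mu k (fun=> 1) sigma | sigma in
    [set sigma | density sigma /\
       ((v [set: borel M])^-1 * \int[v]_p (sigma p)%:E = 1)%E]].

End Spectrum.

(* Main.v *)
(* Let [f] be a function that is a coordinate on some coordinate box, and let [u_i] be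
   finitely many smooth functions whose differentials span every cotangent space.
   For the metric [s^2 (df df^T + b^2 sum_i du_i du_i^T)] one has [|df|^2 <= s^-2],
   and its volume density is [s^n b^(n-1)] times a factor that is bounded on [M] and
   bounded below on the box, uniformly in [b <= 1]. Normalizing the volume to 1 thus
   forces [s] to infinity as [b] tends to 0, because [n >= 2], while the slabs
   [al <= f <= be] keep a volume [>= c0 (be - al)].
   Take bump functions of [f] supported in [2 (k + 1)] disjoint slabs of equal width.
   As the total mass of [sigma] is 1, at least [k + 1] of these slabs have mass at most
   [1 / (k + 1)], and the span of their bump functions gives
   [mu_k (1, sigma) <= K (k + 1)^2 s^-2] with [K] independent of [s], [k] and [sigma].
   Since [mu_0 <= 0] and [(k + 1)^2 <= 4 k^2] for [k > 0], choosing [s] large enough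
   yields the bound even with [C = 1].
   The Riemannian volume is assembled from the charts. The chart densities agree on
   overlaps by a change of variables inequality: locally a transition map is a linear
   map followed by a [(1 + e)]-Lipschitz one. *)
Require Import Defs.
From HB Require Import structures.
From mathcomp Require Import all_boot all_order all_fingroup all_algebra.
From mathcomp Require Import all_classical all_reals all_analysis.
From mathcomp Require finmap.
From mathcomp Require Import measurable_realfun ring lra zify.
Import Order.TTheory GRing.Theory Num.Theory.
Import numFieldNormedType.Exports.
Local Open Scope classical_set_scope.
Local Open Scope ring_scope.
Set Implicit Arguments.
Unset Strict Implicit.
Unset Printing Implicit Defensive.

(** The order of choices is what allows [C = 1]: [f], the range of the slabs and the lower constant
    [c0] are fixed before the bound [dl] on [|df|^2], so the constant of the spectral estimate does
    not see [dl], and [dl] can be taken proportional to the power of [eps]. The metrics have no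
    closed form in [eps]; they are picked for each [eps] separately. The power of [N = k + 1] arises
    as follows: squared slopes of the bumps give [N^2], the light mass gives [1 / N], and the slab
    volume in the denominator gives one more [N]. Disjoint supports make both quadratic forms
    diagonal in the bumps, so one bound on the single bumps serves the whole span. Boundary points
    shape the calculus: derivatives on a chart image are one-sided and are computed on local smooth
    extensions. For volumes only upper bounds on the distortion are proved; exchanging the two
    charts turns them into an equality. *)

Lemma pushforward_sigma_finite_measure d d' (T1 : measurableType d)
    (T2 : measurableType d') (R : realType)
    (m : {measure set T1 -> \bar R}) (f : T1 -> T2) (g : T2 -> T1) :
  sigma_finite setT m -> measurable_fun setT f -> measurable_fun setT g -> cancel f g ->
  exists mu : {sigma_finite_measure set T2 -> \bar R},
    (mu : set T2 -> \bar R) = pushforward m f.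
Proof.
move=> mfin mf mg fK.
pose m0 : set T2 -> \bar R := pushforward m f.
have m00 : m0 set0 = 0%E by rewrite /m0 /pushforward preimage_set0 measure0.
have m0_ge0 A : (0 <= m0 A)%E by exact: measure_ge0.
have m0_sigma : semi_sigma_additive m0.
  exact: (@measure_semi_sigma_additive _ _ _ (pushforward m f)).
pose a := isMeasure.Build _ _ _ m0 m00 m0_ge0 m0_sigma.
have m0_fin : sigma_finite setT m0.
  have /sigma_finiteP[F [TF ndF Foo]] := mfin.
  (* Since [g] is a left inverse of [f], these sets pull back along [f] to the exhausting sets [F k]
     themselves, hence have the same finite mass. *)
  exists (fun k => g @^-1` F k).
    by rewrite -preimage_bigcup -TF preimage_setT.
  move=> k; have [mF Fk] := Foo k; split.
    by rewrite -[X in measurable X]setTI; exact: mg.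
  by rewrite /m0 /pushforward -comp_preimage /comp/= (_ : _ @^-1` _ = F k)//;
    apply/seteqP; split=> x /=; rewrite fK.
pose M0 : {measure set T2 -> \bar R} := HB.pack m0 a.
pose b := @Measure_isSigmaFinite.Build _ _ _ M0 m0_fin.
by exists (HB.pack_for {sigma_finite_measure set T2 -> \bar R} m0 a b).
Qed.

(** Both exhaustions are nondecreasing, so the diagonal products already cover. This keeps the
    recursion of [lebesgue_tuple] within sigma-finite measures, where the next product can be
    formed. *)
Lemma sigma_finite_product d1 d2 (T1 : measurableType d1)
    (T2 : measurableType d2) (R : realType)
    (m1 : {sigma_finite_measure set T1 -> \bar R})
    (m2 : {sigma_finite_measure set T2 -> \bar R}) :
  sigma_finite setT (product_measure1 m1 m2).
Proof.
have /sigma_finiteP[F [TF ndF Foo]] := sigma_finiteT m1.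
have /sigma_finiteP[G [TG ndG Goo]] := sigma_finiteT m2.
exists (fun n => F n `*` G n).
  rewrite -setXTT TF TG; apply/seteqP; split => -[x y] /=.
    move=> [[i _ Fix] [j _ Gjy]]; exists (maxn i j) => //; split.
      by move: x Fix; exact/subsetPset/ndF/leq_maxl.
    by move: y Gjy; exact/subsetPset/ndG/leq_maxr.
  by move=> [i _ [Fix Giy]]; split; exists i.
move=> i; have [mF Fi] := Foo i; have [mG Gi] := Goo i.
split; first exact: measurableX.
by rewrite product_measure1E// lte_mul_pinfty// ge0_fin_numE.
Qed.

(** * Lebesgue measure on tuples *)

Section lebesgue_tuple_measure.
Context {R : realType}.
Local Notation T n := (n.-tuple (measurableTypeR R)).

Lemma lebesgue_tuple_sigma_finite_measure n :
  exists mu : {sigma_finite_measure set (T n) -> \bar R},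
    (mu : set (T n) -> \bar R) = @lebesgue_tuple R n.
Proof.
elim: n => [|n [mu muE]].
  by exists (dirac [tuple] : {sigma_finite_measure set (T 0) -> \bar R}).
pose h := (fun xt : measurableTypeR R * T n =>
  [the n.+1.-tuple (measurableTypeR R) of xt.1 :: xt.2]).
pose k := (fun t : T n.+1 => (thead t, [tuple of behead t])).
rewrite /= -muE.
pose lam : {sigma_finite_measure set (measurableTypeR R) -> \bar R} :=
  @lebesgue_measure R.
have [||||nu nuE] := @pushforward_sigma_finite_measure _ _ _ _ _
    (product_measure1 lam mu) h k.
- exact: sigma_finite_product.
- exact: measurable_cons.
- by apply: measurable_fun_pair; [exact: measurable_tnth|exact: measurable_behead].
- by move=> [x t]; rewrite /h /k /=; congr pair; apply/val_inj.
by exists nu.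
Qed.

(** The same set function as [lebesgue_tuple], bundled so that measure theory applies to it; [lebTE]
    leads back to the bare function in [is_volume]. *)
Definition lebT n : {sigma_finite_measure set (T n) -> \bar R} :=
  projT1 (cid (lebesgue_tuple_sigma_finite_measure n)).

Lemma lebTE n : (lebT n : set (T n) -> \bar R) = @lebesgue_tuple R n.
Proof. by rewrite /lebT; case: cid. Qed.

Lemma lebT_box n (A : 'I_n -> set (measurableTypeR R)) (l : 'I_n -> R) :
  (forall i, measurable (A i)) ->
  (forall i, lebesgue_measure (A i) = (l i)%:E) ->
  lebT n [set t | forall i, A i (tnth t i)] = (\prod_i l i)%:E.
Proof.
rewrite lebTE; elim: n => [|n IH] in A l *.
  move=> _ _; rewrite big_ord0 /= /dirac indicE (_ : _ \in _ = true)//.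
  by apply/mem_set => -[].
move=> mA lA; rewrite big_ord_recl /= /pushforward.
rewrite (_ : _ @^-1` _ =
   A ord0 `*` [set t : T n | forall i, A (lift ord0 i) (tnth t i)]); last first.
  apply/seteqP; split => [[x t] /= H|[x t] /= [H1 H2] i].
    split; first exact: (H ord0).
    by move=> i; have := H (lift ord0 i); rewrite tnthS.
  by case: (unliftP ord0 i) => [j|] ->; rewrite ?tnthS.
rewrite -lebTE product_measure1E// ?lA.
- rewrite lebTE (IH (fun i => A (lift ord0 i)) (fun i => l (lift ord0 i))) ?EFinM//.
  by congr (_ * _)%E; exact: lA.
- rewrite (_ : [set _ | _] = \bigcap_(i : 'I_n)
     ((@tnth n (measurableTypeR R))^~ i @^-1` (A (lift ord0 i)))).
    apply: fin_bigcap_measurable => // i _.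
    by rewrite -[X in measurable X]setTI; exact: measurable_tnth.
  by apply/seteqP; split => t /= H i; [move=> _|]; exact: H.
Qed.

End lebesgue_tuple_measure.

Lemma countable_partition (K : countType) (T : Type) (D : set K)
    (C : K -> set T) : trivIset D C ->
  exists F : nat -> set T,
    [/\ forall j, F j = set0 \/ exists2 i, D i & F j = C i,
        trivIset setT F & \bigcup_(i in D) C i = \bigcup_j F j].
Proof.
move=> tC; pose F m := if @pickle_inv K m is Some i
  then if i \in D then C i else set0 else set0.
exists F; split.
- move=> m; rewrite /F; case: pickle_inv => [i|]; last by left.
  by case: ifPn => [/set_mem Di|_]; [right; exists i|left].
- move=> m m' _ _ [t []]; rewrite /F.
  have := @pickle_invK K m; have := @pickle_invK K m'.
  case: (pickle_inv m) => [i|]//; case: (pickle_inv m') => [i'|]//= <- <-.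
  case: ifPn => // /set_mem Di; case: ifPn => // /set_mem Di' Cit Ci't.
  by rewrite (tC i i' Di Di')//; exists t.
- apply/seteqP; split=> [t [i Di Ct]|t [m _]].
    by exists (pickle i) => //; rewrite /F pickleK_inv (mem_set Di).
  rewrite /F; case: pickle_inv => // i; case: ifPn => // /set_mem Di Ct.
  by exists i.
Qed.

(** * Dyadic cubes *)

Section dyadic.
Context {R : realType} {n : nat}.
Local Notation T := (n.-tuple (measurableTypeR R)).
Implicit Types (s t : T) (U V : set T) (j k : nat) (z : {ffun 'I_n -> int}).

Definition dyadic_index k t : {ffun 'I_n -> int} :=
  [ffun i => Num.floor (2 ^+ k * (tnth t i : R))].

Definition dyadic_cube k z : set T := [set t | dyadic_index k t = z].

(** Openness for the topology generated by half-open dyadic cubes, which is finer than the usual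
    one. Such sets are disjoint countable unions of cubes, hence measurable with computable
    measure. *)
Definition dyadic_open U : Prop :=
  forall t, U t -> exists k, dyadic_cube k (dyadic_index k t) `<=` U.

(** Cubes of different generations are nested because the floor of [2 * a] determines that of [a]:
    twice the floor of [a] is an integer below [2 * a]. *)
Lemma dyadic_index_le j k s t : (j <= k)%N ->
  dyadic_index k s = dyadic_index k t -> dyadic_index j s = dyadic_index j t.
Proof.
move=> jk; rewrite -(subnK jk); elim: (k - j)%N => [//|m IH] st.
apply: IH; apply/ffunP => i; rewrite !ffunE.
have := congr1 (fun f : {ffun _ -> _} => f i) st; rewrite !ffunE addSn exprS.
set x := _ ^+ _ * tnth s i; set y := _ ^+ _ * tnth t i.
rewrite -!mulrA -/x -/y.
suff H (a b : R) : Num.floor (2 * a) = Num.floor (2 * b) ->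
    Num.floor a <= Num.floor b.
  by move=> xy; apply/eqP; rewrite eq_le !H.
move=> ab; rewrite floor_ge_int.
suff : 2 * (Num.floor a)%:~R <= 2 * b by lra.
rewrite -[2]/(2%:~R) -intrM -floor_ge_int -ab floor_ge_int intrM.
by rewrite ler_pM2l// floor_le.
Qed.

Lemma dyadic_cube_box k z : dyadic_cube k z = [set t | forall i,
  [set` `[(z i)%:~R / 2 ^+ k, (z i + 1)%:~R / 2 ^+ k[] (tnth t i)].
Proof.
have p : 0 < 2 ^+ k :> R by rewrite exprn_gt0.
apply/seteqP; split=> t /=.
  move=> <- i; rewrite ffunE in_itv/= ler_pdivrMr// ltr_pdivlMr//.
  by rewrite mulrC floor_itv.
move=> H; apply/ffunP => i; rewrite ffunE; apply/eqP; rewrite floor_eq.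
have := H i; rewrite in_itv/= ler_pdivrMr// ltr_pdivlMr//.
by rewrite mulrC.
Qed.

Lemma measurable_box (A : 'I_n -> set (measurableTypeR R)) :
  (forall i, measurable (A i)) -> measurable [set t : T | forall i, A i (tnth t i)].
Proof.
move=> mA; rewrite (_ : [set _ | _] = \bigcap_(i : 'I_n)
     ((@tnth n (measurableTypeR R))^~ i @^-1` (A i))).
  apply: fin_bigcap_measurable => // i _.
  by rewrite -[X in measurable X]setTI; exact: measurable_tnth.
by apply/seteqP; split => t /= H i; [move=> _|]; exact: H.
Qed.

Lemma measurable_dyadic_cube k z : measurable (dyadic_cube k z).
Proof.
rewrite dyadic_cube_box.
apply: (measurable_box (A := fun i => [set` `[_, _[])) => i.
exact: measurable_itv.
Qed.

Lemma lebT_dyadic_cube k z : lebT n (dyadic_cube k z) = ((2^-1 ^+ k) ^+ n)%:E.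
Proof.
rewrite dyadic_cube_box (lebT_box (A := fun i => [set` `[_, _[])
    (l := fun=> 2^-1 ^+ k)).
- by rewrite prodr_const card_ord.
- by move=> i; exact: measurable_itv.
- move=> i; rewrite lebesgue_measure_itv/= lte_fin.
  have p : 0 < 2 ^+ k :> R by rewrite exprn_gt0.
  rewrite ltr_pM2r ?invr_gt0// ltr_int ifT; last by lia.
  by rewrite -EFinB -mulrBl intrD addrAC subrr add0r mul1r exprVn.
Qed.

Lemma dyadic_open_cube k z : dyadic_open (dyadic_cube k z).
Proof. by move=> t <-; exists k. Qed.

Lemma dyadic_openI U V : dyadic_open U -> dyadic_open V -> dyadic_open (U `&` V).
Proof.
move=> oU oV t [/oU[j jU] /oV[k kV]]; exists (maxn j k) => s st; split.
  by apply: jU; apply: (dyadic_index_le (leq_maxl j k)).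
by apply: kV; apply: (dyadic_index_le (leq_maxr j k)).
Qed.

Lemma dyadic_open_bigcup I (D : set I) (F : I -> set T) :
  (forall i, D i -> dyadic_open (F i)) -> dyadic_open (\bigcup_(i in D) F i).
Proof.
move=> oF t [i Di /(oF _ Di)[k kF]]; exists k => s st.
by exists i => //; exact: kF.
Qed.

(* The cubes kept are the maximal ones contained in [U]. *)
Lemma dyadic_open_partition U : dyadic_open U ->
  exists F : nat -> set T,
    [/\ forall j, F j = set0 \/ exists k z, F j = dyadic_cube k z,
        trivIset setT F & U = \bigcup_j F j].
Proof.
move=> oU.
pose D : set (nat * {ffun 'I_n -> int}) := [set kz |
  dyadic_cube kz.1 kz.2 `<=` U /\ forall j t, (j < kz.1)%N ->
    dyadic_cube kz.1 kz.2 t -> ~ dyadic_cube j (dyadic_index j t) `<=` U].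
have [|F [F0 tF UF]] := @countable_partition _ _ D
  (fun kz => dyadic_cube kz.1 kz.2).
  move=> [k z] [k' z'] /= [zU zm] [z'U z'm] [t [/= tz tz']].
  have kk : k = k'.
    apply: contrapT => /eqP; rewrite neq_ltn => /orP[] lt.
      by apply: (z'm _ t lt tz'); rewrite tz.
    by apply: (zm _ t lt tz); rewrite tz'.
  by rewrite -tz -tz' kk.
exists F; split => //.
  by move=> j; have [->|[[k z] _ ->]] := F0 j; [left|right; exists k, z].
rewrite -UF; apply/seteqP; split=> [t Ut|t [[k z] [/= zU _]]]; last exact: zU.
have [k0 k0U] := oU _ Ut.
have exk : exists k, `[< dyadic_cube k (dyadic_index k t) `<=` U >].
  by exists k0; apply/asboolP.
have /asboolP kU := ex_minnP exk; case: ex_minnP kU => k /asboolP kU km _.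
exists (k, dyadic_index k t) => //; split => //= j s jk st sU.
suff : (k <= j)%N by rewrite leqNgt jk.
by apply: km; apply/asboolP; rewrite -(dyadic_index_le (ltnW jk) st).
Qed.

Lemma dyadic_open_measurable U : dyadic_open U -> measurable U.
Proof.
move=> /dyadic_open_partition[F [F0 _ ->]]; apply: bigcupT_measurable => j.
by have [->//|[k [z ->]]] := F0 j; exact: measurable_dyadic_cube.
Qed.

End dyadic.

(** * Approximation of Borel sets by dyadic open sets *)

Section regularity.
Context {R : realType} {n : nat}.
Local Notation T := (n.-tuple (measurableTypeR R)).
Implicit Types (s t : T) (U V E : set T) (j k : nat) (z : {ffun 'I_n -> int}).

Lemma dyadic_index_dist k s t i : dyadic_index k s = dyadic_index k t ->
  `|tnth s i - tnth t i : R| < 2^-1 ^+ k.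
Proof.
move=> /(congr1 (fun f : {ffun _ -> _} => f i)); rewrite !ffunE => st.
have p : 0 < 2 ^+ k :> R by rewrite exprn_gt0.
rewrite -(ltr_pM2l p) -exprMn divff// expr1n -{1}(gtr0_norm p) -normrM.
rewrite mulrBr ltr_norml.
have := floor_itv (2 ^+ k * tnth s i : R); have := floor_itv (2 ^+ k * tnth t i : R).
by rewrite st !intrD => /andP[? ?] /andP[? ?]; apply/andP; split; lra.
Qed.

Lemma exists_half_expr_lt (d : R) : 0 < d -> exists k, 2^-1 ^+ k < d.
Proof.
move=> d0; have h : `|2^-1 : R| < 1 by rewrite gtr0_norm; lra.
have /cvgrPdist_lt/(_ _ d0)[k _ /(_ k (leqnn k))] := cvg_expr h.
by rewrite sub0r normrN ger0_norm ?exprn_ge0 ?invr_ge0//; exists k.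
Qed.

Lemma dyadic_open_ball U :
  (forall t, U t -> exists2 d : R, 0 < d &
     forall s, (forall i, `|tnth s i - tnth t i : R| < d) -> U s) ->
  dyadic_open U.
Proof.
move=> oU t /oU[d d0 dU]; have [k kd] := exists_half_expr_lt d0.
exists k => s st; apply: dU => i; apply: le_lt_trans kd.
exact/ltW/dyadic_index_dist.
Qed.

Lemma dyadic_open_capn N (V : nat -> set T) :
  (forall j, dyadic_open (V j)) -> dyadic_open (\bigcap_(j in `I_N) V j).
Proof.
move=> oV; elim: N => [|N IH].
  by move=> t _; exists 0%N => s _ j /=; rewrite ltn0.
rewrite IIS bigcap_setU; apply: dyadic_openI => //.
by rewrite bigcap_set1.
Qed.

Variable mu : {measure set T -> \bar R}.
Hypothesis mufin : (mu setT < +oo)%E.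

(** Approximation of [E] from outside by [U] and of its complement by [V]. The condition is
    symmetric under complements, which makes the sigma-algebra argument short. *)
Let regular E := forall e : R, 0 < e -> exists U V,
  [/\ dyadic_open U, dyadic_open V, E `<=` U, ~` E `<=` V &
      (mu (U `&` V) <= e%:E)%E].

(** Continuity from above, where finiteness of [mu] enters. *)
Let mu_capn (W : nat -> set T) (e : R) : (forall N, measurable (W N)) ->
  nonincreasing_seq W -> (mu (\bigcap_N W N) < e%:E)%E ->
  exists N, (mu (W N) <= e%:E)%E.
Proof.
move=> mW niW lt; apply: contrapT => /forallNP H.
have cW : mu \o W @ \oo --> mu (\bigcap_N W N).
  apply: nonincreasing_cvg_mu => //; last exact: bigcapT_measurable.
  by apply: le_lt_trans mufin; apply: le_measure; rewrite ?inE.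
suff : (e%:E <= mu (\bigcap_N W N))%E by rewrite leNgt lt.
rewrite -(cvg_lim _ cW)//; apply: lime_ge; first by apply/cvg_ex; eexists; exact: cW.
by near=> N; have /negP := H N; rewrite -ltNge => /ltW.
Unshelve. all: by end_near. Qed.

Let regular_ray i (a : R) : regular [set t | a <= tnth t i].
Proof.
move=> e e0; pose V := [set t : T | tnth t i < a :> R].
have oV : dyadic_open V.
  apply: dyadic_open_ball => t ta; exists (a - tnth t i); first by rewrite subr_gt0.
  by move=> s /(_ i); rewrite ltr_norml /V /= => /andP[? ?]; lra.
pose U k := [set t : T | a - k.+1%:R^-1 < tnth t i :> R].
have oU k : dyadic_open (U k).
  apply: dyadic_open_ball => t ta; exists (tnth t i - (a - k.+1%:R^-1)).
    by rewrite subr_gt0.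
  move=> s /(_ i); rewrite ltr_norml /U /= => /andP[+ _].
  by set c := _^-1 => H; lra.
have [N lt] : exists N, (mu (U N `&` V) <= e%:E)%E.
  apply: mu_capn.
  - by move=> N; apply: measurableI; exact: dyadic_open_measurable.
  - move=> N M NM; apply/subsetPset => t [/= Ut Vt]; split => //.
    apply: le_lt_trans Ut; rewrite lerD2l lerN2 lef_pV2 ?posrE ?ltr0n//.
    by rewrite ler_nat.
  - rewrite (_ : \bigcap_N _ = set0) ?measure0//.
    apply/seteqP; split=> // t H; have [_ /= ta] := H 0%N I.
    have d0 : 0 < a - tnth t i by rewrite subr_gt0.
    have [k kd] := ltr_add_invr d0; rewrite add0r in kd.
    have [+ _] := H k I; rewrite /U/= ltrBlDr -ltrBlDl => h.
    by move: (lt_trans kd h); rewrite ltxx.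
exists (U N), V; split=> // t /=; last by move/negP; rewrite -ltNge.
by move=> at_; apply: lt_le_trans at_; rewrite ltrBlDr ltrDl invr_gt0 ltr0n.
Qed.

Let regularC E : regular E -> regular (~` E).
Proof.
move=> rE e /rE[U [V [oU oV EU EV UV]]].
by exists V, U; split => //; rewrite ?setCK// setIC.
Qed.

Let regular0 : regular set0.
Proof.
move=> e e0; exists set0, setT; split => //.
- by move=> t _; exists 0%N.
- by rewrite set0I measure0 lee_fin ltW.
Qed.

(** The union of the outer sets is dyadic open, but a countable intersection of the [V j] need not
    be. Finite intersections are used instead, and [mu_capn] picks a good one. The errors add up to
    [e / 2], which leaves the strict inequality that [mu_capn] asks for. *)
Let regular_bigcup (F : nat -> set T) :
  (forall j, regular (F j)) -> regular (\bigcup_j F j).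
Proof.
move=> rF e e0.
have ej j : 0 < e / 2 / (2 ^ j.+1)%:R.
  by rewrite !divr_gt0// ltr0n expn_gt0.
have /choice[UV HUV] : forall j, exists UV : set T * set T,
  [/\ dyadic_open UV.1, dyadic_open UV.2, F j `<=` UV.1, ~` F j `<=` UV.2 &
      (mu (UV.1 `&` UV.2) <= (e / 2 / (2 ^ j.+1)%:R)%:E)%E].
  by move=> j; have [U [V ?]] := rF j _ (ej j); exists (U, V).
pose U := \bigcup_j (UV j).1; pose V N := \bigcap_(j in `I_N) (UV j).2.
have oU : dyadic_open U by apply: dyadic_open_bigcup => j _; have [] := HUV j.
have oV N : dyadic_open (V N) by apply: dyadic_open_capn => j; have [] := HUV j.
have mUV j : measurable ((UV j).1 `&` (UV j).2).
  by have [? ? _ _ _] := HUV j; apply: dyadic_open_measurable; exact: dyadic_openI.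
have [N le] : exists N, (mu (U `&` V N) <= e%:E)%E.
  apply: mu_capn.
  - by move=> N; apply: measurableI; exact: dyadic_open_measurable.
  - move=> N M NM; apply/subsetPset => t [Ut Vt]; split => // j jN.
    by apply: Vt; exact: leq_trans NM.
  - apply: (@le_lt_trans _ _ (e / 2)%:E); last by rewrite lte_fin; lra.
    apply: (@le_trans _ _ (\sum_(j <oo) mu ((UV j).1 `&` (UV j).2))%E).
      apply: measure_sigma_subadditive => //.
        apply: bigcapT_measurable => N.
        by apply: measurableI; exact: dyadic_open_measurable.
      move=> t H; have [[j _ Ut] _] := H 0%N I.
      by exists j => //; split=> //; have [_ +] := H j.+1 I; apply => /=.
    apply: le_trans (epsilon_trick0 _ _); last by apply/ltW; rewrite divr_gt0.
    by apply: lee_nneseries => [j *|j *]; [exact: measure_ge0|have [_ _ _ _] := HUV j].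
exists U, (V N); split => //.
  by move=> t [j _ Ft]; exists j => //; have [_ _ + _ _] := HUV j; apply.
move=> t Ft j _; have [_ _ _ + _] := HUV j; apply => Fjt.
by apply: Ft; exists j.
Qed.

(** Regular sets form a sigma-algebra that contains the coordinate rays, and these generate all
    measurable sets of tuples. *)
Lemma dyadic_regular E : measurable E -> forall e : R, 0 < e -> exists U V,
  [/\ dyadic_open U, dyadic_open V, E `<=` U, ~` E `<=` V &
      (mu (U `&` V) <= e%:E)%E].
Proof.
have sr : sigma_algebra setT regular.
  by split=> // A /regularC; rewrite setTD.
suff : measurable `<=` regular by move=> + mE; apply.
apply: smallest_sub => //.
rewrite -bigcup_seq => A [i _ [B mB <-]]; rewrite setTI.
move: B mB; rewrite (_ : @measurable _ (measurableTypeR R) = (@measurable_realfun.RGenCInfty.G R).-sigma.-measurable);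
  last exact: measurable_realfun.RGenCInfty.measurableE.
apply: smallest_sub.
  split.
  - by rewrite /mkset preimage_set0.
  - by move=> A0 /regularC; rewrite setTD preimage_setC.
  - by move=> F rF /=; rewrite preimage_bigcup; exact: regular_bigcup.
move=> _ [a ->] /=; rewrite (_ : _ @^-1` _ = [set t | a <= tnth t i]).
  exact: regular_ray.
by apply/seteqP; split => t /=; rewrite in_itv/= andbT.
Qed.

End regularity.

(** * Measure of Lipschitz images *)

Section lipschitz.
Context {R : realType} {n : nat}.
Local Notation T := (n.-tuple (measurableTypeR R)).
Local Notation lam := (lebT n).
Implicit Types (s t : T) (U V E B : set T) (j k : nat) (d : R).

(** Each coordinate projection of [B] lies in the interval of length [d i] that starts at its
    infimum. *)
Lemma lebT_diameter B (d : 'I_n -> R) : (forall i, 0 <= d i) -> measurable B ->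
  (forall s t, B s -> B t -> forall i, `|tnth s i - tnth t i : R| <= d i) ->
  (lam B <= (\prod_i d i)%:E)%E.
Proof.
move=> d0 mB dB; have [->|/set0P[t0 Bt0]] := eqVneq B set0.
  by rewrite measure0 lee_fin prodr_ge0.
pose S i := [set (tnth t i : R) | t in B].
have infS i : has_inf (S i).
  split; first by exists (tnth t0 i), t0.
  exists (tnth t0 i - d i) => _ [t Bt <-].
  by have := dB _ _ Bt0 Bt i; rewrite ler_norml => /andP[_]; lra.
pose A i : set (measurableTypeR R) := [set` `[inf (S i), inf (S i) + d i]].
have BA : B `<=` [set t | forall i, A i (tnth t i)].
  move=> t Bt i; rewrite /A /= in_itv /=; apply/andP; split.
    by apply: inf_lbound; [exact: (infS i).2|exists t].
  rewrite -lerBlDr; apply: lb_le_inf; first exact: (infS i).1.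
  move=> _ [s Bs <-]; have := dB _ _ Bt Bs i.
  by rewrite ler_norml => /andP[_]; lra.
have mA i : measurable (A i) by exact: measurable_itv.
apply: (@le_trans _ _ (lam [set t | forall i, A i (tnth t i)])).
  by apply: le_measure => //; rewrite inE//; exact: measurable_box.
rewrite (lebT_box (l := d))// => i.
 rewrite /A lebesgue_measure_itv /= lte_fin.
case: ifPn => [_|]; first by rewrite -EFinB addrAC subrr add0r.
by rewrite -leNgt gerDl => ?; congr EFin; apply/eqP; rewrite eq_le d0 ?andbT ?andTb.
Qed.

(** Restricting Lebesgue measure to [Q] makes it finite, so that regularity applies. The cubes
    partition [U] within [Q], and what they contain besides [E] lies in [U] and [V]. *)
Lemma lebT_dyadic_cover Q k z E e : Q = dyadic_cube k z -> measurable E ->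
  E `<=` Q -> 0 < e -> exists F : nat -> set T,
  [/\ forall j, F j = set0 \/ exists k z, F j = dyadic_cube k z,
      E `<=` \bigcup_j F j & (\sum_(j <oo) lam (F j) <= lam E + e%:E)%E].
Proof.
move=> QE mE EQ e0.
have mQ : measurable Q by rewrite QE; exact: measurable_dyadic_cube.
have oQ : dyadic_open Q by rewrite QE; exact: dyadic_open_cube.
have [|U [V [oU oV EU EV UV]]] := @dyadic_regular _ _ (mrestr lam mQ) _ _ mE _ e0.
  by rewrite /= /mrestr setTI QE lebT_dyadic_cube ltry.
have oUQ := dyadic_openI oU oQ.
have [F [F0 tF UF]] := dyadic_open_partition oUQ.
have mF j : measurable (F j).
  by have [->//|[k' [z' ->]]] := F0 j; exact: measurable_dyadic_cube.
exists F; split => //.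
  by rewrite -UF => t Et; split; [exact: EU|exact: EQ].
rewrite -measure_semi_bigcup// -?UF//; last exact: dyadic_open_measurable.
have mUQ := dyadic_open_measurable oUQ.
have mUVQ : measurable (U `&` V `&` Q).
  by apply: dyadic_open_measurable; do 2 apply: dyadic_openI => //.
apply: (@le_trans _ _ (lam (E `|` (U `&` V `&` Q)))).
  apply: le_measure; rewrite ?inE//; first exact: measurableU.
  move=> t [Ut Qt]; have [Et|nEt] := pselect (E t); [by left|right].
  by split => //; split => //; exact: EV.
apply: le_trans (leeD2l _ UV).
rewrite /= /mrestr; exact: measureU2.
Qed.

Section image.
Variables (K : 'I_n -> R) (F : T -> T) (E : set T).
Hypotheses (K0 : forall i, 0 < K i)
  (mF : forall A, A `<=` E -> measurable A -> measurable (F @` A))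
  (FK : forall d, 0 <= d -> forall s t, E s -> E t ->
    (forall i, `|tnth s i - tnth t i : R| <= d) ->
    forall i, `|tnth (F s) i - tnth (F t) i : R| <= K i * d).

(** Cover [A] by cubes of total measure close to its own; a piece in a cube of side [2^-k] has an
    image of width at most [K i * 2^-k] in direction [i]. *)
Let lipschitz_cube k z A : A `<=` E -> measurable A ->
  A `<=` dyadic_cube k z -> (lam (F @` A) <= (\prod_i K i)%:E * lam A)%E.
Proof.
move=> AE mA AQ; have Kn : 0 < \prod_i K i by rewrite prodr_gt0.
apply/lee_addgt0Pr => e e0.
have eK : 0 < e / \prod_i K i by rewrite divr_gt0.
have [G [G0 AG leG]] := lebT_dyadic_cover (erefl _) mA AQ eK.
have mG j : measurable (G j).
  by have [->//|[k' [z' ->]]] := G0 j; exact: measurable_dyadic_cube.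
have mAG j : measurable (F @` (A `&` G j)).
  by apply: mF; [move=> t [/AE]|exact: measurableI].
apply: (@le_trans _ _ (\sum_(j <oo) lam (F @` (A `&` G j)))%E).
  apply: measure_sigma_subadditive => //; first exact: mF.
  move=> _ [t At <-]; have [j _ Gt] := AG _ At.
  by exists j => //; exists t.
apply: (@le_trans _ _ (\sum_(j <oo) ((\prod_i K i)%:E * lam (G j)))%E); last first.
  rewrite nneseriesZl//.
  apply: (@le_trans _ _ ((\prod_i K i)%:E * (lam A + (e / \prod_i K i)%:E))%E).
    by rewrite lee_pmul2l ?lte_fin.
  rewrite ge0_muleDr ?measure_ge0 ?lee_fin ?(ltW eK)// -EFinM.
  by rewrite [(\prod_i _) * _]mulrC divfK// gt_eqF.
apply: lee_nneseries => [j *|j *]; first exact: measure_ge0.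
have [Gj|[k' [z' Gj]]] := G0 j.
  by rewrite Gj setI0 image_set0 measure0 mule0.
rewrite Gj lebT_dyadic_cube -EFinM -[X in _ ^+ X]card_ord -prodr_const -big_split.
apply: lebT_diameter.
- by move=> i; rewrite mulr_ge0 ?exprn_ge0 ?invr_ge0// ltW.
- by rewrite -Gj.
- move=> _ _ [s [As Qs] <-] [t [At Qt] <-]; apply: FK.
  + by rewrite exprn_ge0// invr_ge0.
  + exact: AE.
  + exact: AE.
  + by move=> i; apply/ltW/dyadic_index_dist; rewrite Qs Qt.
Qed.

(** A separate constant per coordinate makes the bound sharp for diagonal maps. Measurability of the
    images is assumed because a Lipschitz image of a Borel set need not be Borel; the maps to which
    this is applied have measurable inverses on the relevant sets. *)
Lemma lebT_lipschitz_image : measurable E ->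
  (lam (F @` E) <= (\prod_i K i)%:E * lam E)%E.
Proof.
move=> mE; have Kn : 0 < \prod_i K i by rewrite prodr_gt0.
have [|G [G0 tG TG]] := @dyadic_open_partition R n setT.
  by move=> t _; exists 0%N.
have mG j : measurable (G j).
  by have [->//|[k' [z' ->]]] := G0 j; exact: measurable_dyadic_cube.
have mEG j : measurable (E `&` G j) by exact: measurableI.
apply: (@le_trans _ _ (\sum_(j <oo) lam (F @` (E `&` G j)))%E).
  apply: measure_sigma_subadditive => //.
  - by move=> j; apply: mF => //; move=> t [].
  - exact: mF.
  - move=> _ [t Et <-]; have : setT t by [].
    by rewrite TG => -[j _ Gt]; exists j => //; exists t.
apply: (@le_trans _ _ (\sum_(j <oo) ((\prod_i K i)%:E * lam (E `&` G j)))%E).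
  apply: lee_nneseries => [j *|j *]; first exact: measure_ge0.
  have [Gj|[k' [z' Gj]]] := G0 j.
    by rewrite Gj setI0 image_set0 measure0 mule0.
  apply: (@lipschitz_cube k' z') => //; last by rewrite -Gj; move=> t [].
rewrite nneseriesZl//.
rewrite lee_pmul2l ?lte_fin//.
rewrite -measure_semi_bigcup//.
- by rewrite -setI_bigcupr -TG setIT.
- by apply: trivIset_setIl.
- by rewrite -setI_bigcupr -TG setIT.
Qed.

End image.
End lipschitz.

(** Letting [d] tend to 0 from the right removes the factors [1 + d] left by local
    approximations. *)
Lemma le_expr1D_mul (R : realType) (m : nat) (x y : \bar R) : (0 <= y)%E ->
  (forall d : R, 0 < d -> (x <= ((1 + d) ^+ m)%:E * y)%E) -> (x <= y)%E.
Proof.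
case: y => [y|_ _|//]; [|exact: leey]; rewrite lee_fin => y0 H.
have c : (((1 + d) ^+ m * y)%:E : \bar R) @[d --> 0^'+] --> (y%:E).
  apply: cvg_EFin; first by near=> d.
  rewrite -[X in _ --> X](_ : (1 + 0) ^+ m * y = _); last by rewrite addr0 expr1n mul1r.
  apply: cvg_at_right_filter; apply: cvgM; last exact: cvg_cst.
  apply: (@continuous_comp _ _ _ (fun d : R => 1 + d) (fun u => u ^+ m)).
    by apply: cvgD; [exact: cvg_cst|exact: cvg_id].
  exact: exprn_continuous.
rewrite -(cvg_lim _ c)//; apply: lime_ge; first by apply/cvg_ex; eexists; exact: c.
near=> d; rewrite EFinM; apply: H; near: d; exact: nbhs_right_gt.
Unshelve. all: by end_near. Qed.

(** * Measure of linear images *)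

Section linear.
Context {R : realType} {n : nat}.
Local Notation T := (n.-tuple (measurableTypeR R)).
Local Notation lam := (lebT n).
Implicit Types (A B : 'M[R]_n) (c : R) (E : set T).

Definition row_tuple (x : 'rV[R]_n) : T := [tuple x 0 i | i < n].

Lemma tuple_rowK : cancel (@tuple_row R n) row_tuple.
Proof. by move=> t; apply: eq_from_tnth => i; rewrite tnth_mktuple mxE. Qed.

Lemma row_tupleK : cancel row_tuple (@tuple_row R n).
Proof. by move=> x; apply/rowP => i; rewrite mxE tnth_mktuple. Qed.

Definition mxmap A (t : T) : T := row_tuple (tuple_row t *m A).

Lemma mxmapE A t i : tnth (mxmap A t) i = \sum_j (tnth t j : R) * A j i.
Proof. by rewrite tnth_mktuple mxE; apply: eq_bigr => j _; rewrite mxE. Qed.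

Lemma mxmapM A B t : mxmap B (mxmap A t) = mxmap (A *m B) t.
Proof. by rewrite /mxmap row_tupleK mulmxA. Qed.

Lemma mxmap1 t : mxmap 1%:M t = t.
Proof. by rewrite /mxmap mulmx1 tuple_rowK. Qed.

Lemma measurable_mxmap A : measurable_fun setT (mxmap A).
Proof.
apply/measurable_fun_tnthP => i.
rewrite (_ : _ \o _ = (fun t => \sum_j (tnth t j : R) * A j i)); last first.
  by apply/funext => t; exact: mxmapE.
apply: measurable_sum => j; apply: measurable_funM => //.
exact: measurable_tnth.
Qed.

Lemma mxmap_image A E : A \in unitmx -> mxmap A @` E = mxmap (invmx A) @^-1` E.
Proof.
move=> uA; apply/seteqP; split=> [_ [t Et <-]|t Et] /=.
  by rewrite mxmapM mulmxV// mxmap1.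
by exists (mxmap (invmx A) t) => //; rewrite mxmapM mulVmx// mxmap1.
Qed.

Lemma measurable_mxmap_image A E : A \in unitmx -> measurable E ->
  measurable (mxmap A @` E).
Proof.
move=> uA mE; rewrite mxmap_image// -[X in measurable X]setTI.
exact: measurable_mxmap.
Qed.

(** Only an upper bound is recorded, which is stable under products and enough for the comparison of
    charts. Invertibility is included so that images stay measurable. *)
Definition dilation_le A c : Prop := A \in unitmx /\
  forall E, measurable E -> (lam (mxmap A @` E) <= c%:E * lam E)%E.

Lemma dilation_leM A B c d : 0 <= d -> dilation_le A c -> dilation_le B d ->
  dilation_le (A *m B) (c * d).
Proof.
move=> d0 [uA cA] [uB dB]; split; first by rewrite unitmx_mul uA uB.
move=> E mE; rewrite (_ : _ @` _ = mxmap B @` (mxmap A @` E)); last first.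
  by rewrite image_comp; congr (_ @` _); apply/funext => t /=; rewrite mxmapM.
apply: le_trans (dB _ _) _; first exact: measurable_mxmap_image.
rewrite mulrC EFinM -muleA; apply: lee_wpmul2l; first by rewrite lee_fin.
exact: cA.
Qed.

Lemma dilation_le_lipschitz A (K : 'I_n -> R) : A \in unitmx ->
  (forall i, 0 < K i) -> (forall i, \sum_j `|A j i| <= K i) ->
  dilation_le A (\prod_i K i).
Proof.
move=> uA K0 AK; split => // E mE; apply: lebT_lipschitz_image => //.
  by move=> B _; exact: measurable_mxmap_image.
move=> d d0 s t _ _ st i; rewrite !mxmapE -sumrB.
apply: le_trans (ler_norm_sum _ _ _) _.
apply: (@le_trans _ _ (\sum_j `|A j i| * d)); last first.
  by rewrite -mulr_suml ler_wpM2r.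
apply: ler_sum => j _; rewrite -mulrBl normrM mulrC.
by apply: ler_wpM2l => //; exact: st.
Qed.

Lemma dilation_le_diag (d : 'rV[R]_n) : (forall i, d 0 i != 0) ->
  dilation_le (diag_mx d) (\prod_i `|d 0 i|).
Proof.
move=> d0; apply: dilation_le_lipschitz.
- by rewrite unitmxE det_diag unitfE prodf_seq_neq0; apply/allP => i _ /=.
- by move=> i; rewrite normr_gt0.
- move=> i; rewrite (bigD1 i)//= mxE eqxx mulr1n big1 ?addr0// => j ji.
  by rewrite mxE (negbTE ji) mulr0n normr0.
Qed.

Lemma dilation_le_perm (s : 'S_n) : dilation_le (perm_mx s) 1.
Proof.
rewrite -[X in dilation_le _ X](_ : \prod_(i < n) (1 : R) = _); last by rewrite big1.
apply: dilation_le_lipschitz; first exact: unitmx_perm.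
  by [].
move=> i; rewrite (bigD1 ((s^-1)%g i))//= !mxE permKV eqxx normr1 big1 ?addr0// => j ji.
rewrite !mxE; case: eqP => [sj|]; last by rewrite normr0.
by move: ji; rewrite -sj permK eqxx.
Qed.

(* Conjugation by diag(t^w) shrinks the off-diagonal entries to 0 as t grows. *)
Lemma dilation_le_unitriangular A (w : 'I_n -> nat) :
  A \in unitmx -> (forall i, A i i = 1) ->
  (forall i j, i != j -> A i j != 0 -> (w i < w j)%N) -> dilation_le A 1.
Proof.
move=> uA A1 Aw; split => // E mE.
rewrite mul1e; apply: (@le_expr1D_mul _ n); first exact: measure_ge0.
move=> d d0; pose C := \sum_i \sum_j `|A i j|.
have C0 : 0 <= C by apply: sumr_ge0 => i _; exact: sumr_ge0.
(* Off the diagonal, the conjugate has entries bounded by [|A i j| / t], and this choice gives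
   [C / t <= d], so that its column sums are at most [1 + d]. The dilations of the two diagonal
   factors cancel at the end. *)
pose t := 1 + C / d.
have t1 : 1 <= t by rewrite /t lerDl divr_ge0// ltW.
have t0 : 0 < t by lra.
pose D : 'rV[R]_n := \row_i t ^+ w i.
pose D' : 'rV[R]_n := \row_i t ^- w i.
have DD' : diag_mx D *m diag_mx D' = 1%:M.
  rewrite mulmx_diag -diag_const_mx; congr diag_mx; apply/rowP => i.
  by rewrite !mxE divff// expf_neq0// gt_eqF.
have D'D : diag_mx D' *m diag_mx D = 1%:M by exact: mulmx1C.
have AE : A = diag_mx D' *m (diag_mx D *m A *m diag_mx D') *m diag_mx D.
  by rewrite -!mulmxA D'D mulmx1 mulmxA D'D mul1mx.
have tw i : 0 < t ^+ w i by rewrite exprn_gt0.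
have dD : dilation_le (diag_mx D) (\prod_i t ^+ w i).
  have := @dilation_le_diag D; rewrite (eq_bigr (fun i => t ^+ w i)); last first.
    by move=> i _; rewrite mxE gtr0_norm.
  by apply => i; rewrite mxE gt_eqF.
have dD' : dilation_le (diag_mx D') (\prod_i t ^- w i).
  have := @dilation_le_diag D'; rewrite (eq_bigr (fun i => t ^- w i)); last first.
    by move=> i _; rewrite mxE gtr0_norm// invr_gt0.
  by apply => i; rewrite mxE invr_neq0// gt_eqF.
have dM : dilation_le (diag_mx D *m A *m diag_mx D') (\prod_(i < n) (1 + d)).
  apply: dilation_le_lipschitz.
  - by rewrite !unitmx_mul uA dD.1 dD'.1.
  - by move=> i; lra.
  move=> i; rewrite (bigD1 i)//=; apply: lerD.
    rewrite -mulmxA mul_diag_mx mul_mx_diag !mxE A1 mul1r divff ?normr1//.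
    by rewrite gt_eqF.
  apply: (@le_trans _ _ (C / t)); last first.
    rewrite ler_pdivrMr// /t mulrDr mulr1 mulrC divfK ?gt_eqF//.
    by rewrite lerDr ltW.
  have Ci : \sum_j `|A j i| <= C.
    rewrite /C exchange_big [leRHS](bigD1 i)//= lerDl.
    by apply: sumr_ge0 => k _; exact: sumr_ge0.
  apply: (@le_trans _ _ ((\sum_j `|A j i|) / t)); last first.
    by rewrite ler_pM2r ?invr_gt0.
  rewrite mulr_suml big_mkcond; apply: ler_sum => j _; case: ifP => [ji|_]; last first.
    by rewrite divr_ge0// ltW.
  rewrite -mulmxA mul_diag_mx mul_mx_diag !mxE.
  have [->|Aji] := eqVneq (A j i) 0; first by rewrite mul0r mulr0 normr0 mul0r.
  have wji := Aw _ _ ji Aji.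
  rewrite mulrCA normrM ler_wpM2l// gtr0_norm ?divr_gt0//.
  rewrite ler_pdivrMr// -[X in _ <= _ * t ^+ X](subnKC wji) addSn exprS mulKf ?gt_eqF//.
  by rewrite exprD ler_peMr ?exprn_ge0 ?(ltW t0)// exprn_ege1.
have p0 : 0 <= \prod_i t ^+ w i by rewrite prodr_ge0// => i _; rewrite ltW.
have q0 : 0 <= \prod_(i < n) (1 + d) by rewrite prodr_ge0// => i _; lra.
have [_ H] := dilation_leM p0 (dilation_leM q0 dD' dM) dD.
rewrite AE; apply: le_trans (H _ mE) _; rewrite mulrAC -big_split /= big1.
  by rewrite mul1r prodr_const card_ord.
by move=> i _; rewrite mulVf// gt_eqF.
Qed.

End linear.

(** By the LUP decomposition [A] is a permutation times a lower unitriangular matrix times a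
    diagonal one times an upper unitriangular one. Only the diagonal factor distorts measure, and
    its factor is [|\det A|]. The weights [n - i] and [i] increase along the nonzero off-diagonal
    entries of the two unitriangular factors. Size 0 is treated apart because the decomposition is
    stated for positive size. *)
Lemma dilation_le_det (R : realType) (n : nat) (A : 'M[R]_n) :
  A \in unitmx -> dilation_le A `|\det A|.
Proof.
case: n A => [|n] A uA.
  split => // E mE; rewrite det_mx00 normr1 mul1e.
  rewrite (_ : _ @` _ = E)//; apply/seteqP; split=> [_ [t Et <-]|t Et].
    by rewrite (_ : mxmap A t = t)//; apply: eq_from_tnth => -[].
  by exists t => //; apply: eq_from_tnth => -[].
have := cormen_lup_correct A; have := cormen_lup_perm A; have := cormen_lup_detL A.
have := @cormen_lup_lower _ _ A; have := @cormen_lup_upper _ _ A.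
case: cormen_lup => -[P L] U /= Uu Ll dL /is_perm_mxP[s ->{P}] PLU.
have dU : \det U = \prod_i U i i.
  rewrite -det_tr det_trig; first by apply: eq_bigr => i _; rewrite mxE.
  by apply/is_trig_mxP => i j ij; rewrite mxE Uu.
have PLU' : perm_mx s *m A = L *m U by [].
have AE : A = perm_mx s^-1%g *m (L *m U).
  by rewrite -PLU' mulmxA -perm_mxM mulVg perm_mx1 mul1mx.
have uU : U \in unitmx.
  by move: uA; rewrite AE !unitmx_mul => /andP[_ /andP[]].
have U0 i : U i i != 0.
  move: uU; rewrite unitmxE dU unitfE => /prodf_neq0; exact.
pose d : 'rV[R]_n.+1 := \row_i U i i.
pose d' : 'rV[R]_n.+1 := \row_i (U i i)^-1.
have UE : U = diag_mx d *m (diag_mx d' *m U).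
  rewrite mulmxA mulmx_diag (_ : (\row_i _) = const_mx 1) ?diag_const_mx ?mul1mx//.
  by apply/rowP => i; rewrite !mxE divff.
have uL : L \in unitmx by rewrite unitmxE dL unitr1.
have hL : dilation_le L 1.
  apply: (@dilation_le_unitriangular _ _ _ (fun i => n - i)%N) => //.
    by move=> i; rewrite Ll// eqxx.
  move=> i j ij; case: (ltnP j i) => [ji _|ij']; last by rewrite Ll// (negbTE ij) eqxx.
  by have := ltn_ord i; lia.
have hd : dilation_le (diag_mx d) (\prod_i `|U i i|).
  have := @dilation_le_diag _ _ d; rewrite (eq_bigr (fun i => `|U i i|)).
    by apply => i; rewrite mxE.
  by move=> i _; rewrite mxE.
have hU : dilation_le (diag_mx d' *m U) 1.
  apply: (@dilation_le_unitriangular _ _ _ (fun i => i)) => //.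
  - by move: uU; rewrite {1}UE unitmx_mul => /andP[].
  - by move=> i; rewrite mul_diag_mx !mxE mulVf.
  - move=> i j ij; rewrite mul_diag_mx !mxE; case: (ltnP i j) => // ji.
    have ji' : (j < i)%N by rewrite ltn_neqAle ji andbT eq_sym.
    by rewrite (Uu _ _ ji') mulr0 eqxx.
have -> : `|\det A| = 1 * (1 * (\prod_i `|U i i| * 1)).
  rewrite {1}AE !det_mulmx dL !mul1r mulr1 det_perm normrM normr_sign mul1r.
  by rewrite dU normr_prod.
have p0 : 0 <= \prod_i `|U i i| by rewrite prodr_ge0.
rewrite [X in dilation_le X _]AE.
apply: dilation_leM; [by rewrite mul1r mulr1|exact: dilation_le_perm|].
apply: dilation_leM; [by rewrite mulr1|exact: hL|].
by rewrite {1}UE; apply: dilation_leM.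
Qed.

(** * Smooth calculus *)

Section rV_norm.
Context {R : realType} {n : nat}.
Implicit Types (x y : 'rV[R]_n).

Lemma nbhs_rVP x (A : set 'rV[R]_n) : nbhs x A <->
  exists2 d : R, 0 < d & forall y, (forall i, `|y 0 i - x 0 i| < d) -> A y.
Proof.
split.
  move=> /nbhs_ballP[d /= d0 dA]; exists d => // y yx; apply: dA; split => //.
  by move=> i j; rewrite ord1 /ball /= distrC.
move=> [d d0 dA]; apply/nbhs_ballP; exists d => // y [_ yx]; apply: dA => i.
by have := yx 0 i; rewrite /ball /= distrC.
Qed.

End rV_norm.

Section partial.
Context {R : realType} {n : nat}.
Implicit Types (V : set 'rV[R]_n) (F G : 'rV[R]_n -> R) (x : 'rV[R]_n).

Lemma partial_is_derive_line F x i (a : R) :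
  derivable F (x + a *: basis_vector i) (basis_vector i) ->
  is_derive a 1 (fun s => F (x + s *: basis_vector i))
    (partial i F (x + a *: basis_vector i)).
Proof.
move=> dF; have E : (fun h => h^-1 *: (((fun s => F (x + s *: basis_vector i)) \o
    shift a) (h *: (1 : R)) - F (x + a *: basis_vector i))) =
  (fun h => h^-1 *: ((F \o shift (x + a *: basis_vector i)) (h *: basis_vector i) -
    F (x + a *: basis_vector i))).
  apply/funext => h /=; congr (_ *: (F _ - _)).
  by rewrite [h *: _]mulr1 scalerDl addrCA.
by apply: DeriveDef; rewrite /derivable /derive/= E.
Qed.

Lemma partial_mean_value F x i (a b : R) : a <= b ->
  (forall s, a <= s <= b -> derivable F (x + s *: basis_vector i) (basis_vector i)) ->
  exists2 c, a <= c <= b & F (x + b *: basis_vector i) - F (x + a *: basis_vector i) =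
     partial i F (x + c *: basis_vector i) * (b - a).
Proof.
move=> ab dF.
have [||c] := @MVT_segment R (fun s => F (x + s *: basis_vector i))
  (fun s => partial i F (x + s *: basis_vector i)) a b ab.
- move=> s; rewrite in_itv/= => /andP[? ?]; apply: partial_is_derive_line.
  by apply: dF; apply/andP; split; exact: ltW.
- apply: derivable_within_continuous => s; rewrite in_itv/= => sab.
  by have [] := partial_is_derive_line (dF _ sab).
- by rewrite in_itv/= => cab ->; exists c.
Qed.

Lemma partial_mean_value_dist F x i (a b l e : R) :
  (forall s, Num.min a b <= s <= Num.max a b ->
     derivable F (x + s *: basis_vector i) (basis_vector i) /\
     `|partial i F (x + s *: basis_vector i) - l| <= e) ->
  `|F (x + b *: basis_vector i) - F (x + a *: basis_vector i) - (b - a) * l|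
    <= e * `|b - a|.
Proof.
move=> dF.
have [c cab ->] : exists2 c, Num.min a b <= c <= Num.max a b &
    F (x + b *: basis_vector i) - F (x + a *: basis_vector i) =
    partial i F (x + c *: basis_vector i) * (b - a).
  have [ab|ba] := leP a b.
    apply: partial_mean_value => // s sab.
    by have [] := dF s _; rewrite // min_l// max_r.
  have [s sab|c cab E] := @partial_mean_value F x i b a (ltW ba).
    by have [] := dF s _; rewrite // min_r ?max_l ?(ltW ba).
  by exists c => //; rewrite -opprB E -mulrN opprB.
rewrite [_ * l]mulrC -mulrBl normrM ler_wpM2r//.
by have [] := dF c cab.
Qed.

(** Both points [y] and [z] vary, as the Lipschitz estimate for transition maps demands. One
    coordinate is exchanged at a time, and the mean value theorem is applied on each segment. *)
Lemma partial_strict_differentiability V F x : open V -> V x ->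
  (forall y i, V y -> derivable F y (basis_vector i)) ->
  (forall i, {for x, continuous (partial i F)}) ->
  forall e : R, 0 < e -> exists2 d : R, 0 < d & forall y z : 'rV[R]_n,
    (forall i, `|y 0 i - x 0 i| < d) -> (forall i, `|z 0 i - x 0 i| < d) ->
    `|F y - F z - \sum_i (y 0 i - z 0 i) * partial i F x|
      <= e * \sum_i `|y 0 i - z 0 i|.
Proof.
move=> oV Vx dF cF e e0.
have : \forall y \near x, V y /\ forall i, `|partial i F y - partial i F x| <= e.
  near=> y; split; first by near: y; exact: open_nbhs_nbhs.
  move=> i; rewrite distrC; move: i; near: y; apply: filter_forall => i.
  by have /cvgrPdist_le/(_ _ e0) := cF i.
move=> /nbhs_rVP[d d0 dVF]; exists d => // y z yx zx.
pose w k : 'rV[R]_n := \row_i if (i < k)%N then y 0 i else z 0 i.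
have -> : F y - F z = \sum_(i < n) (F (w i.+1) - F (w i)).
  rewrite -(big_mkord xpredT (fun i => F (w i.+1) - F (w i))) telescope_sumr//.
  congr (F _ - F _); apply/rowP => i; rewrite mxE ?ltn_ord//.
rewrite -sumrB mulr_sumr; apply: le_trans (ler_norm_sum _ _ _) _.
apply: ler_sum => k _.
(* The base point, with coordinate [k] set to 0, of the line that carries both [w k] and
   [w k.+1]. *)
pose p : 'rV[R]_n := \row_i if (i < k)%N then y 0 i else if i == k then 0 else z 0 i.
have pE (s : R) i : (p + s *: basis_vector k) 0 i =
    if (i < k)%N then y 0 i else if i == k then s else z 0 i.
  rewrite !mxE eqxx/=; case: (eqVneq i k) => [->|ik].
    by rewrite ltnn mulr1 add0r.
  by rewrite mulr0 addr0.
have -> : w k.+1 = p + y 0 k *: basis_vector k.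
  apply/rowP => i; rewrite pE mxE ltnS leq_eqVlt -[_ == _ :> nat]/(i == k).
  by case: (eqVneq i k) => [->|_]; rewrite ?ltnn.
have -> : w k = p + z 0 k *: basis_vector k.
  apply/rowP => i; rewrite pE mxE.
  by case: (eqVneq i k) => [->|_]; rewrite ?ltnn.
apply: partial_mean_value_dist => s sab.
suff H : forall i, `|(p + s *: basis_vector k) 0 i - x 0 i| < d.
  by split; [apply: dF; exact: (dVF _ H).1|exact: (dVF _ H).2].
move=> i; rewrite pE; case: ifP => // _; case: eqP => // ->.
have := yx k; have := zx k; rewrite !ltr_norml => /andP[? ?] /andP[? ?].
move: sab; rewrite ge_min le_max => /andP[/orP[] ? /orP[] ?]; apply/andP; split; lra.
Unshelve. all: by end_near. Qed.

End partial.

(* [Fl] is meant to be [0^'] (derivatives) or [0^'+] (right derivatives). *)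
Lemma curve_chain_rule (R : realType) (n : nat) (G : 'rV[R]_n -> R)
    (a : 'rV[R]_n) (D : 'I_n -> R) (Fl : set_system R) (FF : ProperFilter Fl)
    (c : R -> 'rV[R]_n) (v : 'I_n -> R) :
  (forall e : R, 0 < e -> \forall y \near a,
    `|G y - G a - \sum_j (y 0 j - a 0 j) * D j| <= e * \sum_j `|y 0 j - a 0 j|) ->
  c h @[h --> Fl] --> a ->
  (forall j, h^-1 * (c h 0 j - a 0 j) @[h --> Fl] --> v j) ->
  h^-1 * (G (c h) - G a) @[h --> Fl] --> \sum_j v j * D j.
Proof.
move=> dG ca cv.
have cs : (\sum_j (h^-1 * (c h 0 j - a 0 j)) * D j) @[h --> Fl] --> \sum_j v j * D j.
  by apply: cvg_big => [|j _]; [exact: add_continuous|apply: cvgMl; exact: cv].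
have cn : (\sum_j `|h^-1 * (c h 0 j - a 0 j)|) @[h --> Fl] --> \sum_j `|v j|.
  by apply: cvg_big => [|j _]; [exact: add_continuous|apply: cvg_norm; exact: cv].
suff c0 : (h^-1 * (G (c h) - G a) - \sum_j (h^-1 * (c h 0 j - a 0 j)) * D j)
    @[h --> Fl] --> (0 : R).
  rewrite -[X in _ --> X]add0r.
  rewrite (_ : (fun h => _) = (fun h => (h^-1 * (G (c h) - G a) -
     \sum_j (h^-1 * (c h 0 j - a 0 j)) * D j) +
     \sum_j (h^-1 * (c h 0 j - a 0 j)) * D j)).
    exact: cvgD.
  by apply/funext => h; rewrite subrK.
apply/cvgrPdist_le => e e0; pose K := \sum_j `|v j| + 1.
have K0 : 0 < K by rewrite ltr_wpDl// sumr_ge0.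
have eK : 0 < e / K by rewrite divr_gt0.
have N1 := ca _ (dG _ eK).
near=> h; rewrite sub0r normrN.
have -> : h^-1 * (G (c h) - G a) - \sum_j (h^-1 * (c h 0 j - a 0 j)) * D j =
   h^-1 * (G (c h) - G a - \sum_j (c h 0 j - a 0 j) * D j).
  rewrite [RHS]mulrBr; congr (_ - _); rewrite mulr_sumr.
  by apply: eq_bigr => j _; rewrite mulrA.
rewrite normrM; apply: (@le_trans _ _ (`|h^-1| * (e / K * \sum_j `|c h 0 j - a 0 j|))).
  by apply: ler_wpM2l => //; near: h; exact: N1.
rewrite mulrCA mulr_sumr -[leRHS](divfK (lt0r_neq0 K0)) ler_pM2l//.
rewrite (eq_bigr (fun j => `|h^-1 * (c h 0 j - a 0 j)|)); last first.
  by move=> j _; rewrite normrM.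
near: h; apply: (cvgr_le (\sum_j `|v j|)) => //.
by rewrite /K ltrDl.
Unshelve. all: by end_near. Qed.

(** * Functions of class C^k *)

Section Ck.
Context {R : realType}.

(** [C_infinity] speaks of words of partial derivatives, which behave badly under products and
    compositions. The graded notion allows induction on the order; [C_infinityE] translates. *)
Fixpoint Ck n (k : nat) (V : set 'rV[R]_n) (F : 'rV[R]_n -> R) : Prop :=
  (forall x, V x -> {for x, continuous F}) /\
  match k with
  | 0 => True
  | k'.+1 => (forall x i, V x -> derivable F x (basis_vector i)) /\
             forall i, Ck k' V (partial i F)
  end.

Section basic.
Context {n : nat}.
Implicit Types (V W : set 'rV[R]_n) (F G : 'rV[R]_n -> R) (x : 'rV[R]_n) (k : nat).

Lemma CkW k V F : Ck k.+1 V F -> Ck k V F.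
Proof.
elim: k F => [|k IH] F [cF [dF pF]]; split => //; split => // i.
exact/IH/pF.
Qed.

Lemma Ck_le j k V F : (j <= k)%N -> Ck k V F -> Ck j V F.
Proof. by move=> /subnK <-; elim: (k - j)%N => [//|m IH] /CkW. Qed.

Lemma Ck_subset k V W F : W `<=` V -> Ck k V F -> Ck k W F.
Proof.
move=> WV; elim: k F => [|k IH] F [cF dF]; (split; first by move=> x /WV/cF) => //.
by case: dF => dF pF; split => [x i /WV/dF//|i]; exact/IH/pF.
Qed.

Lemma near_open_eq V F G x : open V -> V x -> (forall y, V y -> F y = G y) ->
  \forall y \near x, F y = G y.
Proof.
by move=> oV Vx FG; near=> y; apply: FG; near: y; exact: open_nbhs_nbhs.
Unshelve. all: by end_near. Qed.

Lemma Ck_eq k V F G : open V -> (forall x, V x -> F x = G x) ->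
  Ck k V F -> Ck k V G.
Proof.
move=> oV; elim: k F G => [|k IH] F G FG [cF dF].
  split => // x Vx; rewrite /prop_for /continuous_at -FG//.
  apply: cvg_trans (cF _ Vx); apply: (near_eq_cvg (F := nbhs x)).
  exact: (near_open_eq oV Vx FG).
split.
  move=> x Vx; rewrite /prop_for /continuous_at -FG//.
  apply: cvg_trans (cF _ Vx); apply: (near_eq_cvg (F := nbhs x)).
  exact: (near_open_eq oV Vx FG).
case: dF => dF pF; split.
  move=> x i Vx; apply: near_eq_derivable (dF _ _ Vx).
  exact: (near_open_eq oV Vx FG).
move=> i; apply: IH (pF i) => x Vx; apply: near_eq_derive.
exact: (near_open_eq oV Vx FG).
Qed.

Lemma C_infinityE V F : C_infinity V F <-> forall k, Ck k V F.
Proof.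
split.
  move=> + k; elim: k F => [|k IH] F sF; have cd := sF [::].
    by split => // x /cd[].
  split; first by move=> x /cd[].
  split; first by move=> x i /cd[].
  by move=> i; apply: IH => s; have := sF (rcons s i); rewrite foldr_rcons.
move=> CF s; elim/last_ind: s F CF => [|s i IH] F CF.
  move=> /= x Vx; have [cF [dF _]] := CF 1%N; split; first exact: cF.
  by move=> i; exact: dF.
rewrite foldr_rcons; apply: IH => k.
by have [_ [_ +]] := CF k.+1; apply.
Qed.

Lemma Ck_cst k V (c : R) : Ck k V (fun=> c).
Proof.
elim: k c => [|k IH] c; (split; first by move=> x _; exact: cst_continuous) => //.
split; first by move=> x i _; exact: derivable_cst.
move=> i; rewrite (_ : partial i _ = fun=> 0)//.
by apply/funext => x; rewrite /partial derive_cst.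
Qed.

Lemma is_derive_coord x i j :
  is_derive x (basis_vector i) (fun y : 'rV[R]_n => y 0 j) (i == j)%:R.
Proof.
have E : (fun h : R => h^-1 *: (((fun y : 'rV[R]_n => y 0 j) \o shift x)
   (h *: basis_vector i) - x 0 j)) @ 0^' --> ((i == j)%:R : R).
  apply: cvg_near_cst; near=> h.
  have h0 : h != 0 by near: h; exact: nbhs_dnbhs_neq.
  rewrite /= !mxE addrK eqxx/= eq_sym -[_ *: _]/(h^-1 * (h * _)).
  by rewrite mulKf.
by apply: DeriveDef; [apply/cvg_ex; eexists; exact: E|exact/cvg_lim].
Unshelve. all: by end_near. Qed.

Lemma Ck_coord k V j : Ck k V (fun x : 'rV[R]_n => x 0 j).
Proof.
have c x : {for x, continuous (fun x : 'rV[R]_n => x 0 j)}.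
  exact: coord_continuous.
case: k => [|k]; split => //; split.
  by move=> x i _; have [] := is_derive_coord x i j.
move=> i; rewrite (_ : partial i _ = fun=> (i == j)%:R); first exact: Ck_cst.
by apply/funext => x; rewrite /partial (@derive_val _ _ _ _ _ _ _ (is_derive_coord x i j)).
Qed.

Lemma CkD k V F G : open V -> Ck k V F -> Ck k V G -> Ck k V (fun x => F x + G x).
Proof.
move=> oV; elim: k F G => [|k IH] F G [cF dF] [cG dG];
  (split; first by move=> x Vx; exact: (cvgD (cF _ Vx) (cG _ Vx))) => //.
case: dF dG => dF pF [dG pG]; split.
  by move=> x i Vx; apply: derivableD; [exact: dF|exact: dG].
move=> i; apply: Ck_eq (IH _ _ (pF i) (pG i)) => // x Vx.
by rewrite /partial -deriveD//; [exact: dF|exact: dG].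
Qed.

Lemma partialM V F G x i : V x -> derivable F x (basis_vector i) ->
  derivable G x (basis_vector i) ->
  partial i (fun x => F x * G x) x = F x * partial i G x + G x * partial i F x.
Proof. by move=> Vx dF dG; rewrite /partial [LHS](deriveM dF dG). Qed.

Lemma CkM k V F G : open V -> Ck k V F -> Ck k V G -> Ck k V (fun x => F x * G x).
Proof.
move=> oV; elim: k F G => [|k IH] F G CF CG.
  by split => // x Vx; exact: (cvgM (CF.1 _ Vx) (CG.1 _ Vx)).
have [[cF [dF pF]] [cG [dG pG]]] := (CF, CG).
split; first by move=> x Vx; exact: (cvgM (cF _ Vx) (cG _ Vx)).
split; first by move=> x i Vx; apply: derivableM; [exact: dF|exact: dG].
move=> i; apply: Ck_eq (CkD oV (IH _ _ (CkW CF) (pG i)) (IH _ _ (CkW CG) (pF i))) => //.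
by move=> x Vx; rewrite (partialM Vx)//; [exact: dF|exact: dG].
Qed.

Lemma Ck_sum k V (I : Type) (r : seq I) (F : I -> 'rV[R]_n -> R) : open V ->
  (forall i, Ck k V (F i)) -> Ck k V (fun x => \sum_(i <- r) F i x).
Proof.
move=> oV CF; elim: r => [|i r IH].
  by rewrite (_ : (fun x => _) = fun=> 0);
    [exact: Ck_cst|apply/funext => x; rewrite big_nil].
rewrite (_ : (fun x => _) = fun x => F i x + \sum_(j <- r) F j x).
  exact: CkD.
by apply/funext => x; rewrite big_cons.
Qed.

Lemma CkV k V F : open V -> (forall x, V x -> F x != 0) -> Ck k V F ->
  Ck k V (fun x => (F x)^-1).
Proof.
move=> oV F0; elim: k F F0 => [|k IH] F F0 CF.
  by split => // x Vx; exact: (cvgV (F0 _ Vx) (CF.1 _ Vx)).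
have [cF [dF pF]] := CF.
split; first by move=> x Vx; exact: (cvgV (F0 _ Vx) (cF _ Vx)).
split; first by move=> x i Vx; apply: derivableV; [exact: F0|exact: dF].
move=> i; have CI := IH _ F0 (CkW CF).
apply: Ck_eq (CkM oV (CkM oV (Ck_cst k V (-1)) (CkM oV CI CI)) (pF i)) => //.
move=> x Vx; rewrite [RHS](deriveV (F0 _ Vx) (dF _ i Vx)) mulN1r.
by rewrite -exprVn expr2.
Qed.

End basic.

Section composition.
Context {m n : nat}.
Variables (V : set 'rV[R]_n) (W : set 'rV[R]_m).
Variables (f : 'rV[R]_n -> 'rV[R]_m) (G : 'rV[R]_m -> R).
Hypotheses (oV : open V) (oW : open W) (VW : forall x, V x -> W (f x)).

Lemma rV_continuous_at x : (forall j, {for x, continuous (fun y => f y 0 j)}) ->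
  {for x, continuous f}.
Proof.
move=> cf A /nbhs_rVP[d d0 dA]; suff : \forall y \near x, A (f y) by [].
near=> y; apply: dA => j; rewrite distrC; move: j; near: y.
apply: filter_forall => j.
by have /cvgrPdist_lt/(_ _ d0) := cf j.
Unshelve. all: by end_near. Qed.

Lemma C1_differentiable x : Ck 1 W G -> W x -> forall e : R, 0 < e ->
  \forall y \near x,
  `|G y - G x - \sum_j (y 0 j - x 0 j) * partial j G x| <= e * \sum_j `|y 0 j - x 0 j|.
Proof.
move=> [_ [dG pG]] Wx e e0.
have cG i : {for x, continuous (partial i G)} by exact: (pG i).1.
have [d d0 H] := partial_strict_differentiability oW Wx dG cG e0.
apply/nbhs_rVP; exists d => // y yx; apply: H => // i.
by rewrite subrr normr0.
Qed.

Lemma is_derive_comp x i : Ck 1 W G -> (forall j, Ck 1 V (fun y => f y 0 j)) ->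
  V x -> is_derive x (basis_vector i) (G \o f)
    (\sum_j partial i (fun y => f y 0 j) x * partial j G (f x)).
Proof.
move=> CG Cf Vx.
have H : (fun h => h^-1 *: (((G \o f) \o shift x) (h *: basis_vector i) - (G \o f) x))
   @ 0^' --> \sum_j partial i (fun y => f y 0 j) x * partial j G (f x).
  apply: (@curve_chain_rule _ _ G (f x) _ _ _ (fun h => f (h *: basis_vector i + x))).
  - exact: (C1_differentiable CG (VW Vx)).
  - have cf : {for x, continuous f}.
      by apply: rV_continuous_at => j; exact: (Cf j).1.
    apply: (cvg_trans _ cf) => A /= fA.
    have : (h *: basis_vector i + x) @[h --> (0 : R)] --> x.
      rewrite [X in _ --> X](_ : x = 0 *: basis_vector i + x); last first.
        by rewrite scale0r add0r.
      by apply: cvgD; [apply: cvgZl; exact: cvg_id|exact: cvg_cst].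
    by move=> /(_ _ fA); exact: nbhs_dnbhs.
  - by move=> j; have [_ [dfj _]] := Cf j; exact: (dfj x i Vx).
by apply: DeriveDef; [apply/cvg_ex; eexists; exact: H|exact/cvg_lim].
Qed.

End composition.

Lemma Ck_comp m n k (V : set 'rV[R]_n) (W : set 'rV[R]_m)
    (f : 'rV[R]_n -> 'rV[R]_m) (G : 'rV[R]_m -> R) :
  open V -> open W -> (forall x, V x -> W (f x)) ->
  (forall j, Ck k V (fun y => f y 0 j)) -> Ck k W G -> Ck k V (G \o f).
Proof.
move=> oV oW VW; elim: k G => [|k IH] G Cf CG.
  split => // x Vx; apply: continuous_comp.
    by apply: rV_continuous_at => j; exact: (Cf j).1.
  exact/CG.1/VW.
have C1 F U : Ck k.+1 U F -> Ck 1 U F by exact: Ck_le.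
have dc x i (Vx : V x) := is_derive_comp oW VW i (C1 _ _ _ CG) (fun j => C1 _ _ _ (Cf j)) Vx.
split.
  move=> x Vx; apply: continuous_comp.
    by apply: rV_continuous_at => j; exact: (Cf j).1.
  exact/CG.1/VW.
split; first by move=> x i Vx; have [] := dc x i Vx.
move=> i; have Cs := Ck_sum (index_enum 'I_m) oV (fun j : 'I_m =>
  CkM oV ((Cf j).2.2 i) (IH _ (fun l => CkW (Cf l)) (CG.2.2 j))).
apply: Ck_eq Cs => // x Vx /=.
by rewrite /partial (@derive_val _ _ _ _ _ _ _ (dc x i Vx)).
Qed.

End Ck.

(** * Flat functions, cutoffs and bumps *)

Section flat_exp.
Context {R : realType}.
Implicit Types (x y : R) (m k : nat).

(** Up to linear combinations this family in [m] is closed under differentiation, so smoothness of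
    all members is one induction on the order. *)
Definition flat_exp m x : R := if 0 < x then x ^- m * expR (- x^-1) else 0.

Lemma flat_exp_gt0 m x : 0 < x -> 0 < flat_exp m x.
Proof. by move=> x0; rewrite /flat_exp x0 mulr_gt0 ?expR_gt0// invr_gt0 exprn_gt0. Qed.

Lemma flat_exp_eq0 m x : x <= 0 -> flat_exp m x = 0.
Proof. by move=> x0; rewrite /flat_exp ltNge x0. Qed.

Lemma flat_exp_ge0 m x : 0 <= flat_exp m x.
Proof.
by have [x0|x0] := leP x 0; [rewrite flat_exp_eq0|exact/ltW/flat_exp_gt0].
Qed.

(** With [N = m + 1], the exponential of [1 / x] is the [N]-th power of that of [1 / (N * x)], hence
    at least [(N * x)^-N]. The bound gives differentiability at 0 and the explicit slope of the
    bumps. *)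
Lemma flat_exp_le m x : 0 < x -> flat_exp m x <= m.+1%:R ^+ m.+1 * x.
Proof.
move=> x0; rewrite /flat_exp x0; set N : R := m.+1%:R.
have N0 : 0 < N by rewrite ltr0n.
have le : (N * x) ^- m.+1 <= expR x^-1.
  have -> : x^-1 = m.+1%:R * (N * x)^-1.
    by rewrite -/N invfM mulrA divff ?mul1r// gt_eqF.
  rewrite expRM_natl -exprVn; apply: lerXn2r; rewrite ?nnegrE ?expR_ge0//.
    by rewrite invr_ge0 mulr_ge0// ltW.
  by apply: le_trans (expR_ge1Dx _); rewrite lerDr.
rewrite expRN mulrC ler_pdivrMr ?exprn_gt0//.
rewrite -mulrA -exprS -exprMn -[leRHS]invrK lef_pV2 ?posrE ?expR_gt0//.
by rewrite invr_gt0 exprn_gt0// mulr_gt0.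
Qed.

Lemma is_derive_flat_exp m x :
  is_derive x 1 (flat_exp m) (flat_exp m.+2 x - m%:R * flat_exp m.+1 x).
Proof.
have [x0|x0|->] := ltgtP x 0.
- rewrite !flat_exp_eq0 ?ltW// mulr0 subrr.
  apply: (near_eq_is_derive _ (is_derive_cst (0 : R) x 1)).
  by near=> y; rewrite flat_exp_eq0//; apply/ltW; near: y; exact: lt_nbhsl.
- have H : is_derive x 1 (fun y => y^-1 ^+ m * expR (- y^-1))
     (flat_exp m.+2 x - m%:R * flat_exp m.+1 x).
    have xn0 : x != 0 by rewrite gt_eqF.
    have d1 : is_derive x 1 (fun y : R => y^-1) (- x ^- 2).
      apply: DeriveDef; first exact: derivableV.
      rewrite (deriveV (f := id) xn0 (@derivable_id _ _ x 1)).
      by rewrite derive_id -[LHS]/(_ * _) mulr1.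
    have d2 : is_derive x 1 (fun y : R => expR (- y^-1)) (x ^- 2 * expR (- x^-1)).
      rewrite -[x ^- 2]opprK mulrC.
      exact: (is_derive1_comp (is_derive_expR _) (is_deriveN d1)).
    have -> : (fun y : R => y^-1 ^+ m * expR (- y^-1)) =
        (fun y => y^-1) ^+ m * (fun y => expR (- y^-1)).
      by apply/funext => y; rewrite fctE exprfctE.
    apply: (is_derive_eq (is_deriveM (is_deriveX m d1) d2)).
    rewrite exprfctE /flat_exp x0 /GRing.scale/= -!exprVn.
    move: (x^-1) (expR _) => y E; case: m => [|m]; first by rewrite /= !expr0; ring.
    rewrite /= !(exprS _ m.+2) !(exprS _ m.+1) !(exprS _ m).
    by move: (y ^+ m) (m.+1%:R) => P N; ring.
  apply: (near_eq_is_derive _ H).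
  by near=> y; rewrite /flat_exp ifT ?exprVn//; near: y; exact: lt_nbhsr.
(* At 0 the difference quotient vanishes for [h <= 0] and is [flat_exp m.+1 h] for [h > 0], which
   [flat_exp_le] bounds by a multiple of [h]. *)
- rewrite !flat_exp_eq0// mulr0 subrr.
  have H : (fun h => h^-1 *: ((flat_exp m \o shift 0) (h *: (1 : R)) - flat_exp m 0))
     @ 0^' --> (0 : R).
    pose C : R := m.+2%:R ^+ m.+2.
    have C0 : 0 < C by rewrite exprn_gt0// ltr0n.
    apply/cvgrPdist_le => e e0; near=> h.
    rewrite /= addr0 [h *: _]mulr1 (flat_exp_eq0 _ (lexx 0)) subr0 sub0r normrN.
    have [h0|h0] := leP h 0; first by rewrite flat_exp_eq0// scaler0 normr0 ltW.
    rewrite -[_ *: _]/(_ * _) (_ : _ * _ = flat_exp m.+1 h); last first.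
      by rewrite /flat_exp h0 mulrA -invfM -exprS.
    rewrite ger0_norm ?flat_exp_ge0//; apply: (le_trans (flat_exp_le _ h0)).
    rewrite -/C -ler_pdivlMl// mulrC -[leLHS]gtr0_norm//.
    by near: h; apply: dnbhs0_le; rewrite divr_gt0.
  by apply: DeriveDef; [apply/cvg_ex; eexists; exact: H|exact/cvg_lim].
Unshelve. all: by end_near. Qed.

Lemma is_derive_scalar (g : R -> R) (y : 'rV[R]_1) (i : 'I_1) (l : R) :
  is_derive (y 0 0) 1 g l ->
  is_derive y (basis_vector i) (fun z : 'rV[R]_1 => g (z 0 0)) l.
Proof.
move=> [dg gl].
have E : (fun h => h^-1 *: (((fun z : 'rV[R]_1 => g (z 0 0)) \o shift y)
      (h *: basis_vector i) - g (y 0 0))) =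
  (fun h => h^-1 *: ((g \o shift (y 0 0)) (h *: (1 : R)) - g (y 0 0))).
  by apply/funext => h; rewrite /= !mxE ord1 eqxx.
by apply: DeriveDef; rewrite /derivable /derive E.
Qed.

Lemma Ck_flat_exp k m : Ck k setT (fun y : 'rV[R]_1 => flat_exp m (y 0 0)).
Proof.
have d l i (y : 'rV[R]_1) := is_derive_scalar (y := y) i (is_derive_flat_exp l (y 0 0)).
have c l (y : 'rV[R]_1) : {for y, continuous (fun z : 'rV[R]_1 => flat_exp l (z 0 0))}.
  apply: (@continuous_comp _ _ _ (fun z : 'rV[R]_1 => z 0 0) (flat_exp l)).
    exact: coord_continuous.
  apply/differentiable_continuous/derivable1_diffP.
  by have [] := is_derive_flat_exp l (y 0 0).
elim: k m => [|k IH] m; (split; first by move=> y _; exact: c) => //.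
split; first by move=> y i _; have [] := d m i y.
move=> i; apply: Ck_eq (CkD openT (IH m.+2)
   (CkM openT (Ck_cst k setT (- m%:R)) (IH m.+1))); first exact: openT.
by move=> y _; rewrite /partial (@derive_val _ _ _ _ _ _ _ (d m i y)) mulNr.
Qed.

Lemma Ck_flat_exp_comp n k m V (F : 'rV[R]_n -> R) : open V -> Ck k V F ->
  Ck k V (fun z => flat_exp m (F z)).
Proof.
move=> oV CF.
pose f (z : 'rV[R]_n) : 'rV[R]_1 := \row_(j < 1) F z.
pose G (y : 'rV[R]_1) := flat_exp m (y 0 0).
have E : G \o f = fun z => flat_exp m (F z).
  by apply/funext => z; rewrite /G /f /= mxE.
rewrite -E; apply: (@Ck_comp R 1 n k V setT f G oV openT) => //.
  by move=> j; apply: Ck_eq CF => // z _; rewrite mxE.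
exact: Ck_flat_exp.
Qed.

End flat_exp.

Section plateau.
Context {R : realType} {n : nat}.
Variables (a : 'rV[R]_n) (r : R).
Hypothesis r0 : 0 < r.

Definition sqdist (x : 'rV[R]_n) : R := \sum_j (r^-1 * (x 0 j - a 0 j)) ^+ 2.

(** The usual quotient of flat functions: equal to 1 on the Euclidean ball of radius [r] about [a],
    positive inside radius [2 * r], zero outside. The denominator is positive because the conditions
    [sqdist < 4] and [1 < sqdist] cover everything. *)
Definition plateau (x : 'rV[R]_n) : R := flat_exp 0 (4 - sqdist x) *
  (flat_exp 0 (4 - sqdist x) + flat_exp 0 (sqdist x - 1))^-1.

Let den_gt0 x : 0 < flat_exp 0 (4 - sqdist x) + flat_exp 0 (sqdist x - 1).
Proof.
have [x1|x1] := ltP 1 (sqdist x).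
  by rewrite ltr_wpDl ?flat_exp_ge0// flat_exp_gt0// subr_gt0.
by rewrite ltr_wpDr ?flat_exp_ge0// flat_exp_gt0//; lra.
Qed.

Lemma Ck_sqdist k : Ck k setT sqdist.
Proof.
apply: Ck_sum => [|j]; first exact: openT.
have Cj : Ck k setT (fun x : 'rV[R]_n => r^-1 * (x 0 j - a 0 j)).
  by apply: CkM; [exact: openT|exact: Ck_cst|apply: CkD;
    [exact: openT|exact: Ck_coord|exact: Ck_cst]].
by apply: CkM => //; exact: openT.
Qed.

Lemma Ck_plateau k : Ck k setT plateau.
Proof.
have C1 : Ck k setT (fun x => flat_exp 0 (4 - sqdist x)).
  apply: Ck_flat_exp_comp; first exact: openT.
  apply: Ck_eq (CkD openT (Ck_cst k _ 4) (CkM openT (Ck_cst k _ (-1)) (Ck_sqdist k))).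
    exact: openT.
  by move=> x _; rewrite mulN1r.
have C2 : Ck k setT (fun x => flat_exp 0 (sqdist x - 1)).
  apply: Ck_flat_exp_comp; first exact: openT.
  by apply: CkD; [exact: openT|exact: Ck_sqdist|exact: Ck_cst].
apply: CkM => //; first exact: openT.
apply: CkV; first exact: openT.
  by move=> x _; rewrite gt_eqF.
by apply: CkD => //; exact: openT.
Qed.

Lemma plateau_eq1 x : sqdist x <= 1 -> plateau x = 1.
Proof.
move=> x1; rewrite /plateau (flat_exp_eq0 _ (x := _ - 1)) ?subr_le0// addr0 divff//.
by rewrite gt_eqF// flat_exp_gt0//; lra.
Qed.

Lemma plateau_eq0 x : 4 <= sqdist x -> plateau x = 0.
Proof. by move=> x4; rewrite /plateau flat_exp_eq0 ?subr_le0// mul0r. Qed.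

Lemma plateau_gt0 x : sqdist x < 4 -> 0 < plateau x.
Proof. by move=> x4; rewrite divr_gt0// flat_exp_gt0// subr_gt0. Qed.

Lemma sqdist_le_coord x : sqdist x <= 4 -> forall j, `|x 0 j - a 0 j| <= 2 * r.
Proof.
move=> x4 j; have : (r^-1 * (x 0 j - a 0 j)) ^+ 2 <= 2 ^+ 2.
  apply: le_trans (_ : sqdist x <= _); last by rewrite -natrX.
  by rewrite /sqdist (bigD1 j)//= lerDl sumr_ge0// => i _; exact: sqr_ge0.
rewrite -real_normK ?num_real// ler_pXn2r ?nnegrE//.
by rewrite normrM gtr0_norm ?invr_gt0// ler_pdivrMl// mulrC.
Qed.

Lemma sqdist_center : sqdist a = 0.
Proof. by rewrite /sqdist big1// => j _; rewrite subrr mulr0 expr0n. Qed.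

End plateau.

Section flat_bump.
Context {R : realType}.

Definition flat_bump (s : R) : R := flat_exp 0 (1 - s ^+ 2).

(** The derivative of [flat_exp 0] is [flat_exp 2], since the other term carries the factor [m = 0];
    the rest is the inner derivative. *)
Definition flat_bump' (s : R) : R := flat_exp 2 (1 - s ^+ 2) * (- (2 * s)).

Lemma is_derive_bump (s : R) : is_derive s 1 flat_bump (flat_bump' s).
Proof.
have d : is_derive s 1 (fun s : R => 1 - s ^+ 2) (- (2 * s)).
  have h1 : is_derive s (1 : R) (cst 1 : R -> R) 0 by exact: is_derive_cst.
  have h2 : is_derive s (1 : R) (id : R -> R) 1 by exact: is_derive_id.
  have := is_deriveB h1 (is_deriveX 2 h2).
  by rewrite /= sub0r /GRing.scale/= mulr1 expr1.
have := @is_derive1_comp _ _ (fun s : R => 1 - s ^+ 2) s _ _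
  (is_derive_flat_exp 0 (1 - s ^+ 2)) d.
by rewrite mul0r subr0.
Qed.

Lemma Ck_bump_comp n k V (F : 'rV[R]_n -> R) : open V -> Ck k V F ->
  Ck k V (fun x => flat_bump (F x)).
Proof.
move=> oV CF; apply: Ck_flat_exp_comp => //.
apply: Ck_eq (CkD oV (Ck_cst k _ 1) (CkM oV (Ck_cst k _ (-1)) (CkM oV CF CF))) => //.
by move=> x _; rewrite mulN1r expr2.
Qed.

Lemma flat_bump_eq0 s : 1 <= `|s| -> flat_bump s = 0.
Proof.
move=> s1; rewrite /flat_bump flat_exp_eq0// subr_le0 -real_normK ?num_real//.
by rewrite exprn_ege1.
Qed.

Lemma flat_bump'_eq0 s : 1 <= `|s| -> flat_bump' s = 0.
Proof.
move=> s1; rewrite /flat_bump' flat_exp_eq0 ?mul0r// subr_le0 -real_normK ?num_real//.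
by rewrite exprn_ege1.
Qed.

(** The value 54 is [27 * 2]: [flat_exp_le] gives [3^3] on arguments at most 1, and [|2 * s| <= 2]
    on the support. *)
Lemma flat_bump'_bound s : `|flat_bump' s| <= 54.
Proof.
have [s1|s1] := leP 1 `|s|; first by rewrite flat_bump'_eq0// normr0.
rewrite /flat_bump' normrM ger0_norm ?flat_exp_ge0// normrN normrM [`|2|]gtr0_norm//.
have s2 : 0 < 1 - s ^+ 2 by rewrite subr_gt0 -real_normK ?num_real// expr_lt1.
have A27 : flat_exp 2 (1 - s ^+ 2) <= 27.
  apply: le_trans (flat_exp_le 2 s2) _; have := sqr_ge0 s.
  by rewrite (_ : 3%:R ^+ 3 = 27 :> R); [lra|rewrite -natrX].
apply: (@le_trans _ _ (27 * (2 * 1))); last by lra.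
apply: ler_pM => //; first exact: flat_exp_ge0.
by apply: ler_wpM2l => //; exact: ltW.
Qed.

(** There [1 - s^2 >= 3 / 4], so the exponent is at least [- 4 / 3], which exceeds [- 2]. *)
Lemma flat_bump_lower : exists2 m : R, 0 < m & forall s, `|s| <= 2^-1 -> m <= flat_bump s.
Proof.
exists (expR (- 2)); first exact: expR_gt0.
move=> s s2; have s4 : s ^+ 2 <= 4^-1.
  rewrite -real_normK ?num_real//; have := normr_ge0 s; move: `|s| s2 => C; nra.
rewrite /flat_bump /flat_exp ifT; last by lra.
rewrite expr0 invr1 mul1r ler_expR lerN2 -[leRHS]invrK lef_pV2 ?posrE; lra.
Qed.

End flat_bump.

Import Defs.

Lemma within_continuous_nbhs (T U : topologicalType) (A : set T) (f : T -> U) x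
    (B : set U) : {within A, continuous f} -> A x -> nbhs (f x) B ->
  \forall y \near x, A y -> B (f y).
Proof.
move=> /subspace_continuousP cf Ax fB.
exact: (cf _ Ax _ fB).
Qed.

Lemma within_continuous_open (T U : topologicalType) (A : set T) (f : T -> U)
    (B : set U) : {within A, continuous f} -> open B ->
  exists2 V, open V & A `&` f @^-1` B = A `&` V.
Proof.
move=> cf oB; exists (interior [set y | A y -> B (f y)]); first exact: open_interior.
apply/seteqP; split=> x [Ax]; last by move=> /interior_subset H; split => //; exact: H.
move=> /= fB; split => //.
by apply: within_continuous_nbhs => //; exact: open_nbhs_nbhs.
Qed.

(** * Charts and smooth functions *)

Section smooth_at.
Context {R : realType} {n : nat}.
Local Notation H := (halfspace R n).
Implicit Types (A V : set 'rV[R]_n) (f g : 'rV[R]_n -> R) (x y : 'rV[R]_n).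

(** [smooth_on A f] asks for this at each point of [A]; the pointwise form suits local changes of
    [A], of [f] and of the chart. *)
Definition smooth_at A f x := exists V F,
  [/\ open V, V x, C_infinity V F & forall y, A y -> V y -> F y = f y].

Definition half_open A := exists2 V, open V & A = V `&` H.

Lemma line_near V x v : nbhs x V -> \forall h \near (0 : R), V (x + h *: v).
Proof.
move=> xV; have : (x + h *: v) @[h --> (0 : R)] --> x.
  rewrite [X in _ --> X](_ : x = x + 0 *: v); last by rewrite scale0r addr0.
  by apply: cvgD; [exact: cvg_cst|apply: cvgZl; exact: cvg_id].
exact.
Qed.

Lemma near_at_right (P : set R) : (\forall h \near (0 : R), P h) ->
  \forall h \near (0 : R)^'+, P h.
Proof. exact: cvg_within. Qed.

Lemma half_open_right A x i : half_open A -> A x ->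
  \forall h \near (0 : R)^'+, A (x + h *: basis_vector i).
Proof.
move=> [V oV ->] [Vx Hx].
have NV := near_at_right (line_near (basis_vector i) (open_nbhs_nbhs (conj oV Vx))).
near=> h; split; first by near: h; exact: NV.
have h0 : 0 < h by near: h; exact: nbhs_right_gt.
by move=> j j0; rewrite !mxE addr_ge0 ?Hx// mulr_ge0// ltW.
Unshelve. all: by end_near. Qed.

(** Short steps in the positive coordinate directions stay in [A], so the one-sided quotients of [f]
    are those of [F]. Hence the partial derivatives of an extension at points of [A] depend on [f]
    alone. *)
Lemma rpartial_extension A V F f x i : half_open A -> A x -> open V -> V x ->
  Ck 1 V F -> (forall y, A y -> V y -> F y = f y) ->
  h^-1 * (f (x + h *: basis_vector i) - f x) @[h --> 0^'+] --> partial i F x /\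
  rpartial i f x = partial i F x.
Proof.
move=> hA Ax oV Vx [_ [dF _]] Ff.
have cF : h^-1 * (F (x + h *: basis_vector i) - F x) @[h --> 0^'+] --> partial i F x.
  have := dF x i Vx; rewrite /derivable => cF B /cF /=.
  rewrite /dnbhs /at_right /within /nbhs/=; apply: filterS => h BF h0.
  by rewrite (addrC x); apply: BF; rewrite gt_eqF.
have E : h^-1 * (f (x + h *: basis_vector i) - f x) @[h --> 0^'+] --> partial i F x.
  apply: cvg_trans cF; apply: near_eq_cvg.
  have NV := near_at_right (line_near (basis_vector i) (open_nbhs_nbhs (conj oV Vx))).
  near=> h; rewrite -!Ff//.
  - by near: h; exact: half_open_right.
  - by near: h; exact: NV.
by split => //; exact/cvg_lim.
Unshelve. all: by end_near. Qed.

Lemma rpartialE A V F f x i : half_open A -> A x -> open V -> V x ->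
  C_infinity V F -> (forall y, A y -> V y -> F y = f y) ->
  rpartial i f x = partial i F x.
Proof.
move=> hA Ax oV Vx /C_infinityE CF Ff.
by have [] := rpartial_extension i hA Ax oV Vx (CF 1%N) Ff.
Qed.

Lemma smooth_at_near A V f g x : open V -> V x ->
  (forall y, A y -> V y -> f y = g y) -> smooth_at A f x -> smooth_at A g x.
Proof.
move=> oV Vx fg [W [F [oW Wx CF Ff]]]; exists (V `&` W), F; split => //.
- exact: openI.
- apply/C_infinityE => k; apply: Ck_subset (_ : _ `<=` W) _; first by move=> y [].
  by move/C_infinityE : CF.
- by move=> y Ay [Vy Wy]; rewrite Ff// fg.
Qed.

Lemma smooth_at_subset A B V f x : open V -> V x -> A `&` V `<=` B ->
  smooth_at B f x -> smooth_at A f x.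
Proof.
move=> oV Vx AB [W [F [oW Wx CF Ff]]]; exists (V `&` W), F; split => //.
- exact: openI.
- apply/C_infinityE => k; apply: Ck_subset (_ : _ `<=` W) _; first by move=> y [].
  by move/C_infinityE : CF.
- by move=> y Ay [Vy Wy]; rewrite Ff//; apply: AB.
Qed.

Lemma smooth_at_global A F x : (forall k, Ck k setT F) -> smooth_at A F x.
Proof.
move=> CF; exists setT, F; split => //; first exact: openT.
exact/C_infinityE.
Qed.

Lemma open_forall_ord m (V : 'I_m -> set 'rV[R]_n) : (forall j, open (V j)) ->
  open [set x | forall j, V j x].
Proof.
move=> oV; rewrite openE => x Vx; rewrite /interior.
near=> y; move=> j; move: j; near: y; apply: filter_forall => j.
by apply: open_nbhs_nbhs; split; [exact: oV|exact: Vx].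
Unshelve. all: by end_near. Qed.

Lemma smooth_at_family m A (f : 'I_m -> 'rV[R]_n -> R) x :
  (forall j, smooth_at A (f j) x) ->
  exists V (F : 'I_m -> 'rV[R]_n -> R), [/\ open V, V x, forall j k, Ck k V (F j) &
    forall j y, A y -> V y -> F j y = f j y].
Proof.
move=> /choice[V /choice[F HF]].
exists [set x | forall j, V j x], F; split => //.
- by apply: open_forall_ord => j; have [] := HF j.
- by move=> j; have [] := HF j.
- move=> j k; apply: Ck_subset (_ : _ `<=` V j) _; first by move=> y; exact.
  by have [_ _ /C_infinityE + _] := HF j; exact.
- by move=> j y Ay Vy; have [_ _ _] := HF j; apply.
Qed.

Lemma smooth_atD A f g x : smooth_at A f x -> smooth_at A g x ->
  smooth_at A (fun y => f y + g y) x.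
Proof.
move=> [V [F [oV Vx CF Ff]]] [W [G [oW Wx CG Gg]]].
exists (V `&` W), (fun y => F y + G y); split => //; first exact: openI.
  apply/C_infinityE => k; apply: CkD; first exact: openI.
    by move/C_infinityE : CF => /(_ k); apply: Ck_subset => y [].
  by move/C_infinityE : CG => /(_ k); apply: Ck_subset => y [].
by move=> y Ay [Vy Wy]; rewrite Ff// Gg.
Qed.

Lemma smooth_atM A f g x : smooth_at A f x -> smooth_at A g x ->
  smooth_at A (fun y => f y * g y) x.
Proof.
move=> [V [F [oV Vx CF Ff]]] [W [G [oW Wx CG Gg]]].
exists (V `&` W), (fun y => F y * G y); split => //; first exact: openI.
  apply/C_infinityE => k; apply: CkM; first exact: openI.
    by move/C_infinityE : CF => /(_ k); apply: Ck_subset => y [].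
  by move/C_infinityE : CG => /(_ k); apply: Ck_subset => y [].
by move=> y Ay [Vy Wy]; rewrite Ff// Gg.
Qed.

Lemma smooth_at_sum (I : Type) (r : seq I) A (f : I -> 'rV[R]_n -> R) x :
  (forall i, smooth_at A (f i) x) -> smooth_at A (fun y => \sum_(i <- r) f i y) x.
Proof.
move=> sf; elim: r => [|i r IH].
  rewrite (_ : (fun y => _) = fun=> 0); last by apply/funext => y; rewrite big_nil.
  by apply: smooth_at_global => k; exact: Ck_cst.
rewrite (_ : (fun y => _) = fun y => f i y + \sum_(j <- r) f j y).
  exact: smooth_atD.
by apply/funext => y; rewrite big_cons.
Qed.

Lemma smooth_at_rpartial A f x i : half_open A -> A x -> smooth_at A f x ->
  smooth_at A (rpartial i f) x.
Proof.
move=> hA Ax [V [F [oV Vx CF Ff]]]; exists V, (partial i F); split => //.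
  apply/C_infinityE => k; move/C_infinityE : CF => /(_ k.+1)[_ [_]]; exact.
by move=> y Ay Vy; rewrite (rpartialE i hA Ay oV Vy CF Ff).
Qed.

Lemma smooth_at_continuous A f x : A x -> smooth_at A f x ->
  f @ within A (nbhs x) --> f x.
Proof.
move=> Ax [V [F [oV Vx CF Ff]]].
have cF : {for x, continuous F} by move/C_infinityE : CF => /(_ 0%N)[+ _]; apply.
rewrite -(Ff x)//; apply: (@cvg_trans _ (F @ within A (nbhs x))).
  apply: near_eq_cvg; near=> y.
  apply: Ff; first by near: y; exact: withinT.
  by near: y; apply: cvg_within; exact: open_nbhs_nbhs.
by apply: cvg_trans cF; exact/cvg_app/cvg_within.
Unshelve. all: by end_near. Qed.

End smooth_at.

Section composition.
Context {R : realType} {m n : nat}.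
Variables (A : set 'rV[R]_n) (B : set 'rV[R]_m).
Variables (phi : 'I_m -> 'rV[R]_n -> R) (g : 'rV[R]_m -> R) (x : 'rV[R]_n).
Let f y := \row_j phi j y.
Hypotheses (hA : half_open A) (hB : half_open B) (Ax : A x) (Bfx : B (f x)).
Hypothesis fAB : \forall y \near x, A y -> B (f y).
Hypotheses (sphi : forall j, smooth_at A (phi j) x) (sg : smooth_at B g (f x)).

Lemma smooth_at_comp : smooth_at A (g \o f) x /\ forall i,
  rpartial i (g \o f) x = \sum_j rpartial i (phi j) x * rpartial j g (f x).
Proof.
have [V [F [oV Vx CF Ff]]] := smooth_at_family sphi.
have [W [G [oW Wx CG Gg]]] := sg.
pose Phi y := \row_j F j y.
have Ff' y : A y -> V y -> Phi y = f y.
  by move=> Ay Vy; apply/rowP => j; rewrite !mxE Ff.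
have CPhi k j : Ck k V (fun y => Phi y 0 j).
  by rewrite (_ : (fun y => _) = F j)//; apply/funext => y; rewrite mxE.
(* Off [A] the extension [Phi] may leave [B], so there it is only required to land in the domain [W]
   of the extension of [g]; membership in [B] is kept for points of [A]. *)
pose U := V `&` (interior [set y | A y -> B (f y)]) `&` [set y | W (Phi y)].
have oU : open U.
  rewrite openE => y [[Vy Ny] Wy]; rewrite /interior.
  have cPhi : {for y, continuous Phi}.
    by apply: rV_continuous_at => j; exact: (CPhi 0%N j).1.
  have N1 : nbhs y V by exact: open_nbhs_nbhs.
  have N2 : nbhs y (interior [set y | A y -> B (f y)]).
    by apply: open_nbhs_nbhs; split => //; exact: open_interior.
  have N3 : nbhs y [set y | W (Phi y)] by apply: cPhi; exact: open_nbhs_nbhs.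
  exact: filterI (filterI N1 N2) N3.
have Ux : U x.
  split; first split => //.
  by rewrite /= Ff'.
have C k : Ck k U (G \o Phi).
  apply: (Ck_comp oU oW) => [y [_ //]|j|]; last by move/C_infinityE : CG.
  by apply: Ck_subset (CPhi k j) => y [[]].
have E y : A y -> U y -> (G \o Phi) y = (g \o f) y.
  move=> Ay [[Vy Ny] Wy]; have By := interior_subset Ny Ay.
  by rewrite /comp -(Ff' _ Ay Vy) Gg// Ff'.
split.
  by exists U, (G \o Phi); split => //; apply/C_infinityE.
move=> i; have /C_infinityE CU := C.
rewrite (rpartialE i hA Ax oU Ux CU E).
have := @is_derive_comp _ _ _ U W Phi G oW (fun y (Uy : U y) => Uy.2) x i.
have CG1 : Ck 1 W G by move/C_infinityE : CG.
have CPhi1 j : Ck 1 U (fun y => Phi y 0 j).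
  by apply: Ck_subset (CPhi 1%N j) => y [[]].
move=> /(_ CG1 CPhi1 Ux) dc; rewrite /partial (@derive_val _ _ _ _ _ _ _ dc).
apply: eq_bigr => j _; congr (_ * _).
  rewrite (_ : (fun y => Phi y 0 j) = F j); last by apply/funext => y; rewrite mxE.
  have /C_infinityE CFj : forall k, Ck k V (F j) by [].
  by rewrite (rpartialE i hA Ax oV Vx CFj (Ff j)).
by rewrite (rpartialE j hB Bfx oW Wx CG Gg) Ff'.
Qed.

End composition.

Lemma near_open (T : topologicalType) (x : T) (P : set T) :
  (\forall y \near x, P y) ->
  exists2 V, open V /\ V x & forall y, V y -> P y.
Proof.
move=> xP; exists (interior P); last by move=> y /interior_subset.
by split; [exact: open_interior|exact: xP].
Qed.

Section chart.
Context {R : realType} {n : nat} {M : ptopologicalType}.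
Implicit Types (c d e : chart R n M) (p q : M) (f g : M -> R).

Definition chart_image c := coord c @` dom c.

Lemma image_half_open c : half_open (chart_image c).
Proof. by have [V oV cV] := image_open c; exists V. Qed.

Lemma image_coord c p : dom c p -> chart_image c (coord c p).
Proof. by exists p. Qed.

Lemma image_param c x : chart_image c x -> dom c (param c x) /\ coord c (param c x) = x.
Proof. by move=> [p cp <-]; rewrite coordK. Qed.

Lemma near_param c p (O : set M) : dom c p -> nbhs p O ->
  \forall y \near coord c p, chart_image c y -> O (param c y).
Proof.
move=> cp Op; apply: within_continuous_nbhs; first exact: param_continuous.
  exact: image_coord.
by rewrite coordK.
Qed.

Lemma near_coord c p (O : set 'rV[R]_n) : dom c p -> nbhs (coord c p) O ->
  \forall q \near p, dom c q /\ O (coord c q).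
Proof.
move=> cp Op; have Ncp : nbhs p (dom c) by apply: open_nbhs_nbhs; split => //; exact: dom_open.
have := within_continuous_nbhs (@coord_continuous _ _ _ c) cp Op.
by apply: filterS2 Ncp => q cq H; split => //; exact: H.
Qed.

Lemma near_overlap c d p : dom c p -> dom d p ->
  \forall y \near coord c p, chart_image c y -> (coord c @` (dom c `&` dom d)) y.
Proof.
move=> cp dp; have Ndp : nbhs p (dom d) by apply: open_nbhs_nbhs; split => //; exact: dom_open.
apply: filterS (near_param cp Ndp) => y H cy; have [? cy'] := image_param cy.
by exists (param c y) => //; split => //; exact: H.
Qed.

Lemma overlap_half_open c d : half_open (coord c @` (dom c `&` dom d)).
Proof.
have [V oV cV] := image_half_open c.
have [W oW dW] := within_continuous_open (@param_continuous _ _ _ c) (dom_open d).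
exists (V `&` W); first exact: openI.
rewrite -/(chart_image c) in dW; rewrite setIAC -cV -dW; apply/seteqP; split.
  by move=> _ [p [cp dp] <-]; split; [exists p|rewrite /= coordK].
by move=> _ [[p cp <-] dp]; exists p => //; split => //; move: dp; rewrite /= coordK.
Qed.

(** The transpose of the usual Jacobian matrix of the transition map: tangent vectors are rows, and
    the cocycle rule reads from left to right. *)
Definition jac c d p : 'M[R]_n :=
  \matrix_(i, j) rpartial i (fun x => coord d (param c x) 0 j) (coord c p).

Definition dchart c f p : 'cV[R]_n := \col_i rpartial i (f \o param c) (coord c p).

Definition smooth_in c f p := smooth_at (chart_image c) (f \o param c) (coord c p).

Lemma jac_id c p : dom c p -> jac c c p = 1%:M.
Proof.
move=> cp; apply/matrixP => i j; rewrite !mxE.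
have C k : Ck k setT (fun x : 'rV[R]_n => x 0 j) by exact: Ck_coord.
have /C_infinityE CT := C.
rewrite (rpartialE i (image_half_open c) (image_coord cp) openT I CT).
  by rewrite /partial (@derive_val _ _ _ _ _ _ _ (is_derive_coord _ i j)).
by move=> y /image_param[_ ->].
Qed.

Lemma smooth_in_near c f g p : dom c p -> (\forall q \near p, f q = g q) ->
  smooth_in c f p -> smooth_in c g p.
Proof.
move=> cp fg; have [V [oV Vp] VE] := near_open (near_param cp fg).
by apply: (smooth_at_near oV Vp) => y Ay Vy; apply: VE.
Qed.

Lemma smooth_in_global c (F : 'rV[R]_n -> R) p : dom c p ->
  (forall k, Ck k setT F) -> smooth_in c (F \o coord c) p.
Proof.
move=> cp CF; apply: (smooth_at_near openT I) (smooth_at_global _ _ CF).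
by move=> y /image_param[_ /= ->].
Qed.

Variable S : smooth_structure R n M.

Lemma smooth_in_coord c d p j : atlas S c -> atlas S d -> dom c p -> dom d p ->
  smooth_in c (fun q => coord d q 0 j) p.
Proof.
move=> Sc Sd cp dp; have [V [oV Vp] VE] := near_open (near_overlap cp dp).
apply: (@smooth_at_subset _ _ _ (coord c @` (dom c `&` dom d)) V) => //.
  by move=> y [cy Vy]; exact: VE.
by apply: (atlas_compatible Sc Sd); exists p.
Qed.

Lemma change_chart c d f p : atlas S c -> atlas S d -> dom c p -> dom d p ->
  smooth_in d f p ->
  smooth_in c f p /\ dchart c f p = jac c d p *m dchart d f p.
Proof.
move=> Sc Sd cp dp sf.
pose phi (j : 'I_n) y := coord d (param c y) 0 j.
have E y : \row_j phi j y = coord d (param c y) by apply/rowP => j; rewrite mxE.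
have Ep : \row_j phi j (coord c p) = coord d p by rewrite E coordK.
have [|||||||H1 H2] := @smooth_at_comp R n n (chart_image c) (chart_image d) phi (f \o param d) (coord c p).
- exact: image_half_open.
- exact: image_half_open.
- exact: image_coord.
- by rewrite Ep; exact: image_coord.
- have Ndp : nbhs p (dom d) by apply: open_nbhs_nbhs; split => //; exact: dom_open.
  by apply: filterS (near_param cp Ndp) => y H cy; rewrite E; apply/image_coord/H.
- by move=> j; exact: smooth_in_coord.
- by rewrite Ep.
have Ndp : nbhs p (dom d) by apply: open_nbhs_nbhs; split => //; exact: dom_open.
have [V [oV Vp] VE] := near_open (near_param cp Ndp).
have fE y : chart_image c y -> V y -> ((f \o param d) \o (fun y => \row_j phi j y)) y = (f \o param c) y.
  by move=> cy Vy; rewrite /= E coordK//; exact: VE.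
split; first exact: smooth_at_near oV Vp fE H1.
apply/colP => i; rewrite !mxE.
have -> : rpartial i (f \o param c) (coord c p) =
    rpartial i ((f \o param d) \o (fun y => \row_j phi j y)) (coord c p).
  have [W [F [oW Wp CF FE]]] := H1.
  rewrite (rpartialE i (image_half_open c) (image_coord cp) oW Wp CF FE).
  apply: (rpartialE i (image_half_open c) (image_coord cp) (openI oW oV)).
  - by split.
  - by apply/C_infinityE => k; move/C_infinityE : CF => /(_ k); apply: Ck_subset => y [].
  - by move=> y cy [Wy Vy]; rewrite FE// fE.
by rewrite H2; apply: eq_bigr => j _; rewrite !mxE Ep.
Qed.

Lemma dchart_coord c d p j : dchart c (fun q => coord d q 0 j) p = col j (jac c d p).
Proof. by apply/colP => i; rewrite !mxE. Qed.

Lemma jac_cocycle c d e p : atlas S c -> atlas S d -> atlas S e ->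
  dom c p -> dom d p -> dom e p -> jac c e p = jac c d p *m jac d e p.
Proof.
move=> Sc Sd Se cp dp ep; apply/matrixP => i j.
have [_] := change_chart Sc Sd cp dp (smooth_in_coord j Sd Se dp ep).
rewrite !dchart_coord => /colP/(_ i); rewrite !mxE => ->.
by apply: eq_bigr => k _; rewrite !mxE.
Qed.

Lemma jac_inv c d p : atlas S c -> atlas S d -> dom c p -> dom d p ->
  jac c d p *m jac d c p = 1%:M.
Proof. by move=> Sc Sd cp dp; rewrite -jac_cocycle// jac_id. Qed.

Lemma jac_unit c d p : atlas S c -> atlas S d -> dom c p -> dom d p ->
  jac c d p \in unitmx.
Proof. by move=> Sc Sd cp dp; have /mulmx1_unit[] := jac_inv Sc Sd cp dp. Qed.

Lemma chart_atP p : atlas S (chart_at S p) /\ dom (chart_at S p) p.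
Proof. by rewrite /chart_at; case: cid2. Qed.

Lemma smooth_functionP f : smooth_function S f <->
  forall c p, atlas S c -> dom c p -> smooth_in c f p.
Proof.
split => [sf c p Sc cp|sf c Sc _ [p cp <-]].
  by apply: (sf c Sc); exists p.
exact: sf.
Qed.

Lemma jacobian_differential c f p : atlas S c -> dom c p -> smooth_function S f ->
  jacobian S c p *m differential S f p = dchart c f p.
Proof.
move=> Sc cp /smooth_functionP sf; have [Sp dp] := chart_atP p.
by have [_ ->] := change_chart Sc Sp cp dp (sf _ _ Sp dp).
Qed.

Lemma jacobian_unit c p : atlas S c -> dom c p -> jacobian S c p \in unitmx.
Proof. by move=> Sc cp; have [Sp dp] := chart_atP p; exact: jac_unit. Qed.

Lemma jacobian_jac c d p : atlas S c -> atlas S d -> dom c p -> dom d p ->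
  jacobian S c p = jac c d p *m jacobian S d p.
Proof. by move=> Sc Sd cp dp; have [Sp sp] := chart_atP p; exact: jac_cocycle. Qed.

Lemma smooth_function_chart f : (forall p, exists2 c, atlas S c /\ dom c p &
  smooth_in c f p) -> smooth_function S f.
Proof.
move=> H; apply/smooth_functionP => c p Sc cp; have [d [Sd dp] sd] := H p.
by have [] := change_chart Sc Sd cp dp sd.
Qed.

Lemma closed_halfspace : closed (halfspace R n).
Proof.
have -> : halfspace R n = \bigcap_(i in [set i : 'I_n | i = 0%N :> nat])
    ((fun x : 'rV[R]_n => x 0 i) @^-1` [set y | 0 <= y]).
  by apply/seteqP; split=> x H i; have := H i.
apply: closed_bigI => i _; apply: preimage_closed; last exact: closed_ge.
by move=> x _; exact: ((Ck_coord 0 setT i).1 x I).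
Qed.

Definition chart_ext c (u : 'rV[R]_n -> R) (p : M) : R :=
  if p \in dom c then u (coord c p) else 0.

Lemma chart_extE c u p : dom c p -> chart_ext c u p = u (coord c p).
Proof. by move=> cp; rewrite /chart_ext mem_set. Qed.

(** A point outside [dom c] is harmless because the part of the box inside the half-space is
    compact; its image in the Hausdorff space [M] is closed, and the extension by 0 vanishes off
    that image. *)
Lemma chart_ext_smooth c (u : 'rV[R]_n -> R) (a : 'rV[R]_n) (r : R) : hausdorff_space M -> atlas S c ->
  (forall k, Ck k setT u) ->
  (forall x, halfspace R n x -> (forall i, `|x 0 i - a 0 i| <= r) -> chart_image c x) ->
  (forall x : 'rV[R]_n, ~ (forall i, `|x 0 i - a 0 i| <= r) -> u x = 0) ->
  smooth_function S (chart_ext c u).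
Proof.
move=> hM Sc Cu ac u0; apply: smooth_function_chart => p.
have [cp|ncp] := pselect (dom c p).
  exists c => //; apply: smooth_in_near (smooth_in_global cp Cu) => //.
  have : nbhs p (dom c) by apply: open_nbhs_nbhs; split => //; exact: dom_open.
  by apply: filterS => q cq; rewrite chart_extE.
have [Sp dp] := chart_atP p; exists (chart_at S p) => //.
pose B : set 'rV[R]_n := [set x | forall i, `[a 0 i - r, a 0 i + r]%classic (x 0 i)].
have BE x : B x <-> forall i, `|x 0 i - a 0 i| <= r.
  by split=> H i; have := H i; rewrite /= in_itv/= ler_distl.
pose K := param c @` (B `&` halfspace R n).
have BH : B `&` halfspace R n `<=` chart_image c by move=> x [/BE Bx Hx]; exact: ac.
have cK : compact K.
  apply: continuous_compact.
    exact: continuous_subspaceW BH (@param_continuous _ _ _ c).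
  have cH := closed_halfspace.
  apply: compact_closedI => //.
  exact: (@rV_compact R n (fun i => `[a 0 i - r, a 0 i + r]%classic) (fun i => @segment_compact R _ _)).
have oK : open (~` K) by rewrite openC; exact: compact_closed.
have nKp : (~` K) p.
  by move=> [x Bx xp]; apply: ncp; rewrite -xp; have [] := image_param (BH _ Bx).
apply: (@smooth_in_near _ (fun=> 0)) => //.
  have : nbhs p (~` K) by exact: open_nbhs_nbhs.
  apply: filterS => q nKq; rewrite /chart_ext; case: ifPn => // /set_mem cq.
  rewrite u0// => Bq; apply: nKq; exists (coord c q); last by rewrite coordK.
  split; first exact/BE.
  have [V _ cV] := image_half_open c.
  by have := image_coord cq; rewrite cV => -[].
by apply: smooth_at_global => k; exact: Ck_cst.
Qed.

End chart.

(** * Metrics from spanning families of functions *)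

Section gram.
Import finmap.
Context {R : realType} {n : nat} {M : ptopologicalType}.
Variable S : smooth_structure R n M.
Implicit Types (c : chart R n M) (p q : M).

Definition spanning (I : finType) (u : I -> M -> R) : Prop :=
  forall p (v : 'rV[R]_n), (forall k, v *m differential S (u k) p = 0) -> v = 0.

(** The pull-back of the Euclidean metric under the map with components [u k]. The condition
    [spanning] says that this map is an immersion. *)
Definition gram (I : finType) (u : I -> M -> R) (p : M) : 'M[R]_n :=
  \sum_k differential S (u k) p *m (differential S (u k) p)^T.

Section family.
Context {I : finType} {u : I -> M -> R}.
Hypothesis su : forall k, smooth_function S (u k).

Lemma in_chart_gram c p : atlas S c -> dom c p -> in_chart S (gram u) c p =
  \sum_k dchart c (u k) p *m (dchart c (u k) p)^T.
Proof.
move=> Sc cp; rewrite /in_chart /gram mulmx_sumr mulmx_suml.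
apply: eq_bigr => k _; rewrite -(jacobian_differential Sc cp (su k)) trmx_mul.
by rewrite !mulmxA.
Qed.

Lemma gram_metric : spanning u ->
  exists g : riemannian_metric S, (g : M -> 'M[R]_n) = gram u.
Proof.
move=> spu.
have sym p : (gram u p)^T = gram u p.
  rewrite /gram raddf_sum; apply: eq_bigr => k _.
  by rewrite /= trmx_mul trmxK.
have quad p (v : 'rV[R]_n) : (v *m gram u p *m v^T) 0 0 =
    \sum_k ((v *m differential S (u k) p) 0 0) ^+ 2.
  rewrite /gram mulmx_sumr mulmx_suml summxE; apply: eq_bigr => k _.
  rewrite -!mulmxA -trmx_mul mulmxA.
  by rewrite mxE big_ord1 [X in _ * X]mxE expr2.
have pos p (v : 'rV[R]_n) : v != 0 -> 0 < (v *m gram u p *m v^T) 0 0.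
  move=> v0; rewrite quad lt0r; apply/andP; split; last first.
    by apply: sumr_ge0 => k _; exact: sqr_ge0.
  apply: contra v0 => /eqP/psumr_eq0P H; apply/eqP/(spu p) => k.
  apply/matrixP => i j; rewrite !ord1 [RHS]mxE; apply/eqP.
  by rewrite -sqrf_eq0 H// => l _; exact: sqr_ge0.
have smo c : atlas S c -> forall i j : 'I_n, smooth_on (coord c @` dom c)
    (fun x => in_chart S (gram u) c (param c x) i j).
  move=> Sc i j x cx.
  apply: (@smooth_at_near _ _ _ setT (fun x =>
     \sum_k rpartial i (u k \o param c) x * rpartial j (u k \o param c) x)) => //.
  - exact: openT.
  - move=> y cy _; have [cpy cy'] := image_param cy.
    rewrite in_chart_gram// summxE; apply: eq_bigr => k _.
    by rewrite mxE big_ord1 !mxE cy'.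
  - apply: smooth_at_sum => k; apply: smooth_atM; apply: smooth_at_rpartial => //;
      by [exact: image_half_open|exact: su].
by exists (Build_riemannian_metric sym pos smo).
Qed.

End family.

Lemma dchart_chart_ext c (F : 'rV[R]_n -> R) p : dom c p -> (forall k, Ck k setT F) ->
  dchart c (chart_ext c F) p = \col_i partial i F (coord c p).
Proof.
move=> cp CF; have /C_infinityE CT := CF; apply/colP => i; rewrite !mxE.
apply: (rpartialE i (image_half_open c) (image_coord cp) openT I CT).
by move=> y /image_param[cy yE] _; rewrite /= chart_extE// yE.
Qed.

Lemma chart_box c p : dom c p -> exists2 r : R, 0 < r &
  forall x, halfspace R n x -> (forall i, `|x 0 i - coord c p 0 i| <= 2 * r) -> chart_image c x.
Proof.
move=> cp; have [V oV cV] := image_half_open c.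
have : nbhs (coord c p) V.
  apply: open_nbhs_nbhs; split => //.
  by have := image_coord cp; rewrite cV => -[].
move=> /nbhs_rVP[d d0 dV]; exists (d / 4); first by rewrite divr_gt0.
move=> x Hx xd; rewrite cV; split => //; apply: dV => i.
by apply: le_lt_trans (xd i) _; lra.
Qed.

(** The value 1 off [dom c] is a placeholder that makes the function total. The doubled radius in
    [chart_box] accommodates the support of [plateau]. *)
Definition chart_radius c p : R :=
  if pselect (dom c p) is left cp then projT1 (cid2 (chart_box cp)) else 1.

Lemma chart_radiusP c p : dom c p -> 0 < chart_radius c p /\
  forall x, halfspace R n x ->
    (forall i, `|x 0 i - coord c p 0 i| <= 2 * chart_radius c p) -> chart_image c x.
Proof. by move=> cp; rewrite /chart_radius; case: pselect => // cp'; case: cid2. Qed.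

Definition cutoff c p := plateau (coord c p) (chart_radius c p).

Lemma Ck_cutoff c p k : Ck k setT (cutoff c p).
Proof. exact: Ck_plateau. Qed.

Lemma smooth_chart_ext_cutoff c p (F : 'rV[R]_n -> R) : hausdorff_space M ->
  atlas S c -> dom c p -> (forall k, Ck k setT F) ->
  smooth_function S (chart_ext c (fun x => cutoff c p x * F x)).
Proof.
move=> hM Sc cp CF; have [r0 rV] := chart_radiusP cp.
apply: (chart_ext_smooth (a := coord c p) (r := 2 * chart_radius c p)) => //.
  by move=> k; apply: CkM; [exact: openT|exact: Ck_cutoff|exact: CF].
move=> x nx; rewrite /cutoff plateau_eq0 ?mul0r//.
rewrite leNgt; apply/negP => /ltW le; apply: nx.
exact: sqdist_le_coord.
Qed.

(** The index [None] gives the cutoff itself. Its differential is what spoils [d (cutoff * x_j)]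
    where the cutoff is not constant, so having it in the family makes the differentials span
    wherever the cutoff is positive. *)
Definition cutoff_coord c p (o : option 'I_n) : M -> R :=
  chart_ext c (fun x => cutoff c p x * (if o is Some j then x 0 j else 1)).

Lemma smooth_cutoff_coord c p o : hausdorff_space M -> atlas S c -> dom c p ->
  smooth_function S (cutoff_coord c p o).
Proof.
move=> hM Sc cp; apply: smooth_chart_ext_cutoff => // k.
by case: o => [j|]; [exact: Ck_coord|exact: Ck_cst].
Qed.

(** In the chart [c], a vector [w] that kills the differential of the cutoff and that of the cutoff
    times [x_j] satisfies [cutoff * w_j = 0], and the cutoff is positive at [q]. *)
Lemma spanning_cutoff_coord c p q (v : 'rV[R]_n) : hausdorff_space M ->
  atlas S c -> dom c p ->
  dom c q -> sqdist (coord c p) (chart_radius c p) (coord c q) < 4 ->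
  (forall o, v *m differential S (cutoff_coord c p o) q = 0) -> v = 0.
Proof.
move=> hM Sc cp cq q4 H; have [Sq dq] := chart_atP S q.
have J := jac_unit Sq Sc dq cq.
set w := v *m jac (chart_at S q) c q.
suff w0 : w = 0 by rewrite -(mulmxK J v) -/w w0 mul0mx.
have [r0 _] := chart_radiusP cp.
have CF o k : Ck k setT (fun x : 'rV[R]_n => cutoff c p x * (if o is Some j then x 0 j else 1)).
  apply: CkM; [exact: openT|exact: Ck_cutoff|].
  by case: o => [j|]; [exact: Ck_coord|exact: Ck_cst].
have Hw o : w *m \col_i partial i (fun x : 'rV[R]_n =>
    cutoff c p x * (if o is Some j then x 0 j else 1)) (coord c q) = 0.
  rewrite -(dchart_chart_ext cq (CF o)) -mulmxA.
  have sc := smooth_cutoff_coord o hM Sc cp.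
  have [_ <-] := change_chart Sq Sc dq cq ((smooth_functionP _ _).1 sc _ _ Sc cq).
  exact: H.
clearbody w; have [_ [dchi _]] := Ck_cutoff c p 1.
have E0 : \sum_i w 0 i * partial i (cutoff c p) (coord c q) = 0.
  have := Hw None; rewrite (_ : (fun x : 'rV[R]_n => cutoff c p x * 1) = cutoff c p).
    move=> /(congr1 (fun m : 'M[R]_(1, 1) => m 0 0)); rewrite !mxE => E; rewrite -[RHS]E.
    by apply: eq_bigr => i _; rewrite mxE.
  by apply/funext => x; rewrite mulr1.
apply/rowP => j; rewrite [RHS]mxE.
have := congr1 (fun m : 'M[R]_(1, 1) => m 0 0) (Hw (Some j)); rewrite !mxE.
rewrite (eq_bigr (fun i => coord c q 0 j * (w 0 i * partial i (cutoff c p) (coord c q)) +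
   (i == j)%:R * (w 0 i * cutoff c p (coord c q)))); last first.
  move=> i _; have dj := is_derive_coord (coord c q) i j.
  have P := @partialM R n setT (cutoff c p) (fun x => x 0 j) (coord c q) i I
    (dchi _ i I) (@ex_derive _ _ _ _ _ _ _ dj).
  rewrite mxE P.
  rewrite [X in _ * X + _](_ : _ = (i == j)%:R); last first.
    by rewrite /partial (@derive_val _ _ _ _ _ _ _ dj).
  by ring.
rewrite big_split /= -mulr_sumr E0 mulr0 add0r (bigD1 j)//= eqxx mul1r big1 ?addr0.
  move=> /eqP; rewrite mulf_eq0 => /orP[/eqP//|]; rewrite gt_eqF//.
  exact: plateau_gt0.
by move=> i ij; rewrite (negbTE ij) mul0r.
Qed.

Lemma exists_spanning_family : hausdorff_space M -> compact [set: M] ->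
  exists (I : finType) (u : I -> M -> R),
    (forall k, smooth_function S (u k)) /\ spanning u.
Proof.
move=> hM; rewrite compact_cover => /(_ M setT (fun p => interior [set q |
   dom (chart_at S p) q /\ sqdist (coord (chart_at S p) p)
     (chart_radius (chart_at S p) p) (coord (chart_at S p) q) < 4])).
move=> [p _|p _|D _ MD]; first exact: open_interior.
  exists p => //; have [Sp cp] := chart_atP S p; have [r0 _] := chart_radiusP cp.
  apply: (near_coord (O := [set y | sqdist (coord (chart_at S p) p)
     (chart_radius (chart_at S p) p) y < 4]) cp).
  have := (Ck_sqdist (coord (chart_at S p) p) (chart_radius (chart_at S p) p) 0).1.
  move=> /(_ (coord (chart_at S p) p) I)/(cvgr_lt _); apply.
  by rewrite sqdist_center.
exists (D * option 'I_n)%type, (fun k => cutoff_coord (chart_at S (val k.1)) (val k.1) k.2).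
split=> [[p o] /=|q v H].
  by have [Sp cp] := chart_atP S (val p); exact: smooth_cutoff_coord.
have [p /= pD /interior_subset[cq q4]] := MD q I.
have [Sp cp] := chart_atP S p.
by apply: (spanning_cutoff_coord hM Sp cp cq q4) => o; exact: (H (FSetSub pD, o)).
Qed.

End gram.

(** * Riemannian volume *)

Section measurable_tuple.
Context {R : realType} {n : nat}.
Local Notation T := (n.-tuple (measurableTypeR R)).

Lemma measurable_tuple_ind (C : set (set T)) : sigma_algebra setT C ->
  (forall i (a : R), C [set t | a <= tnth t i]) -> @measurable _ T `<=` C.
Proof.
move=> sC Cray; apply: smallest_sub => //.
rewrite -bigcup_seq => A [i _ [B mB <-]]; rewrite setTI.
move: B mB; rewrite (_ : @measurable _ (measurableTypeR R) =
    (@measurable_realfun.RGenCInfty.G R).-sigma.-measurable); last first.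
  exact: measurable_realfun.RGenCInfty.measurableE.
have [C0 CC CU] := sC.
apply: smallest_sub.
  split.
  - by rewrite /mkset preimage_set0.
  - by move=> A0 /CC; rewrite !setTD preimage_setC.
  - by move=> F rF /=; rewrite preimage_bigcup; exact: CU.
move=> _ [a ->] /=; rewrite (_ : _ @^-1` _ = [set t | a <= tnth t i]) //.
by apply/seteqP; split => t /=; rewrite in_itv/= andbT.
Qed.

Lemma measurable_fun_tuple d (X : measurableType d) (D : set X) (f : X -> T) :
  measurable D ->
  (forall i (a : R), measurable (D `&` [set x | a <= tnth (f x) i])) ->
  measurable_fun D f.
Proof.
move=> mD H _ B mB; move: B mB; apply: (@measurable_tuple_ind [set B | measurable (D `&` f @^-1` B)]) => //.
split.
- by rewrite /= preimage_set0 setI0.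
- move=> B mB /=; rewrite setTD preimage_setC.
  rewrite (_ : _ `&` _ = D `\` (D `&` f @^-1` B)); first exact: measurableD.
  by rewrite setDIr setDv set0U setDE.
- by move=> F mF /=; rewrite preimage_bigcup setI_bigcupr; exact: bigcupT_measurable.
Qed.

(** The bridge between the topology of row vectors and the product sigma-algebra of tuples: open
    sets are dyadic open. *)
Lemma measurable_tuple_row_open (V : set 'rV[R]_n) : open V ->
  measurable [set t : T | V (tuple_row t)].
Proof.
move=> oV; apply: dyadic_open_measurable; apply: dyadic_open_ball => t Vt.
have [d d0 dV] := (nbhs_rVP _ _).1 (open_nbhs_nbhs (conj oV Vt)).
by exists d => // s st; apply: dV => i; rewrite !mxE.
Qed.

Lemma measurable_tuple_row_halfspace :
  measurable [set t : T | halfspace R n (tuple_row t)].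
Proof.
rewrite (_ : [set _ | _] = [set t : T | forall i : 'I_n, (if i == 0%N :> nat then
   [set` `[0 : R, +oo[%R] else setT) (tnth t i)]).
  apply: (@measurable_box R n (fun i : 'I_n => if i == 0%N :> nat then [set` `[0 : R, +oo[%R] else setT)).
  by move=> i; case: ifP => // _; exact: measurable_itv.
apply/seteqP; split=> t H i; have := H i; rewrite mxE.
  by case: eqP => // i0 /(_ i0) ti; rewrite /= in_itv/= ti.
by case: eqP => //; rewrite /= in_itv/= andbT.
Qed.

Lemma measurable_half_open (A : set 'rV[R]_n) : half_open A ->
  measurable [set t : T | A (tuple_row t)].
Proof.
move=> [V oV ->]; apply: measurableI; first exact: measurable_tuple_row_open.
exact: measurable_tuple_row_halfspace.
Qed.

End measurable_tuple.

Section chart_measurable.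
Context {R : realType} {n : nat} {M : ptopologicalType}.
Local Notation T := (n.-tuple (measurableTypeR R)).
Local Notation lam := (lebT n).
Implicit Types (c d : chart R n M) (p q : M) (E : set (borel M)).

Lemma open_borel (O : set M) : open O -> measurable (O : set (borel M)).
Proof. by move=> oO; apply: (@sub_sigma_algebra _ setT (@open M)). Qed.

Lemma measurable_dom c : measurable (dom c : set (borel M)).
Proof. by apply: open_borel; exact: (dom_open c). Qed.

Definition chart_tuple c (p : M) : T := row_tuple (coord c p).

Definition tuple_param c (t : T) : M := param c (tuple_row t).

Lemma chart_tupleK c p : dom c p -> tuple_param c (chart_tuple c p) = p.
Proof. by move=> cp; rewrite /tuple_param row_tupleK coordK. Qed.

Lemma chart_tuple_image c (E : set M) :
  [set t : T | (coord c @` E) (tuple_row t)] = chart_tuple c @` E.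
Proof.
apply/seteqP; split=> [t [p Ep pt]|_ [p Ep <-]].
  by exists p => //; rewrite /chart_tuple pt tuple_rowK.
by exists p => //; rewrite row_tupleK.
Qed.

Lemma chart_tuple_imageE c (E : set M) : E `<=` dom c -> chart_tuple c @` E =
  [set t | chart_image c (tuple_row t)] `&` tuple_param c @^-1` E.
Proof.
move=> Ec; apply/seteqP; split=> [_ [p Ep <-]|t [[p cp pt] /= Et]].
  by split; [exists p; [exact: Ec|rewrite row_tupleK]|rewrite /= chart_tupleK//; exact: Ec].
exists p; first by move: Et; rewrite /tuple_param -pt coordK.
by rewrite /chart_tuple pt tuple_rowK.
Qed.

Lemma measurable_tuple_param c :
  measurable_fun [set t : T | chart_image c (tuple_row t)]
    (tuple_param c : T -> borel M).
Proof.
apply: (@measurability _ _ T (borel M) _ _ (@open M)) => // _ [Z oZ <-].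
have [W oW cW] := within_continuous_open (@param_continuous _ _ _ c) oZ.
rewrite (_ : _ `&` _ = [set t : T | chart_image c (tuple_row t)] `&`
   [set t | W (tuple_row t)]).
  apply: measurableI; last exact: measurable_tuple_row_open.
  by apply: measurable_half_open; exact: (image_half_open c).
have cW' : chart_image c `&` param c @^-1` Z = chart_image c `&` W by [].
apply/seteqP; split=> t [ct Ot]; split=> //.
  have : (chart_image c `&` W) (tuple_row t) by rewrite -cW'.
  by case.
have : (chart_image c `&` param c @^-1` Z) (tuple_row t) by rewrite cW'.
by case.
Qed.

(** Inside the chart image, the image of [E] is its preimage under the inverse chart. *)
Lemma measurable_chart_tuple_image c E : measurable E -> E `<=` dom c ->
  measurable (chart_tuple c @` E).
Proof.
move=> mE Ec; rewrite chart_tuple_imageE//; apply: measurable_tuple_param => //.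
by apply: measurable_half_open; exact: (image_half_open c).
Qed.

Lemma measurable_chart_tuple c :
  measurable_fun (dom c : set (borel M)) (chart_tuple c : borel M -> T).
Proof.
apply: measurable_fun_tuple; first exact: measurable_dom.
move=> i a.
have -> : (dom c : set (borel M)) `&` [set x | a <= tnth (chart_tuple c x) i] =
    dom c `\` (dom c `&` coord c @^-1` [set x : 'rV[R]_n | x 0 i < a]).
  apply/seteqP; split=> p /=; rewrite tnth_mktuple leNgt.
    by move=> [cp /negP H]; split => // -[_] /=.
  by move=> [cp H]; split => //; apply/negP => H'; apply: H.
apply: measurableD; first exact: measurable_dom.
have oV : open [set x : 'rV[R]_n | x 0 i < a].
  rewrite (_ : [set _ | _] = (fun x : 'rV[R]_n => x 0 i) @^-1` [set y | y < a])//.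
  apply: open_comp; last exact: open_lt.
  by move=> x _; exact: ((Ck_coord 0 setT i).1 x I).
have [W oW ->] := within_continuous_open (@coord_continuous _ _ _ c) oV.
by apply: open_borel; apply: openI => //; exact: dom_open.
Qed.

End chart_measurable.

(** * Change of variables between charts *)

Section local_jacobian_bound.
Context {R : realType} {n : nat} {M : ptopologicalType}.
Variable S : smooth_structure R n M.
Local Notation T := (n.-tuple (measurableTypeR R)).
Local Notation lam := (lebT n).
Implicit Types (c d : chart R n M) (p q : M) (E : set (borel M)).

Lemma strict_differentiability_family m (V : set 'rV[R]_n) (F : 'I_m -> 'rV[R]_n -> R) x :
  open V -> V x -> (forall j k, Ck k V (F j)) -> forall eta : R, 0 < eta ->
  exists2 d : R, 0 < d & forall j (y z : 'rV[R]_n),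
    (forall i, `|y 0 i - x 0 i| < d) -> (forall i, `|z 0 i - x 0 i| < d) ->
    `|F j y - F j z - \sum_i (y 0 i - z 0 i) * partial i (F j) x|
      <= eta * \sum_i `|y 0 i - z 0 i|.
Proof.
move=> oV Vx CF eta eta0.
suff : \forall d \near (0 : R)^'+, forall j (y z : 'rV[R]_n),
    (forall i, `|y 0 i - x 0 i| < d) -> (forall i, `|z 0 i - x 0 i| < d) ->
    `|F j y - F j z - \sum_i (y 0 i - z 0 i) * partial i (F j) x|
      <= eta * \sum_i `|y 0 i - z 0 i|.
  move=> H; have [d [d0 dH]] : exists d : R, 0 < d /\ forall j (y z : 'rV[R]_n),
    (forall i, `|y 0 i - x 0 i| < d) -> (forall i, `|z 0 i - x 0 i| < d) ->
    `|F j y - F j z - \sum_i (y 0 i - z 0 i) * partial i (F j) x|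
      <= eta * \sum_i `|y 0 i - z 0 i|.
    apply: (@filter_ex _ (0 : R)^'+).
    by near=> d; split; [near: d; exact: nbhs_right_gt|near: d; exact: H].
  by exists d.
apply: filter_forall => j.
have [_ [dF pF]] := CF j 1%N.
have [d d0 dH] := partial_strict_differentiability oV Vx dF (fun i => (pF i).1 x Vx) eta0.
near=> d' => y z yx zx; apply: dH => i.
  apply: lt_trans (yx i) _; near: d'; exact: nbhs_right_lt.
apply: lt_trans (zx i) _; near: d'; exact: nbhs_right_lt.
Unshelve. all: by end_near. Qed.

(* In the chart [d], seen through the inverse of the differential at [p] of the
   transition map, [E] is a [(1 + e)]-Lipschitz image of [E] in the chart [c]. *)
Lemma local_jacobian_bound c d p (e : R) : atlas S c -> atlas S d ->
  dom c p -> dom d p -> 0 < e ->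
  exists2 Z : set M, open Z /\ Z p & forall E, measurable E ->
    E `<=` dom c `&` dom d -> E `<=` Z ->
    (lam (chart_tuple d @` E) <=
     ((1 + e) ^+ n * `|\det (jac c d p)|)%:E * lam (chart_tuple c @` E))%E.
Proof.
move=> Sc Sd cp dp e0; set J := jac c d p.
have uJ : J \in unitmx by exact: (jac_unit Sc Sd cp dp).
pose phi (j : 'I_n) x := coord d (param c x) 0 j.
have xA : (coord c @` (dom c `&` dom d)) (coord c p) by exists p.
have [V [F [oV Vx CF Fphi]]] := smooth_at_family (fun j => atlas_compatible Sc Sd j xA).
have JE i j : J i j = partial i (F j) (coord c p).
  rewrite mxE; have /C_infinityE CFj : forall k, Ck k V (F j) by [].
  exact: (rpartialE i (overlap_half_open c d) xA oV Vx CFj (Fphi j)).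
pose C := \sum_j \sum_k `|invmx J j k|.
have C0 : 0 <= C by apply: sumr_ge0 => j _; exact: sumr_ge0.
(* Chosen so that [eta * n * C <= e]; the added 1 keeps the denominator positive. *)
pose eta := e / (n%:R * C + 1).
have D0 : 0 < n%:R * C + 1 by rewrite ltr_wpDl// mulr_ge0.
have eta0 : 0 < eta by rewrite divr_gt0.
have [dl dl0 dH] := strict_differentiability_family oV Vx CF eta0.
have NO : nbhs (coord c p) [set x | V x /\ forall i, `|x 0 i - coord c p 0 i| < dl].
  have NV : nbhs (coord c p) V by apply: open_nbhs_nbhs.
  apply: (filterI NV).
  by apply/nbhs_rVP; exists dl.
have [Z [oZ Zp] ZE] := near_open (near_coord cp NO).
exists Z => // E mE Ecd EZ.
pose Phi x : 'rV[R]_n := \row_j F j x.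
have PhiE q : E q -> Phi (coord c q) = coord d q.
  move=> Eq; have [cq [Vq _]] := ZE _ (EZ _ Eq); have [_ dq] := Ecd _ Eq.
  apply/rowP => j; rewrite mxE Fphi//; first by rewrite coordK.
  by exists q.
pose f (t : T) : T := mxmap (invmx J) (row_tuple (Phi (tuple_row t))).
have fE q : E q -> f (chart_tuple c q) = mxmap (invmx J) (chart_tuple d q).
  by move=> Eq; rewrite /f row_tupleK PhiE.
have Ec : E `<=` dom c by move=> q /Ecd[].
have Ed : E `<=` dom d by move=> q /Ecd[].
have dJf : chart_tuple d @` E = mxmap J @` (f @` (chart_tuple c @` E)).
  rewrite !image_comp; apply/seteqP; split=> _ [q Eq <-]; exists q => //=;
  by rewrite fE// mxmapM mulVmx// mxmap1.
(* [A] is the image in [c] of the Borel set [EA], so its image under [f] is a linear image of the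
   chart image of [EA] in [d]. *)
have mf A : A `<=` chart_tuple c @` E -> measurable A -> measurable (f @` A).
  move=> AE mA; pose EA : set (borel M) := E `&` (dom c `&` chart_tuple c @^-1` A).
  have mEA : measurable EA.
    apply: measurableI => //; apply: measurable_chart_tuple => //.
    exact: measurable_dom.
  rewrite (_ : f @` A = mxmap (invmx J) @` (chart_tuple d @` EA)).
    apply: measurable_mxmap_image; first by rewrite unitmx_inv.
    by apply: measurable_chart_tuple_image => // q [/Ed].
  rewrite image_comp; apply/seteqP; split.
    move=> _ [t At <-]; have [q Eq qt] := AE _ At.
    exists q => /=; last by rewrite -fE// qt.
    by split => //; split; [exact: Ec|rewrite /= qt].
  move=> _ [q [Eq [cq Aq]] <-]; exists (chart_tuple c q) => //.
  by rewrite fE.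
have lip b : 0 <= b -> forall s t, (chart_tuple c @` E) s -> (chart_tuple c @` E) t ->
    (forall i, `|tnth s i - tnth t i : R| <= b) ->
    forall i, `|tnth (f s) i - tnth (f t) i : R| <= (1 + e) * b.
  move=> b0 _ _ [q Eq <-] [q' Eq' <-] st k.
  have st' i : `|coord c q 0 i - coord c q' 0 i| <= b.
    by have := st i; rewrite !tnth_mktuple.
  have [_ [_ qd]] := ZE _ (EZ _ Eq); have [_ [_ q'd]] := ZE _ (EZ _ Eq').
  rewrite /f !row_tupleK !mxmapE -sumrB.
  set y := coord c q; set z := coord c q'.
  pose r j := F j y - F j z - \sum_i (y 0 i - z 0 i) * J i j.
  have rle j : `|r j| <= eta * (n%:R * b).
    rewrite /r; under eq_bigr do rewrite JE.
    apply: le_trans (dH j _ _ qd q'd) _; rewrite ler_pM2l//.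
    apply: (@le_trans _ _ (\sum_(i < n) b)); first by apply: ler_sum => i _; exact: st'.
    by rewrite sumr_const card_ord mulr_natl.
  (* After composition with the inverse of [J] the linear part is the identity, and only the
     remainder [r] of strict differentiability perturbs it. *)
  have -> : \sum_i ((tnth (row_tuple (Phi y)) i : R) * invmx J i k -
        (tnth (row_tuple (Phi z)) i : R) * invmx J i k) =
      (y 0 k - z 0 k) + \sum_j r j * invmx J j k.
    have := congr1 (fun w : 'rV[R]_n => w 0 k) (mulmxK uJ (y - z)).
    rewrite [RHS]mxE [(- z) 0 k]mxE => <-; rewrite mxE -big_split /=.
    apply: eq_bigr => j _; rewrite -mulrDl -mulrBl; congr (_ * _).
    rewrite !tnth_mktuple !mxE /r [RHS]addrC.
    have -> : \sum_i (y - z) 0 i * J i j = \sum_i (y 0 i - z 0 i) * J i j.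
      by apply: eq_bigr => i _; rewrite [in LHS]mxE [(- z) 0 i]mxE.
    by rewrite subrK.
  rewrite mulrDl mul1r; apply: le_trans (ler_normD _ _) _; apply: lerD; first exact: st'.
  apply: le_trans (ler_norm_sum _ _ _) _.
  apply: (@le_trans _ _ (\sum_j eta * (n%:R * b) * `|invmx J j k|)).
    by apply: ler_sum => j _; rewrite normrM ler_wpM2r.
  rewrite -mulr_sumr.
  apply: (@le_trans _ _ (eta * (n%:R * b) * C)).
    apply: ler_wpM2l; first by rewrite mulr_ge0 ?(ltW eta0)// mulr_ge0.
    apply: ler_sum => j _; rewrite (bigD1 k)//= lerDl; exact: sumr_ge0.
  rewrite -mulrA [_ * C]mulrAC mulrA ler_wpM2r//.
  rewrite /eta -mulrA ler_piMr ?(ltW e0)// mulrC ler_pdivrMr// mul1r.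
  by rewrite lerDl.
rewrite dJf; apply: (@le_trans _ _ (`|\det J|%:E * lam (f @` (chart_tuple c @` E)))%E).
  have [_] := dilation_le_det uJ; apply.
  by apply: mf => //; exact: measurable_chart_tuple_image.
rewrite mulrC EFinM -muleA; apply: lee_wpmul2l; first by rewrite lee_fin.
have e1 : 0 < 1 + e by rewrite ltr_wpDl.
have := @lebT_lipschitz_image R n (fun=> 1 + e) f _ (fun=> e1) mf lip.
rewrite prodr_const card_ord; apply.
exact: measurable_chart_tuple_image.
Qed.

End local_jacobian_bound.

Lemma cvg_det (R : realType) (T : Type) (F : set_system T) (FF : Filter F) n
    (A : T -> 'M[R]_n) (B : 'M[R]_n) :
  (forall i j, A t i j @[t --> F] --> B i j) -> \det (A t) @[t --> F] --> \det B.
Proof.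
move=> AB; apply: cvg_big => [|s _]; first exact: add_continuous.
apply: cvgMr; apply: cvg_big => [|i _]; first exact: mul_continuous.
exact: AB.
Qed.

(** On the segment from the identity to [A] all forms are positive definite, so the determinant
    never vanishes and keeps the sign it has at the identity. *)
Lemma posdef_det_gt0 (R : realType) n (A : 'M[R]_n) :
  (forall v : 'rV[R]_n, v != 0 -> 0 < (v *m A *m v^T) 0 0) -> 0 < \det A.
Proof.
move=> pA; pose B (t : R) : 'M[R]_n := (1 - t) *: 1%:M + t *: A.
have pB t : 0 <= t <= 1 -> \det (B t) != 0.
  move=> /andP[t0 t1]; apply/negP => /det0P[v v0 vB].
  have : (v *m B t *m v^T) 0 0 = 0 by rewrite vB mul0mx mxE.
  rewrite /B mulmxDr mulmxDl -!scalemxAr -!scalemxAl mulmx1 !mxE.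
  have v1 : 0 < (v *m v^T) 0 0.
    rewrite mxE lt0r; apply/andP; split; last first.
      by apply: sumr_ge0 => i _; rewrite mxE -expr2 sqr_ge0.
    apply: contra v0 => /eqP/psumr_eq0P H; apply/eqP/rowP => i; apply/eqP.
    rewrite [X in _ == X]mxE -sqrf_eq0; have := H _ i isT; rewrite mxE -expr2 => ->//.
    by move=> j _; rewrite mxE -expr2 sqr_ge0.
  have v2 := pA v v0; rewrite mxE in v1; rewrite mxE in v2.
  move: v1 v2; set a := \sum_j _; set b := \sum_j _ => a0 b0 ab.
  have ta : 0 <= (1 - t) * a by rewrite mulr_ge0 ?subr_ge0// ltW.
  have tb : 0 <= t * b by rewrite mulr_ge0// ltW.
  move/eqP: ab; rewrite paddr_eq0// !mulf_eq0 (gt_eqF a0) (gt_eqF b0) !orbF.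
  by rewrite subr_eq0 => /andP[/eqP <-]; rewrite oner_eq0.
have B0 : \det (B 0) = 1 by rewrite /B subr0 scale1r scale0r addr0 det1.
have B1 : \det (B 1) = \det A by rewrite /B subrr scale0r add0r scale1r.
rewrite ltNge; apply/negP => A0.
have cB : {within `[0, 1], continuous (fun t => \det (B t))}.
  apply: continuous_subspaceT => t; apply: cvg_det => i j.
  rewrite !mxE; under eq_fun do rewrite !mxE.
  apply: cvgD; apply: cvgMl.
    by apply: cvgB; [exact: cvg_cst|exact: cvg_id].
  exact: cvg_id.
have [|t t01 Bt] := @IVT R (fun t => \det (B t)) 0 1 0 ler01 cB.
  rewrite B0 B1; apply/andP; split; first by rewrite ge_min A0 orbT.
  by rewrite le_max ler01.
by move: (pB t); rewrite Bt eqxx => /(_ t01).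
Qed.

Section density.
Context {R : realType} {n : nat} {M : ptopologicalType}.
Variables (S : smooth_structure R n M) (g : riemannian_metric S).
Local Notation T := (n.-tuple (measurableTypeR R)).
Local Notation lam := (lebT n).
Implicit Types (c d : chart R n M) (p q : M) (E : set (borel M)).

Lemma smooth_in_continuous c (f : M -> R) p : dom c p -> smooth_in c f p ->
  {for p, continuous f}.
Proof.
move=> cp /(smooth_at_continuous (image_coord cp)) sf A.
rewrite /= coordK// in sf => /sf /near_coord-/(_ cp)/=.
apply: filterS => q [cq] /(_ (image_coord cq)) /=.
by rewrite coordK.
Qed.

Lemma continuous_open_measurable (V : set M) (f : M -> R) : open V ->
  (forall p, V p -> {for p, continuous f}) ->
  measurable_fun (V : set (borel M)) (f : borel M -> measurableTypeR R).
Proof.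
move=> oV cf; apply: (@measurability _ _ (borel M) (measurableTypeR R) _ _
  (@measurable_realfun.RGenOpens.G R)).
  exact: measurable_realfun.RGenOpens.measurableE.
move=> _ [_ [a [b ->]] <-]; apply: open_borel.
rewrite openE => p [Vp fp]; apply: filterI; first exact: open_nbhs_nbhs.
apply: (cf _ Vp); apply: open_nbhs_nbhs; split => //.
Qed.

Definition chart_density c p : R := Num.sqrt (\det (in_chart S g c p)).

Lemma in_chart_det_gt0 c p : atlas S c -> dom c p -> 0 < \det (in_chart S g c p).
Proof.
move=> Sc cp; apply: posdef_det_gt0 => v v0.
rewrite /in_chart !mulmxA -mulmxA -trmx_mul; apply: metric_positive.
apply: contra v0 => /eqP vJ; apply/eqP.
by rewrite -(mulmxK (jacobian_unit Sc cp) v) vJ mul0mx.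
Qed.

Lemma chart_density_gt0 c p : atlas S c -> dom c p -> 0 < chart_density c p.
Proof. by move=> Sc cp; rewrite sqrtr_gt0 in_chart_det_gt0. Qed.

Lemma chart_density_continuous c p : atlas S c -> dom c p ->
  {for p, continuous (chart_density c)}.
Proof.
move=> Sc cp; apply: continuous_comp; last exact: sqrt_continuous.
apply: cvg_det => i j.
apply: (smooth_in_continuous cp (f := fun q => in_chart S g c q i j)).
exact: (metric_smooth g Sc i j (image_coord cp)).
Qed.

Lemma chart_density_jac c d p : atlas S c -> atlas S d -> dom c p -> dom d p ->
  chart_density c p = `|\det (jac c d p)| * chart_density d p.
Proof.
move=> Sc Sd cp dp; rewrite /chart_density /in_chart (jacobian_jac Sc Sd cp dp).
rewrite trmx_mul !mulmxA -[in LHS]mulmxA det_mulmx.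
set B := jacobian S d p; rewrite -!mulmxA !det_mulmx !det_tr.
set J := \det (jac c d p).
rewrite (_ : _ * _ = J ^+ 2 * (\det B * (\det (g p) * \det B))); last by ring.
by rewrite sqrtrM ?sqr_ge0// sqrtr_sqr.
Qed.

Definition chart_volume c E : \bar R :=
  (\int[lam]_(t in chart_tuple c @` E) (chart_density c (tuple_param c t))%:E)%E.

Lemma measurable_chart_density c E : atlas S c -> measurable E -> E `<=` dom c ->
  measurable_fun (chart_tuple c @` E)
    (fun t => (chart_density c (tuple_param c t))%:E).
Proof.
move=> Sc mE Ec; apply/measurable_EFinP.
apply: (measurable_comp (F := dom c : set (borel M))).
- exact: measurable_dom.
- by move=> _ [_ [p Ep <-] <-]; rewrite chart_tupleK; exact: Ec.
- apply: continuous_open_measurable; first exact: dom_open.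
  by move=> p cp; exact: chart_density_continuous.
- apply: measurable_funS (measurable_tuple_param (c := c)).
    by apply: measurable_half_open; exact: (image_half_open c).
  by move=> _ [p Ep <-] /=; rewrite row_tupleK; exists p => //; exact: Ec.
Qed.

Lemma chart_volume_bigcup c (F : nat -> set (borel M)) : atlas S c ->
  (forall j, measurable (F j)) -> (forall j, F j `<=` dom c) -> trivIset setT F ->
  chart_volume c (\bigcup_j F j) = (\sum_(j <oo) chart_volume c (F j))%E.
Proof.
move=> Sc mF Fc tF; rewrite /chart_volume image_bigcup ge0_integral_bigcup//.
- by move=> j; exact: measurable_chart_tuple_image.
- rewrite -image_bigcup; apply: measurable_chart_density => //.
    exact: bigcupT_measurable.
  by move=> p [j _]; exact: Fc.
- by move=> t _; rewrite lee_fin sqrtr_ge0.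
- move=> i j _ _ [_ [[p Fp <-] [q Fq qp]]]; apply: (tF i j) => //.
  exists p; split => //; rewrite -(chart_tupleK (Fc _ _ Fp)) -qp chart_tupleK//.
  exact: Fc Fq.
Qed.

Lemma chart_volume_ge0 c E : (0 <= chart_volume c E)%E.
Proof. by apply: integral_ge0 => t _; rewrite lee_fin sqrtr_ge0. Qed.

Lemma chart_volume_le c E (a : R) : atlas S c -> measurable E -> E `<=` dom c ->
  (forall p, E p -> chart_density c p <= a) ->
  (chart_volume c E <= a%:E * lam (chart_tuple c @` E))%E.
Proof.
move=> Sc mE Ec Ea; have mtE := measurable_chart_tuple_image mE Ec.
rewrite -integral_cst//; apply: ge0_le_integral => //.
- by move=> t _; rewrite lee_fin sqrtr_ge0.
- exact: measurable_chart_density.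
- by move=> _ [p Ep <-]; rewrite lee_fin chart_tupleK; [exact: Ea|exact: Ec].
Qed.

Lemma chart_volume_ge c E (a : R) : atlas S c -> measurable E -> E `<=` dom c ->
  0 <= a -> (forall p, E p -> a <= chart_density c p) ->
  (a%:E * lam (chart_tuple c @` E) <= chart_volume c E)%E.
Proof.
move=> Sc mE Ec a0 Ea; have mtE := measurable_chart_tuple_image mE Ec.
rewrite -integral_cst//; apply: ge0_le_integral => //.
- exact: measurable_chart_density.
- by move=> _ [p Ep <-]; rewrite lee_fin chart_tupleK; [exact: Ea|exact: Ec].
Qed.

End density.

Section chart_independence.
Context {R : realType} {n : nat} {M : ptopologicalType}.
Variables (S : smooth_structure R n M) (g : riemannian_metric S).
Local Notation T := (n.-tuple (measurableTypeR R)).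
Local Notation lam := (lebT n).
Implicit Types (c d : chart R n M) (p q : M) (E : set (borel M)).

(** Of the [n + 2] factors [1 + e], [n] come from the transition map, and two from replacing the
    densities in [c] and in [d] by their values at [p]. *)
Lemma chart_volume_local c d p (e : R) : atlas S c -> atlas S d ->
  dom c p -> dom d p -> 0 < e ->
  exists2 Z : set M, open Z /\ Z p & forall E, measurable E ->
    E `<=` dom c `&` dom d -> E `<=` Z ->
    (chart_volume g d E <= ((1 + e) ^+ n.+2)%:E * chart_volume g c E)%E.
Proof.
move=> Sc Sd cp dp e0; have e1 : 0 < 1 + e by rewrite ltr_wpDl.
have [Z1 [oZ1 Z1p] Z1E] := local_jacobian_bound Sc Sd cp dp e0.
have c0 := chart_density_gt0 g Sc cp; have d0 := chart_density_gt0 g Sd dp.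
have Nc : \forall q \near p, chart_density g c p / (1 + e) <= chart_density g c q.
  apply: (cvgr_ge (chart_density g c p)); first exact: chart_density_continuous.
  move: c0; move: (chart_density g c p) => a a0.
  by rewrite ltr_pdivrMr// mulrDr mulr1 ltrDl mulr_gt0.
have Nd : \forall q \near p, chart_density g d q <= (1 + e) * chart_density g d p.
  apply: (cvgr_le (chart_density g d p)); first exact: chart_density_continuous.
  move: d0; move: (chart_density g d p) => a a0.
  by rewrite mulrDl mul1r ltrDl mulr_gt0.
have [Z2 [oZ2 Z2p] Z2E] := near_open (filterI Nc Nd).
exists (Z1 `&` Z2); first by split; [exact: openI|].
move=> E mE Ecd EZ.
have Ec : E `<=` dom c by move=> q /Ecd[].
have Ed : E `<=` dom d by move=> q /Ecd[].
apply: (@le_trans _ _ (((1 + e) * chart_density g d p)%:E * lam (chart_tuple d @` E))%E).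
  by apply: chart_volume_le => // q /EZ[_ /Z2E[_]].
apply: (@le_trans _ _ (((1 + e) * chart_density g d p)%:E *
  (((1 + e) ^+ n * `|\det (jac c d p)|)%:E * lam (chart_tuple c @` E)))%E).
  apply: lee_wpmul2l; first by rewrite lee_fin; exact: mulr_ge0 (ltW e1) (ltW d0).
  by apply: Z1E => // q /EZ[].
apply: (@le_trans _ _ (((1 + e) ^+ n.+2)%:E *
  ((chart_density g c p / (1 + e))%:E * lam (chart_tuple c @` E)))%E); last first.
  apply: lee_wpmul2l; first by rewrite lee_fin exprn_ge0// ltW.
  have ce0 := divr_ge0 (ltW c0) (ltW e1).
  by apply: (chart_volume_ge Sc mE Ec ce0) => q /EZ[_ /Z2E[]].
rewrite !muleA -!EFinM; apply: lee_wpmul2r => //; rewrite lee_fin.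
rewrite (chart_density_jac g Sc Sd cp dp) !exprS le_eqVlt; apply/orP; left; apply/eqP.
by field; rewrite gt_eqF.
Qed.

Lemma chart_volume0 c : chart_volume g c set0 = 0%E.
Proof. by rewrite /chart_volume image_set0 integral_set0. Qed.

(** The local estimate is summed over countably many disjoint pieces, then [e] tends to 0. The same
    inequality with the charts exchanged gives equality. *)
Lemma chart_volume_overlap_le c d E : atlas S c -> atlas S d -> measurable E ->
  E `<=` dom c `&` dom d -> (chart_volume g d E <= chart_volume g c E)%E.
Proof.
move=> Sc Sd mE Ecd; apply: (@le_expr1D_mul _ n.+2); first exact: chart_volume_ge0.
move=> e e0; have e1 : 0 < 1 + e by rewrite ltr_wpDl.
have Ec : E `<=` dom c by move=> q /Ecd[].
have Ed : E `<=` dom d by move=> q /Ecd[].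
(* Quantifying over all [E'] with image inside [Q] makes the property pass to subsets of [Q], so it
   survives disjointification. *)
pose good (Q : set T) := forall E', measurable E' -> E' `<=` dom c `&` dom d ->
  chart_tuple c @` E' `<=` Q ->
  (chart_volume g d E' <= ((1 + e) ^+ n.+2)%:E * chart_volume g c E')%E.
(* An enumeration of the good dyadic cubes; codes of other cubes give the empty set. *)
pose F j : set T := if @unpickle (nat * {ffun 'I_n -> int})%type j is Some kz
  then [set t | good (dyadic_cube kz.1 kz.2) /\ dyadic_cube kz.1 kz.2 t] else set0.
have goodF j A : A `<=` F j -> good A.
  rewrite /F; case: unpickle => [[k z]|] AF E' mE' E'cd E'A.
    have [->|/set0P[q E'q]] := eqVneq E' set0.
      by rewrite !chart_volume0 mule0.
    have [|gQ _] := AF (chart_tuple c q); first by apply: E'A; exists q.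
    by apply: gQ => // t /E'A/AF[].
  have [->|/set0P[q E'q]] := eqVneq E' set0.
    by rewrite !chart_volume0 mule0.
  by have [] := AF (chart_tuple c q); apply: E'A; exists q.
have mF j : measurable (F j).
  rewrite /F; case: unpickle => [[k z]|]//.
  have [gQ|nQ] := pselect (good (dyadic_cube k z)).
    rewrite (_ : [set _ | _] = dyadic_cube k z); first exact: measurable_dyadic_cube.
    by apply/seteqP; split=> t //= -[].
  by rewrite (_ : [set _ | _] = set0)//; apply/seteqP; split=> t //= -[].
have EF q : E q -> exists j, F j (chart_tuple c q).
  move=> Eq; have [cq dq] := Ecd _ Eq.
  have [Z [oZ Zq] ZE] := chart_volume_local Sc Sd cq dq e0.
  have /nbhs_rVP[r r0 rZ] := near_param cq (open_nbhs_nbhs (conj oZ Zq)).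
  have [k kr] := exists_half_expr_lt r0.
  exists (pickle (k, dyadic_index k (chart_tuple c q))).
  rewrite /F pickleK /=; split => // E' mE' E'cd E'Q.
  apply: ZE => // q' E'q'; have [cq' _] := E'cd _ E'q'.
  rewrite -(coordK cq'); apply: rZ; last by exists q'.
  move=> i; apply: lt_trans kr.
  have /(_ (chart_tuple c q')) := E'Q; move=> /(_ (ex_intro2 _ _ q' E'q' erefl)).
  by move=> /(dyadic_index_dist i); rewrite !tnth_mktuple.
pose D j : set (borel M) := E `&` (dom c `&` chart_tuple c @^-1` (seqDU F j)).
have mD j : measurable (D j).
  apply: measurableI => //; apply: measurable_chart_tuple; first exact: measurable_dom.
  by rewrite /seqDU; apply: measurableD => //; exact: bigsetU_measurable.
have DE j : D j `<=` E by move=> q [].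
have ED : E = \bigcup_j D j.
  apply/seteqP; split; last by move=> q [j _ /DE].
  move=> q Eq; have [j Fj] := EF _ Eq.
  have : (\bigcup_j seqDU F j) (chart_tuple c q) by rewrite -seqDU_bigcup_eq; exists j.
  by move=> [k _ Fk]; exists k => //; split => //; split => //; exact: Ec.
have tD : trivIset setT D.
  move=> i j _ _ [q [[_ [_ qi]] [_ [_ qj]]]].
  by apply: (@trivIset_seqDU _ F) => //; exists (chart_tuple c q).
rewrite ED !chart_volume_bigcup//; try by move=> j q /DE; by [exact: Ec|exact: Ed].
rewrite -nneseriesZl//; last by move=> *; exact: chart_volume_ge0.
apply: lee_nneseries => [j *|j _]; first exact: chart_volume_ge0.
have gj : good (seqDU F j) by apply: (goodF j) => t [].
by apply: gj => // [q /DE/Ecd//|_ [q [_ [_ qj]] <-]].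
Qed.

Lemma chart_volume_overlap c d E : atlas S c -> atlas S d -> measurable E ->
  E `<=` dom c `&` dom d -> chart_volume g d E = chart_volume g c E.
Proof.
move=> Sc Sd mE Ecd; have Edc : E `<=` dom d `&` dom c by move=> q /Ecd[].
apply: le_anti; apply/andP; split.
  exact: chart_volume_overlap_le Sc Sd mE Ecd.
exact: chart_volume_overlap_le Sd Sc mE Edc.
Qed.

End chart_independence.

(** * Existence, comparison and finiteness of the volume *)

Section volume.
Import finmap.
Context {R : realType} {n : nat} {M : ptopologicalType}.
Variable S : smooth_structure R n M.
Local Notation T := (n.-tuple (measurableTypeR R)).
Local Notation lam := (lebT n).
Implicit Types (c d : chart R n M) (p q : M) (E : set (borel M)).
Implicit Types (g : riemannian_metric S) (v : {measure set (borel M) -> \bar R}).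

Lemma is_volumeP g v : is_volume g v <-> forall c, atlas S c ->
  forall E, measurable E -> E `<=` dom c -> v E = chart_volume g c E.
Proof.
have H c E : chart_volume g c E = (\int[@lebesgue_tuple R n]_(t in
   [set t | (coord c @` E) (tuple_row t)])
   (Num.sqrt (\det (in_chart S g c (param c (tuple_row t)))))%:E)%E.
  by rewrite -lebTE chart_tuple_image.
by split=> H1 c Sc E mE Ec; [rewrite H|rewrite -H]; exact: H1.
Qed.

Hypothesis cM : compact [set: M].

Lemma countable_open_cover (Z : M -> set M) : (forall p, open (Z p) /\ Z p p) ->
  exists (N : nat) (s : nat -> M), forall q, exists2 i, (i < N)%N & Z (s i) q.
Proof.
move=> oZ; move: cM; rewrite compact_cover => /(_ M setT Z) [p _|p _|D _ MD].
- by have [] := oZ p.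
- by exists p => //; have [] := oZ p.
exists (size (enum_fset D)), (nth point (enum_fset D)) => q.
have [p /= pD Zq] := MD q I.
by exists (index p (enum_fset D)); rewrite ?index_mem// nth_index.
Qed.

(** The finite subcover is listed as a sequence and made disjoint. Past its end the list repeats a
    default chart, whose disjointified pieces are empty. *)
Lemma chart_partition : exists (c : nat -> chart R n M) (D : nat -> set (borel M)),
  [/\ forall i, atlas S (c i), forall i, measurable (D i),
      forall i, D i `<=` dom (c i), trivIset setT D & \bigcup_i D i = setT].
Proof.
have [|N [s sM]] := @countable_open_cover (fun p => dom (chart_at S p)).
  by move=> p; have [_ cp] := chart_atP S p; split => //; exact: dom_open.
pose c i := chart_at S (s i); pose F i : set (borel M) := dom (c i).
have mF i : measurable (F i) by exact: measurable_dom.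
exists c, (seqDU F); split.
- by move=> i; have [] := chart_atP S (s i).
- by move=> i; apply: measurableD => //; exact: bigsetU_measurable.
- by move=> i q [].
- exact: trivIset_seqDU.
- rewrite -seqDU_bigcup_eq; apply/seteqP; split=> // q _.
  by have [i _ Zi] := sM q; exists i.
Qed.

(** Sum over the pieces of a partition of the volume read in the chart of each piece. Agreement on
    overlaps gives the required formula in every chart, not only in the chosen ones. *)
Lemma exists_volume g : exists v, is_volume g v.
Proof.
have [c [D [Sc mD Dc tD DT]]] := chart_partition.
pose nu i E := chart_volume g (c i) (E `&` D i).
have ED i E : E `&` D i `<=` dom (c i) by move=> q [_ /Dc].
have nu0 i : nu i set0 = 0%E by rewrite /nu set0I chart_volume0.
have nu_ge0 i E : (0 <= nu i E)%E by exact: chart_volume_ge0.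
have nu_sigma i : semi_sigma_additive (nu i).
  move=> F mF tF mUF; rewrite [X in _ --> X](_ : _ = (\sum_(j <oo) nu i (F j))%E).
    by apply/cvg_closeP; split; [apply: is_cvg_nneseries => *; exact: nu_ge0|rewrite closeE].
  have mFD j : measurable (F j `&` D i) by exact: measurableI.
  have tFD : trivIset setT (fun j => F j `&` D i) by exact: trivIset_setIr.
  by rewrite {1}/nu setI_bigcupl (chart_volume_bigcup g (Sc i) mFD (fun j => ED i (F j)) tFD).
pose nuM i : {measure set (borel M) -> \bar R} :=
  HB.pack (nu i) (isMeasure.Build _ _ _ (nu i) (nu0 i) (nu_ge0 i) (nu_sigma i)).
exists (mseries nuM 0); apply/is_volumeP => d Sd E mE Ed.
have mED i : measurable (E `&` D i) by exact: measurableI.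
have EDd i : E `&` D i `<=` dom d by move=> q [/Ed].
have tED : trivIset setT (fun i => E `&` D i) by exact: trivIset_setIl.
have EE : E = \bigcup_i (E `&` D i) by rewrite -setI_bigcupr DT setIT.
rewrite [RHS](congr1 (chart_volume g d) EE) (chart_volume_bigcup g Sd mED EDd tED).
rewrite /mseries; apply: eq_eseriesr => i _.
apply: (chart_volume_overlap g Sd (Sc i) (mED i)) => q [Eq Dq].
by split; [exact: Ed|exact: Dc Dq].
Qed.

Lemma volume_le g g' v v' (K : R) : is_volume g v -> is_volume g' v' -> 0 <= K ->
  (forall c p, atlas S c -> dom c p -> chart_density g c p <= K * chart_density g' c p) ->
  forall E, measurable E -> (v E <= K%:E * v' E)%E.
Proof.
move=> /is_volumeP vg /is_volumeP vg' K0 gK E mE.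
have [c [D [Sc mD Dc tD DT]]] := chart_partition.
have ED : E = \bigcup_i (E `&` D i) by rewrite -setI_bigcupr DT setIT.
have mED i : measurable (E `&` D i) by exact: measurableI.
have EDc i : E `&` D i `<=` dom (c i) by move=> q [_ /Dc].
have tED : trivIset setT (fun i => E `&` D i) by exact: trivIset_setIl.
have mUED := bigcupT_measurable _ mED.
rewrite ED (measure_semi_bigcup v mED tED mUED) (measure_semi_bigcup v' mED tED mUED).
rewrite -nneseriesZl; last by move=> *; exact: measure_ge0.
apply: lee_nneseries => [i *|i _]; first exact: measure_ge0.
rewrite (vg _ (Sc i) _ (mED i) (EDc i)) (vg' _ (Sc i) _ (mED i) (EDc i)) /chart_volume.
have mt := measurable_chart_tuple_image (mED i) (EDc i).
have mc := measurable_chart_density g (Sc i) (mED i) (EDc i).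
have mc' := measurable_chart_density g' (Sc i) (mED i) (EDc i).
have c0 (h : riemannian_metric S) (t : T) : (0 <= (chart_density h (c i) (tuple_param (c i) t))%:E)%E.
  by rewrite lee_fin; exact: sqrtr_ge0.
rewrite -(ge0_integralZl lam mt mc' (fun t _ => c0 g' t)); last by rewrite lee_fin.
apply: ge0_le_integral; first exact: mt.
- by move=> t _; exact: c0.
- exact: mc.
- exact: measurable_funeM.
- move=> _ [p Ep <-]; have cp := EDc _ _ Ep; rewrite (chart_tupleK cp).
  by rewrite -EFinM lee_fin; exact: gK.
Qed.

(** Each point has a neighbourhood where the density is bounded and the coordinates stay within 1 of
    their values at the point, hence in a box of side 2; finitely many such neighbourhoods cover
    [M]. *)
Lemma volume_finite g v : is_volume g v -> (v setT < +oo)%E.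
Proof.
move=> /is_volumeP vg.
have /choice[Z HZ] : forall p, exists Z : set M, (open Z /\ Z p) /\ (v Z < +oo)%E.
  move=> p; have [Sc cp] := chart_atP S p; set c := chart_at S p in Sc cp.
  have Nd : \forall q \near p, chart_density g c q <= chart_density g c p + 1.
    apply: (cvgr_le (chart_density g c p)); first exact: chart_density_continuous.
    by rewrite ltrDl.
  have Nb : \forall q \near p, dom c q /\ forall i, `|coord c q 0 i - coord c p 0 i| < 1.
    apply: (near_coord (O := [set x : 'rV[R]_n | forall i, `|x 0 i - coord c p 0 i| < 1])) => //.
    by apply/nbhs_rVP; exists 1.
  have [Z [oZ Zp] HZ] := near_open (filterI Nd Nb).
  exists Z; split => //.
  have mZ : measurable (Z : set (borel M)) by exact: open_borel.
  have Zc : Z `<=` dom c by move=> q /HZ[_ []].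
  rewrite (vg _ Sc)//; apply: le_lt_trans.
    by apply: (chart_volume_le Sc mZ Zc) => q /HZ[le _]; exact: le.
  apply: (@le_lt_trans _ _ ((chart_density g c p + 1)%:E * (\prod_(i < n) 2)%:E)%E).
    apply: lee_wpmul2l; first by rewrite lee_fin addr_ge0// sqrtr_ge0.
    apply: lebT_diameter => //; first exact: measurable_chart_tuple_image.
    move=> _ _ [q Zq <-] [q' Zq' <-] i; rewrite !tnth_mktuple.
    have [_ [_ /(_ i)]] := HZ _ Zq; have [_ [_ /(_ i)]] := HZ _ Zq'.
    by rewrite !ltr_norml ler_norml => /andP[? ?] /andP[? ?]; apply/andP; split; lra.
  by rewrite -EFinM ltry.
have [N [s sM]] := countable_open_cover (fun p => (HZ p).1).
have mZ i : measurable (Z (s i) : set (borel M)) by apply: open_borel; have [[]] := HZ (s i).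
apply: (@le_lt_trans _ _ (\sum_(i < N) v (Z (s i)))%E).
  apply: (@content_subadditive _ _ _ v setT (fun i => Z (s i)) N) => //.
  move=> q _; have [i iN Zi] := sM q.
  by rewrite (bigD1 (Ordinal iN))//=; left.
by apply: lte_sum_pinfty => i _; have [_] := HZ (s i).
Qed.

End volume.

(** * Thin metrics *)

Section matrix.
Context {R : realType} {n : nat}.
Implicit Types (A G : 'M[R]_n) (w y : 'cV[R]_n).

(** The matrix determinant lemma, from two block triangular factorizations of the same bordered
    matrix. *)
Lemma det_rank1 (x : 'cV[R]_n) (v : 'rV[R]_n) : \det (1%:M + x *m v) = 1 + (v *m x) 0 0.
Proof.
have E1 : block_mx 1%:M 0 x 1%:M *m block_mx 1%:M (- v) 0 (1%:M + x *m v) =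
    block_mx (1%:M : 'M[R]_1) (- v) x 1%:M.
  rewrite mulmx_block !mul1mx !mul0mx !mulmx1 !addr0 mulmxN.
  by rewrite addrCA addNr addr0.
have E2 : block_mx (1%:M + v *m x) (- v) 0 1%:M *m block_mx 1%:M 0 x 1%:M =
    block_mx (1%:M : 'M[R]_1) (- v) x 1%:M.
  by rewrite mulmx_block !mulmx1 !mul0mx !mulmx0 !mul1mx !add0r mulNmx addrK.
have := congr1 determinant (etrans E1 (esym E2)).
rewrite !det_mulmx !det_lblock !det_ublock !det1 !mul1r !mulr1 => ->.
by rewrite det_mx11 !mxE eqxx.
Qed.

(** By the matrix determinant lemma the rank one term contributes [t^(n-1) * \det G * q] with [q]
    independent of [t]; the product [\det G * q] is read off at [t = 1], which frees the formula of
    inverse matrices. *)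
Lemma det_add_rank1 G w (t : R) : (0 < n)%N -> G \in unitmx -> t != 0 ->
  \det (w *m w^T + t *: G) =
  t ^+ n * \det G + t ^+ n.-1 * (\det (w *m w^T + G) - \det G).
Proof.
move=> n0 uG t0.
have H (a : R) : a != 0 -> \det (w *m w^T + a *: G) =
    a ^+ n * \det G * (1 + a^-1 * (w^T *m invmx G *m w) 0 0).
  move=> a0.
  have -> : w *m w^T + a *: G = (a *: G) *m (1%:M + (a^-1 *: (invmx G *m w)) *m w^T).
    rewrite mulmxDr mulmx1 addrC; congr (_ + _).
    rewrite -!scalemxAl -scalemxAr scalerA divff// scale1r.
    by rewrite !mulmxA mulmxV// mul1mx.
  by rewrite det_mulmx detZ det_rank1 -scalemxAr mxE mulmxA.
rewrite H// -[w *m w^T + G](congr1 (fun X => w *m w^T + X) (scale1r G)) H ?oner_neq0//.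
rewrite expr1n invr1 !mul1r; set q := (_ *m w) 0 0.
have -> : t ^+ n = t ^+ n.-1 * t by rewrite -exprSr prednK.
move: (t ^+ n.-1) (\det G) => T D.
by field.
Qed.

End matrix.

Section thin_family.
Context {R : realType} {n : nat} {M : ptopologicalType}.
Variable S : smooth_structure R n M.
Implicit Types (c : chart R n M) (p q : M) (f : M -> R).

Lemma change_scale c f p (a : R) : dom c p -> smooth_in c f p ->
  smooth_in c (fun q => a * f q) p /\
  dchart c (fun q => a * f q) p = a *: dchart c f p.
Proof.
move=> cp [V [F [oV Vp CF FE]]].
have CaF : C_infinity V (fun x => a * F x).
  by apply/C_infinityE => k; apply: CkM => //; [exact: Ck_cst|move/C_infinityE : CF].
have aFE y : chart_image c y -> V y -> a * F y = ((fun q => a * f q) \o param c) y.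
  by move=> cy Vy; rewrite FE.
split; first by exists V, (fun x => a * F x).
apply/colP => i; rewrite !mxE.
rewrite (rpartialE i (image_half_open c) (image_coord cp) oV Vp CaF aFE).
rewrite (rpartialE i (image_half_open c) (image_coord cp) oV Vp CF FE).
move/C_infinityE : CF => /(_ 1%N)[_ [dF _]].
exact: (deriveZ a (dF _ i Vp)).
Qed.

Lemma smooth_function_scale f (a : R) : smooth_function S f ->
  smooth_function S (fun q => a * f q).
Proof.
move=> /smooth_functionP sf; apply/smooth_functionP => c p Sc cp.
by have [] := change_scale a cp (sf c p Sc cp).
Qed.

Lemma differential_scale f (a : R) p : smooth_function S f ->
  differential S (fun q => a * f q) p = a *: differential S f p.
Proof.
move=> /smooth_functionP sf; have [Sc cp] := chart_atP S p.
by have [_] := change_scale a cp (sf _ p Sc cp).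
Qed.

Variables (I : finType) (u : I -> M -> R) (k0 : I).
Hypotheses (su : forall k, smooth_function S (u k)) (spu : spanning S u).

(** The function [u k0] occurs twice, once without the factor [b]; the Gram matrix of the doubled
    family is then the thin metric itself, so [gram_metric] applies. *)
Definition thin_family (b s : R) (o : 'I_1 + I) : M -> R :=
  match o with
  | inl _ => fun p => s * u k0 p
  | inr k => fun p => s * b * u k p
  end.

Lemma smooth_thin_family b s o : smooth_function S (thin_family b s o).
Proof. by case: o => [i|k] /=; exact: smooth_function_scale. Qed.

Lemma spanning_thin_family b s : 0 < b -> 0 < s -> spanning S (thin_family b s).
Proof.
move=> b0 s0 p v H; apply: (spu (p := p)) => k.
have := H (inr k); rewrite /= differential_scale// -scalemxAr => /eqP.
by rewrite scaler_eq0 mulf_eq0 !gt_eqF//= => /eqP.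
Qed.

Local Notation D p := (differential S (u k0) p).

Lemma gram_thin_family b s p : gram S (thin_family b s) p =
  s ^+ 2 *: (D p *m (D p)^T + b ^+ 2 *: gram S u p).
Proof.
rewrite /gram big_sumType /= big_ord1 scalerDr; congr (_ + _).
  rewrite differential_scale// linearZ /= -scalemxAl -scalemxAr scalerA.
  by rewrite -expr2.
rewrite scalerA scaler_sumr; apply: eq_bigr => k _.
rewrite differential_scale// linearZ /= -scalemxAl -scalemxAr scalerA.
by rewrite -expr2 exprMn.
Qed.

Lemma gram_quad p (y : 'cV[R]_n) :
  ((D p)^T *m y) 0 0 ^+ 2 <= (y^T *m gram S u p *m y) 0 0.
Proof.
have -> : (y^T *m gram S u p *m y) 0 0 =
    \sum_k (((differential S (u k) p)^T *m y) 0 0) ^+ 2.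
  rewrite /gram mulmx_sumr mulmx_suml summxE; apply: eq_bigr => k _.
  rewrite mulmxA -mulmxA mxE big_ord1 expr2; congr (_ * _).
  by rewrite -[y^T *m _]trmxK trmx_mul trmxK mxE.
by rewrite (bigD1 k0)//= lerDl sumr_ge0// => k _; exact: sqr_ge0.
Qed.

Lemma posdef_unitmx (A : 'M[R]_n) :
  (forall v : 'rV[R]_n, v != 0 -> 0 < (v *m A *m v^T) 0 0) -> A \in unitmx.
Proof. by move=> /posdef_det_gt0 A0; rewrite unitmxE unitfE gt_eqF. Qed.

(** Write [q] for [|df|^2] and test the metric on the gradient [y]:
    [q = g(y, y) >= s^2 * df(y)^2 = s^2 * q^2]. *)
Lemma thin_family_gradient b s (g : riemannian_metric S) p : 0 < b -> 0 < s ->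
  (g : M -> 'M[R]_n) = gram S (thin_family b s) ->
  ((D p)^T *m invmx (g p) *m D p) 0 0 <= s ^- 2.
Proof.
move=> b0 s0 gE; have ug : g p \in unitmx by apply: posdef_unitmx; exact: metric_positive.
pose y := invmx (g p) *m D p; set q := (_ *m D p) 0 0.
have qE : ((D p)^T *m y) 0 0 = q by rewrite /q /y mulmxA.
have qE' : (y^T *m D p) 0 0 = q.
  by rewrite -qE -[y^T *m D p]trmxK trmx_mul trmxK mxE.
have : s ^+ 2 * q ^+ 2 <= q.
  have : (y^T *m g p *m y) 0 0 = q by rewrite -mulmxA /y mulKVmx.
  have E1 : (y^T *m (D p *m (D p)^T) *m y) 0 0 = q * q.
    have -> : y^T *m (D p *m (D p)^T) *m y = (y^T *m D p) *m ((D p)^T *m y).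
      by rewrite !mulmxA.
    by move: qE qE'; move: (_^T *m y) (y^T *m _) => U V UE VE; rewrite mxE big_ord1 UE VE.
  have sc (a : R) (Z : 'M[R]_1) : (a *: Z) 0 0 = a * Z 0 0 by rewrite mxE.
  have ad (Y Z : 'M[R]_1) : (Y + Z) 0 0 = Y 0 0 + Z 0 0 by rewrite mxE.
  rewrite {1}gE gram_thin_family -scalemxAr -scalemxAl sc mulmxDr mulmxDl ad E1.
  rewrite -scalemxAr -scalemxAl sc => qq; rewrite -[leRHS]qq.
  rewrite -expr2 ler_pM2l ?exprn_gt0// lerDl mulr_ge0 ?sqr_ge0//.
  exact: le_trans (sqr_ge0 _) (gram_quad p y).
have [q0|q0] := leP q 0.
  by move=> _; apply: le_trans q0 _; rewrite invr_ge0 exprn_ge0// ltW.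
move=> H; rewrite -[leRHS]mul1r ler_pdivlMr ?exprn_gt0// mulrC -(ler_pM2r q0).
by rewrite mul1r -mulrA -expr2.
Qed.

Hypothesis n0 : (0 < n)%N.

Variable gu : riemannian_metric S.
Hypothesis guE : (gu : M -> 'M[R]_n) = gram S u.

Local Notation w c p := (jacobian S c p *m D p).

(* [det (t G + w w^T) = t^n det G + t^(n-1) det_gap], so that the density of a thin
   metric is of order [b^(n-1)]. *)
Definition det_gap c p : R :=
  \det (w c p *m (w c p)^T + in_chart S gu c p) - \det (in_chart S gu c p).

Lemma in_chart_thin_family b s (g : riemannian_metric S) c p :
  (g : M -> 'M[R]_n) = gram S (thin_family b s) ->
  in_chart S g c p = s ^+ 2 *: (w c p *m (w c p)^T + b ^+ 2 *: in_chart S gu c p).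
Proof.
move=> gE; rewrite /in_chart gE gram_thin_family -scalemxAr -scalemxAl; congr (_ *: _).
rewrite mulmxDr mulmxDl -scalemxAr -scalemxAl guE; congr (_ + _).
by rewrite trmx_mul !mulmxA.
Qed.

Lemma thin_family_density b s (g : riemannian_metric S) c p : 0 < b -> 0 < s ->
  (g : M -> 'M[R]_n) = gram S (thin_family b s) -> atlas S c -> dom c p ->
  chart_density g c p = s ^+ n * b ^+ n.-1 *
    Num.sqrt (b ^+ 2 * \det (in_chart S gu c p) + det_gap c p).
Proof.
move=> b0 s0 gE Sc cp; rewrite /chart_density (in_chart_thin_family _ _ gE) detZ.
have G0 := in_chart_det_gt0 gu Sc cp.
have uG : in_chart S gu c p \in unitmx by rewrite unitmxE unitfE gt_eqF.
have b2 : b ^+ 2 != 0 by rewrite expf_neq0// gt_eqF.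
rewrite (det_add_rank1 _ n0 uG b2) -/(det_gap c p) exprAC.
have bn : (b ^+ 2) ^+ n = (b ^+ 2) ^+ n.-1 * b ^+ 2 by rewrite -exprSr prednK.
rewrite bn -[_ * b ^+ 2 * _]mulrA -mulrDr [(b ^+ 2) ^+ _]exprAC mulrA -exprMn.
rewrite sqrtrM ?sqr_ge0// sqrtr_sqr ger0_norm// mulr_ge0 ?exprn_ge0// ltW//.
Qed.

Lemma det_gapE c p : atlas S c -> dom c p -> det_gap c p =
  \det (in_chart S gu c p) *
    ((w c p)^T *m invmx (in_chart S gu c p) *m w c p) 0 0.
Proof.
move=> Sc cp; have G0 := in_chart_det_gt0 gu Sc cp.
have uG : in_chart S gu c p \in unitmx by rewrite unitmxE unitfE gt_eqF.
rewrite /det_gap.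
set G := in_chart S gu c p; set W := w c p.
have -> : W *m W^T + G = G *m (1%:M + (invmx G *m W) *m W^T).
  by rewrite mulmxDr mulmx1 addrC !mulmxA mulmxV// mul1mx.
by rewrite det_mulmx det_rank1 mulmxA mulrDr mulr1 addrAC subrr add0r.
Qed.

(** The squared length of [df] for [gu] does not depend on the chart. With [det_gapE] this makes the
    gap positive exactly through [df], and [gap_form_le1] bounds it by the determinant. *)
Lemma gap_form c p : atlas S c -> dom c p ->
  ((w c p)^T *m invmx (in_chart S gu c p) *m w c p) 0 0 =
  ((D p)^T *m invmx (gu p) *m D p) 0 0.
Proof.
move=> Sc cp; have uJ := jacobian_unit Sc cp.
have ug : gu p \in unitmx by apply: posdef_unitmx; exact: metric_positive.
congr (fun_of_matrix _ 0 0); rewrite /in_chart.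
set J := jacobian S c p in uJ *; set W := D p; rewrite trmx_mul.
have -> : invmx (J *m gu p *m J^T) = invmx J^T *m invmx (gu p) *m invmx J.
  apply: (@can_inj _ _ _ _ (mulKmx (_ : J *m gu p *m J^T \in unitmx))).
    by rewrite !unitmx_mul uJ ug unitmx_tr uJ.
  rewrite mulmxV ?unitmx_mul ?uJ ?ug ?unitmx_tr//.
  by rewrite -!mulmxA (mulKVmx (_ : J^T \in unitmx)) ?unitmx_tr// mulKVmx// mulmxV.
by rewrite !mulmxA mulmxK ?unitmx_tr// -!mulmxA mulKmx.
Qed.

Lemma gap_form_ge0 p : 0 <= ((D p)^T *m invmx (gu p) *m D p) 0 0 /\
  (D p != 0 -> 0 < ((D p)^T *m invmx (gu p) *m D p) 0 0).
Proof.
have ug : gu p \in unitmx by apply: posdef_unitmx; exact: metric_positive.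
pose y := invmx (gu p) *m D p.
have E : (D p)^T *m invmx (gu p) *m D p = y^T *m gu p *m y^T^T.
  rewrite trmxK /y trmx_mul trmx_inv metric_symmetric.
  by rewrite -!mulmxA mulKVmx.
rewrite E; have [y0|y0] := eqVneq y^T 0.
  have D0 : D p = 0.
    by rewrite -[LHS](mulKVmx ug) -/y -[y]trmxK y0 trmx0 mulmx0.
  by rewrite D0 eqxx y0 mul0mx mul0mx mxE.
by have := metric_positive gu p y0; split => //; exact: ltW.
Qed.

Lemma gap_form_le1 p : ((D p)^T *m invmx (gu p) *m D p) 0 0 <= 1.
Proof.
have ug : gu p \in unitmx by apply: posdef_unitmx; exact: metric_positive.
pose y := invmx (gu p) *m D p; set q := (_ *m D p) 0 0.
have := gram_quad p y; rewrite -guE.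
have -> : (y^T *m gu p *m y) 0 0 = q.
  rewrite /q /y trmx_mul trmx_inv metric_symmetric.
  by rewrite -!mulmxA mulKVmx.
have -> : ((D p)^T *m y) 0 0 = q by rewrite /q /y mulmxA.
have [q0 _] := gap_form_ge0 p; rewrite -/q in q0.
by move=> qq; rewrite leNgt; apply/negP => q1; move: qq; rewrite leNgt expr2 ltr_pMr ?q1//; lra.
Qed.

Lemma det_gap_bounds c p : atlas S c -> dom c p ->
  0 <= det_gap c p <= \det (in_chart S gu c p).
Proof.
move=> Sc cp; have G0 := in_chart_det_gt0 gu Sc cp.
rewrite det_gapE// gap_form//; have [q0 _] := gap_form_ge0 p.
by rewrite mulr_ge0 ?(ltW G0)//= ger_pMr// gap_form_le1.
Qed.

Lemma det_gap_gt0 c p : atlas S c -> dom c p -> D p != 0 -> 0 < det_gap c p.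
Proof.
move=> Sc cp D0; have G0 := in_chart_det_gt0 gu Sc cp.
by rewrite det_gapE// gap_form// mulr_gt0//; apply: (gap_form_ge0 p).2.
Qed.

(** The thin metric with [b = s = 1] is [df df^T] plus the Gram metric, so the gap is a difference
    of determinants of two smooth metrics. *)
Lemma det_gap_continuous (g1 : riemannian_metric S) c p :
  (g1 : M -> 'M[R]_n) = gram S (thin_family 1 1) -> atlas S c -> dom c p ->
  {for p, continuous (det_gap c)}.
Proof.
move=> g1E Sc cp.
have E : det_gap c = fun q => \det (in_chart S g1 c q) - \det (in_chart S gu c q).
  apply/funext => q; rewrite (in_chart_thin_family _ _ g1E) !expr1n !scale1r.
  by [].
have cd (g : riemannian_metric S) : {for p, continuous (fun q => \det (in_chart S g c q))}.
  apply: cvg_det => i j.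
  apply: (smooth_in_continuous cp (f := fun q => in_chart S g c q i j)).
  exact: (metric_smooth g Sc i j (image_coord cp)).
by rewrite E; exact: (cvgB (cd g1) (cd gu)).
Qed.

Lemma thin_family_density_le b s (g : riemannian_metric S) c p : 0 < b <= 1 -> 0 < s ->
  (g : M -> 'M[R]_n) = gram S (thin_family b s) -> atlas S c -> dom c p ->
  chart_density g c p <= s ^+ n * b ^+ n.-1 * 2 * chart_density gu c p.
Proof.
move=> /andP[b0 b1] s0 gE Sc cp; rewrite (thin_family_density b0 s0 gE Sc cp).
rewrite /chart_density -[leRHS]mulrA.
have := det_gap_bounds Sc cp; have := in_chart_det_gt0 gu Sc cp.
move: (\det _) (det_gap c p) => G X G0 /andP[X0 XG].
apply: ler_wpM2l; first by rewrite mulr_ge0 ?exprn_ge0// ltW.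
(* For [b <= 1] the radicand is at most [2 * G], which is below [2^2 * G]. *)
rewrite -[2]ger0_norm// -sqrtr_sqr -sqrtrM ?sqr_ge0// ler_wsqrtr//.
have : b ^+ 2 * G <= G by rewrite ger_pMl// expr_le1// ltW.
by rewrite (_ : 2 ^+ 2 = 4 :> R); [lra|rewrite -natrX].
Qed.

Lemma thin_family_density_ge b s (g : riemannian_metric S) c p : 0 < b -> 0 < s ->
  (g : M -> 'M[R]_n) = gram S (thin_family b s) -> atlas S c -> dom c p ->
  s ^+ n * b ^+ n.-1 * Num.sqrt (det_gap c p) <= chart_density g c p.
Proof.
move=> b0 s0 gE Sc cp; rewrite (thin_family_density b0 s0 gE Sc cp).
have G0 := in_chart_det_gt0 gu Sc cp.
apply: ler_wpM2l; first by rewrite mulr_ge0 ?exprn_ge0// ltW.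
by rewrite ler_wsqrtr// lerDr mulr_ge0 ?sqr_ge0// ltW.
Qed.

End thin_family.

Section coordinate_function.
Context {R : realType} {n : nat} {M : ptopologicalType}.
Variable S : smooth_structure R n M.
Local Notation T := (n.-tuple (measurableTypeR R)).
Local Notation lam := (lebT n).
Hypotheses (hM : hausdorff_space M) (cM : compact [set: M]) (n2 : (2 <= n)%N).
Implicit Types (c : chart R n M) (p q : M) (f : M -> R).

Lemma exists_coordinate_function (i0 : 'I_n) : i0 = 0%N :> nat ->
  exists f c (a : 'rV[R]_n) (r : R), [/\ smooth_function S f, atlas S c, 0 < r,
    forall x : 'rV[R]_n, (forall i, `|x 0 i - a 0 i| <= r) ->
      chart_image c x /\ f (param c x) = x 0 i0 &
    differential S f (param c a) != 0].
Proof.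
move=> i00; set p0 : M := point; pose c := chart_at S p0; have [Sc cp] := chart_atP S p0.
pose a0 := coord c p0; pose r0 := chart_radius c p0.
have [] := chart_radiusP cp; rewrite -/r0 => r00 rV.
have n1 : 0 < n%:R :> R by rewrite ltr0n ltnW.
(* Points of the box differ from [a0] by at most [3 * r = r0 / n] in each coordinate, so their
   [sqdist] is at most [n / n^2 < 1], where the cutoff equals 1. *)
pose r := r0 / (3 * n%:R).
have r_gt0 : 0 < r by rewrite divr_gt0// mulr_gt0.
have r3 : 3 * r = r0 / n%:R by rewrite /r; field; rewrite gt_eqF.
(* The centre moves inward along the coordinate that the half-space constrains; on the box it stays
   at least [r] above 0, so a full box fits even if [p0] is a boundary point. *)
pose a : 'rV[R]_n := a0 + (2 * r) *: basis_vector i0.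
have aE i : a 0 i = a0 0 i + (if i == i0 then 2 * r else 0).
  by rewrite !mxE eqxx/=; case: eqP => _; rewrite ?mulr1 ?mulr0.
have ax (x : 'rV[R]_n) : (forall i, `|x 0 i - a 0 i| <= r) -> forall i, `|x 0 i - a0 0 i| <= r0 / n%:R.
  move=> xa i; have := xa i; rewrite aE -r3 !ler_norml.
  by case: eqP => _ /andP[? ?]; apply/andP; split; lra.
have Hx (x : 'rV[R]_n) : (forall i, `|x 0 i - a 0 i| <= r) -> halfspace R n x.
  move=> xa i ii; have ei : i = i0 by apply/val_inj; rewrite /= ii i00.
  have := xa i; rewrite aE ei eqxx ler_norml => /andP[+ _].
  have [V oV cV] := image_half_open c.
  have : (V `&` halfspace R n) a0 by rewrite -cV; exact: image_coord.
  by move=> [_ /(_ i0 i00)]; lra.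
have n2R : 2 <= n%:R :> R by rewrite (ler_nat R 2).
have rn : r0 / n%:R <= 2 * r0.
  rewrite ler_pdivrMr//; apply: (@le_trans _ _ (2 * r0 * 1)); first by lra.
  by apply: ler_wpM2l; lra.
have imx (x : 'rV[R]_n) : (forall i, `|x 0 i - a 0 i| <= r) -> chart_image c x.
  by move=> xa; apply: rV; [exact: Hx|move=> i; apply: le_trans (ax _ xa i) _].
have sqx (x : 'rV[R]_n) : (forall i, `|x 0 i - a 0 i| <= r) -> sqdist a0 r0 x < 1.
  move=> xa; apply: (@le_lt_trans _ _ (\sum_(i < n) n%:R^-1 ^+ 2)).
    apply: ler_sum => i _; rewrite -real_normK ?num_real// ler_pXn2r ?nnegrE//.
      by rewrite normrM gtr0_norm ?invr_gt0// ler_pdivrMl//; exact: ax.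
  have -> : \sum_(i < n) (n%:R^-1 : R) ^+ 2 = n%:R * (n%:R^-1 ^+ 2).
    by rewrite sumr_const card_ord mulr_natl.
  rewrite expr2 mulrA divff ?gt_eqF// mul1r.
  by rewrite invf_lt1//; lra.
have paE (x : 'rV[R]_n) : (forall i, `|x 0 i - a 0 i| <= r) -> coord c (param c x) = x.
  by move=> /imx/image_param[].
have aa i : `|a 0 i - a 0 i| <= r by rewrite subrr normr0 ltW.
exists (cutoff_coord c p0 (Some i0)), c, a, r; split => //.
- exact: smooth_cutoff_coord.
- move=> x xa; have cx := imx _ xa; split => //.
  rewrite /cutoff_coord chart_extE; last by have [] := image_param cx.
  by rewrite paE// /cutoff plateau_eq1 ?mul1r//; exact/ltW/sqx.
- have [ca _] := image_param (imx _ aa).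
  apply/negP => /eqP D0.
  have := jacobian_differential Sc ca (smooth_cutoff_coord (Some i0) hM Sc cp).
  rewrite D0 mulmx0 dchart_chart_ext//; last first.
    by move=> k; apply: CkM; [exact: openT|exact: Ck_cutoff|exact: Ck_coord].
  move=> /colP/(_ i0); rewrite !mxE paE// => /esym.
  rewrite /partial.
  have -> : 'D_(basis_vector i0) (fun x : 'rV[R]_n => cutoff c p0 x * x 0 i0) a =
      'D_(basis_vector i0) (fun x : 'rV[R]_n => x 0 i0) a.
    apply: near_eq_derive.
    have cs := (Ck_sqdist a0 r0 0).1 a I.
    have : \forall x \near a, sqdist a0 r0 x < 1 by apply: (cvgr_lt _ cs); exact: sqx.
    by apply: filterS => x x1; rewrite /cutoff plateau_eq1 ?mul1r//; exact: ltW.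
  rewrite (@derive_val _ _ _ _ _ _ _ (is_derive_coord a i0 i0)) eqxx => /eqP.
  by rewrite oner_eq0.
Qed.

End coordinate_function.

Section thin_metrics.
Context {R : realType} {n : nat} {M : ptopologicalType}.
Variable S : smooth_structure R n M.
Local Notation T := (n.-tuple (measurableTypeR R)).
Local Notation lam := (lebT n).
Hypotheses (hM : hausdorff_space M) (cM : compact [set: M]) (n2 : (2 <= n)%N).
Implicit Types (c : chart R n M) (p q : M) (f : M -> R).

Lemma chart_box_volume c (a : 'rV[R]_n) (r : R) (i0 : 'I_n) (al be : R) :
  (forall x : 'rV[R]_n, (forall i, `|x 0 i - a 0 i| <= r) -> chart_image c x) ->
  0 <= r -> a 0 i0 - r <= al -> al <= be -> be <= a 0 i0 + r ->
  exists E : set (borel M), [/\ measurable E, E `<=` dom c,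
    forall p, E p -> (forall i, `|coord c p 0 i - a 0 i| <= r) /\ al <= coord c p 0 i0 <= be &
    lam (chart_tuple c @` E) = ((be - al) * \prod_(i < n | i != i0) (2 * r))%:E].
Proof.
move=> ac r0 aal albe bea.
pose lo i := if i == i0 then al else a 0 i - r.
pose hi i := if i == i0 then be else a 0 i + r.
have lohi i : lo i <= hi i by rewrite /lo /hi; case: eqP => // _; lra.
pose A i : set (measurableTypeR R) := [set` `[lo i, hi i]].
pose B : set T := [set t | forall i, A i (tnth t i)].
have mA i : measurable (A i) by exact: measurable_itv.
have mB : measurable B by exact: measurable_box.
pose E : set (borel M) := dom c `&` chart_tuple c @^-1` B.
have mE : measurable E by apply: measurable_chart_tuple => //; exact: measurable_dom.
have Bx (x : 'rV[R]_n) : B (row_tuple x) -> (forall i, `|x 0 i - a 0 i| <= r) /\ al <= x 0 i0 <= be.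
  move=> Bx; have Bi i : lo i <= x 0 i <= hi i.
    by have := Bx i; rewrite tnth_mktuple /A /= in_itv.
  split; last by have := Bi i0; rewrite /lo /hi eqxx.
  move=> i; have := Bi i; rewrite /lo /hi ler_distl.
  by case: eqP => [->|_] // /andP[? ?]; apply/andP; split; lra.
exists E; split => //; first by move=> p [].
  by move=> p [_ /Bx].
have -> : chart_tuple c @` E = B.
  apply/seteqP; split=> [_ [p [_ Bp] <-]//|t Bt].
  have := Bt; rewrite -{1}(tuple_rowK t) => /Bx[/ac/image_param[cp px] _].
  exists (param c (tuple_row t)); last by rewrite /chart_tuple px tuple_rowK.
  by split => //; rewrite /= /chart_tuple px tuple_rowK.
rewrite (lebT_box (l := fun i => hi i - lo i))//.
  rewrite (bigD1 i0)//= /hi /lo eqxx; congr (_ * _)%:E.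
  by apply: eq_bigr => i /negbTE ->; lra.
move=> i; rewrite /A lebesgue_measure_itv/= lte_fin -EFinB.
case: ltP => // le; congr EFin; apply/esym/eqP; rewrite subr_eq0 eq_le le /=.
exact: lohi.
Qed.

(** The order of quantifiers is the point: [f], [A], [L] and [c0] serve every [dl]. *)
Lemma thin_metrics : exists f (A L c0 : R), [/\ smooth_function S f, 0 < L, 0 < c0 &
  forall dl : R, 0 < dl ->
  exists (g : riemannian_metric S) (v : {measure set (borel M) -> \bar R}),
  [/\ is_volume g v, v setT = 1%E,
    forall p, ((differential S f p)^T *m invmx (g p) *m differential S f p) 0 0 <= dl &
    forall al be, A <= al -> al <= be -> be <= A + L ->
      ((c0 * (be - al))%:E <= v [set p | (al <= f p <= be)%R])%E]].
Proof.
have n0 : (0 < n)%N by exact: ltnW.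
pose i0 : 'I_n := Ordinal n0.
have [f [c [a [r [sf Sc r0 aP Df]]]]] := exists_coordinate_function S hM n2 (erefl : i0 = 0%N :> nat).
have [I0 [u0 [su0 spu0]]] := exists_spanning_family S hM cM.
(* [f] is adjoined to the spanning family, as the function [u k0] of the thin construction. *)
pose I : finType := ('I_1 + I0)%type.
pose u (k : I) : M -> R := match k with inl _ => f | inr k => u0 k end.
pose k0 : I := inl ord0.
have su k : smooth_function S (u k) by case: k.
have spu : spanning S u by move=> p w H; apply: (spu0 p w) => k; exact: (H (inr k)).
have [gu guE] := gram_metric su spu.
(* Outside positive [b] and [s] the metric is the placeholder [gu]. *)
have /choice[g0 g0E] : forall bs : R * R, exists g : riemannian_metric S,
    0 < bs.1 -> 0 < bs.2 -> (g : M -> 'M[R]_n) = gram S (thin_family u k0 bs.1 bs.2).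
  move=> [b s]; have [b0|b0] := ltP 0 b; last first.
    by exists gu.
  have [s0|s0] := ltP 0 s; last first.
    by exists gu.
  have [g gE] := gram_metric (smooth_thin_family k0 su b s) (spanning_thin_family su spu b0 s0 (k0 := k0)).
  by exists g.
pose g b s := g0 (b, s).
have gE b s : 0 < b -> 0 < s -> (g b s : M -> 'M[R]_n) = gram S (thin_family u k0 b s).
  by move=> b0 s0; exact: (g0E (b, s)).
have aa i : `|a 0 i - a 0 i| <= r by rewrite subrr normr0 ltW.
have [ca pa] := image_param (aP _ aa).1.
pose p1 := param c a.
pose gap := det_gap u k0 gu c.
have gap0 : 0 < gap p1 by exact: (det_gap_gt0 (u := u) (k0 := k0) gu Sc ca Df).
have gapc : \forall q \near p1, gap p1 / 2 <= gap q.
  apply: (cvgr_ge (gap p1)); last by lra.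
  exact: (det_gap_continuous su guE (gE _ _ ltr01 ltr01) Sc ca).
have := near_param ca gapc; rewrite pa => /nbhs_rVP[d d0 dP].
(* On the box of radius [r1] the gap is at least half of its value at the centre. As the gap
   involves neither [b] nor [s], [kap] is a uniform lower bound for its root. *)
pose r1 := Num.min r (d / 2).
have r10 : 0 < r1 by rewrite lt_min r0 divr_gt0.
have r1r : r1 <= r by rewrite ge_min lexx.
have r1d : r1 < d by rewrite gt_min; apply/orP; right; lra.
pose kap := Num.sqrt (gap p1 / 2).
have kap0 : 0 < kap by rewrite sqrtr_gt0 divr_gt0.
pose P := \prod_(i < n | i != i0) (2 * r1).
have P0 : 0 < P by rewrite prodr_gt0// => i _; rewrite mulr_gt0.
pose A := a 0 i0 - r1; pose L := 2 * r1.
have L0 : 0 < L by rewrite mulr_gt0.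
have [vu vuP] := exists_volume cM gu.
have vufin := volume_finite cM vuP.
pose VG := fine (vu setT).
have VGE : vu setT = VG%:E by rewrite fineK// ge0_fin_numE.
have VG0 : 0 <= VG by rewrite fine_ge0.
have /choice[v vP] : forall bs : R * R, exists v : {measure set (borel M) -> \bar R},
   is_volume (g0 bs) v by move=> bs; exact: (exists_volume cM (g0 bs)).
have mslab al be : measurable ([set p | (al <= f p <= be)%R] : set (borel M)).
  have cf p : {for p, continuous f}.
    have [Sp cp] := chart_atP S p.
    exact: (smooth_in_continuous cp ((smooth_functionP S f).1 sf _ _ Sp cp)).
  have mf := continuous_open_measurable openT (fun p _ => cf p).
  have := mf measurableT _ (measurable_itv `[al, be]); rewrite setTI.
  congr measurable; apply/seteqP; split=> p /=; by rewrite in_itv.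
have lower b s al be : 0 < b -> 0 < s -> A <= al -> al <= be -> be <= A + L ->
    ((s ^+ n * b ^+ n.-1 * kap * ((be - al) * P))%:E <= v (b, s) [set p | (al <= f p <= be)%R])%E.
  move=> b0 s0 Aal albe beA.
  have imc (x : 'rV[R]_n) : (forall i, `|x 0 i - a 0 i| <= r1) -> chart_image c x.
    by move=> xa; apply: (aP x _).1 => i; exact: le_trans (xa i) r1r.
  have beA' : be <= a 0 i0 + r1 by move: beA; rewrite /A /L; lra.
  have [E [mE Ec EP lamE]] := chart_box_volume imc (ltW r10) Aal albe beA'.
  apply: (@le_trans _ _ (v (b, s) E)); last first.
    apply: le_measure; [exact: mem_set|exact: (mem_set (mslab al be))|move=> p Ep /=].
    have [Ex Ea] := EP _ Ep; have cp := Ec _ Ep.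
    have [|_] := aP (coord c p); first by move=> i; exact: le_trans (Ex i) r1r.
    by rewrite coordK// => ->.
  rewrite ((is_volumeP _ _).1 (vP (b, s)) _ Sc _ mE Ec) EFinM -lamE.
  have ce0 : 0 <= s ^+ n * b ^+ n.-1 * kap by rewrite !mulr_ge0 ?exprn_ge0// ltW.
  apply: (chart_volume_ge Sc mE Ec ce0).
  move=> p Ep; have cp := Ec _ Ep; have [Ex _] := EP _ Ep.
  apply: le_trans (thin_family_density_ge su n0 guE b0 s0 (gE _ _ b0 s0) Sc cp).
  apply: ler_wpM2l; first by rewrite mulr_ge0 ?exprn_ge0// ltW.
  rewrite /kap ler_wsqrtr//.
  have := dP (coord c p) (fun i => le_lt_trans (Ex i) r1d) (image_coord cp).
  by rewrite coordK.
have upper b s : 0 < b <= 1 -> 0 < s ->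
    (v (b, s) setT <= (s ^+ n * b ^+ n.-1 * 2 * VG)%:E)%E.
  move=> /andP[b0 b1] s0; rewrite EFinM -VGE.
  have K0 : 0 <= s ^+ n * b ^+ n.-1 * 2 by rewrite !mulr_ge0 ?exprn_ge0// ltW.
  apply: (volume_le cM (vP (b, s)) vuP K0) => // c' p Sc' cp.
  apply: (thin_family_density_le su n0 guE _ s0 (gE _ _ b0 s0) Sc' cp).
  by rewrite b0 b1.
have scale b s : 0 < b -> 0 < s -> v (b, s) setT = ((s ^+ n)%:E * v (b, 1%R) setT)%E.
  move=> b0 s0; have sn0 : 0 < s ^+ n by rewrite exprn_gt0.
  have dens c' p : atlas S c' -> dom c' p ->
      chart_density (g b s) c' p = s ^+ n * chart_density (g b 1) c' p.
    move=> Sc' cp.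
    rewrite (thin_family_density su n0 guE b0 s0 (gE _ _ b0 s0) Sc' cp).
    rewrite (thin_family_density su n0 guE b0 ltr01 (gE _ _ b0 ltr01) Sc' cp).
    by rewrite expr1n mul1r mulrA.
  apply/eqP; rewrite eq_le; apply/andP; split.
    apply: (volume_le cM (vP (b, s)) (vP (b, 1)) (ltW sn0)) => // c' p Sc' cp.
    by rewrite -/(g b s) dens.
  have sV : 0 <= (s ^+ n)^-1 by rewrite invr_ge0 ltW.
  have := volume_le cM (vP (b, 1)) (vP (b, s)) sV _ measurableT.
  have H c' p : atlas S c' -> dom c' p ->
      chart_density (g0 (b, 1)) c' p <= (s ^+ n)^-1 * chart_density (g0 (b, s)) c' p.
    by move=> Sc' cp; rewrite -/(g b s) dens// mulKf// gt_eqF.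
  move=> /(_ H) le; apply: (@le_trans _ _ ((s ^+ n)%:E * (((s ^+ n)^-1)%:E * v (b, s) setT))%E).
    by apply: lee_wpmul2l => //; rewrite lee_fin ltW.
  by rewrite muleA -EFinM divff ?gt_eqF// mul1e.
pose V1 b := fine (v (b, 1%R) setT).
have V1P b : 0 < b <= 1 -> 0 < V1 b /\ v (b, 1%R) setT = (V1 b)%:E.
  move=> b01; have b0 := andP b01 => /=; case: b0 => b0 b1.
  have fin : v (b, 1%R) setT = (V1 b)%:E.
    rewrite /V1 fineK// ge0_fin_numE ?measure_ge0//.
    by apply: le_lt_trans (upper _ _ b01 ltr01) _; rewrite ltry.
  split => //; rewrite -lte_fin -fin.
  have AL : A <= A + L by rewrite lerDl ltW.
  apply: lt_le_trans (le_trans (lower _ _ _ _ b0 ltr01 (lexx A) AL (lexx _)) _).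
    by rewrite lte_fin !mulr_gt0 ?exprn_gt0 ?ltr01// addrC addKr.
  by apply: le_measure => //; [exact: (mem_set (mslab A (A + L)))|exact: (mem_set measurableT)].
have VGpos : 0 < VG.
  rewrite lt_neqAle VG0 andbT; apply/eqP => VG0'.
  have b01 : 0 < (1 : R) <= 1 by rewrite ltr01 lexx.
  have [V10 V1E] := V1P 1 b01; have := upper _ _ b01 ltr01.
  by rewrite V1E -VG0' mulr0 lee_fin leNgt V10.
(* Unit volume and [upper] will give [s^n * b^(n-1) >= 1 / (2 * VG)]; inserted into [lower], this
   yields the constant. *)
exists f, A, L, (kap * P / (2 * VG)); split => //.
  by rewrite divr_gt0 ?mulr_gt0.
(* At scale [s0] the gradient bound [s^-2] equals [dl]. The factor [b] below is small enough that
   unit volume forces [s >= s0]. *)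
move=> dl dl0; pose s0 := Num.sqrt dl^-1.
have s00 : 0 < s0 by rewrite sqrtr_gt0 invr_gt0.
have s0n : 0 < s0 ^+ n by rewrite exprn_gt0.
pose b := Num.min 1 (2 * VG * s0 ^+ n)^-1.
have b0 : 0 < b by rewrite lt_min ltr01 invr_gt0 !mulr_gt0.
have b1 : b <= 1 by rewrite ge_min lexx.
have bs0 : b * (2 * VG * s0 ^+ n) <= 1.
  by rewrite -ler_pdivlMr ?mulr_gt0// div1r ge_min lexx orbT.
have b01 : 0 < b <= 1 by rewrite b0.
have [V10 V1E] := V1P b b01.
(* The volume is homogeneous of degree [n] in [s], so this root normalizes it to 1. *)
pose s := (V1 b)^-1 `^ (n%:R^-1).
have s_gt0 : 0 < s by rewrite powR_gt0// invr_gt0.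
have sn : s ^+ n = (V1 b)^-1.
  rewrite /s -powR_mulrn ?powR_ge0// -powRrM mulVf ?pnatr_eq0 -?lt0n//.
  by rewrite powRr1// invr_ge0 ltW.
have vbs : v (b, s) setT = 1%E.
  by rewrite (scale _ _ b0 s_gt0) V1E -EFinM sn mulVf ?gt_eqF.
have sb : 1 <= s ^+ n * b ^+ n.-1 * (2 * VG).
  by have := upper _ _ b01 s_gt0; rewrite vbs lee_fin -mulrA.
exists (g b s), (v (b, s)); split => //.
- exact: (vP (b, s)).
- move=> p.
  have := thin_family_gradient su p b0 s_gt0 (gE _ _ b0 s_gt0).
  move=> /le_trans; apply.
  suff : s0 <= s.
    move=> ss; have : s0 ^+ 2 <= s ^+ 2 by apply: lerXn2r; rewrite ?nnegrE ?ss// ltW.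
    rewrite sqr_sqrtr ?invr_ge0; last exact: ltW.
    move=> H.
    by rewrite -[leRHS]invrK lef_pV2 ?posrE ?invr_gt0// exprn_gt0.
  rewrite -(ler_pXn2r n0); [|exact: ltW|exact: ltW].
  (* Here [n >= 2] enters: [1 <= s^n * b^(n-1) * 2 * VG <= s^n * b * 2 * VG], whereas
     [b * 2 * VG * s0^n <= 1]. *)
  have bn : b ^+ n.-1 <= b.
    rewrite -{2}(expr1 b); apply: ler_wiXn2l => //; first exact: ltW.
    by rewrite -ltnS prednK.
  have H : b * (2 * VG * s0 ^+ n) <= b * (2 * VG * s ^+ n).
    apply: le_trans bs0 _; apply: le_trans sb _.
    rewrite mulrAC mulrC [s ^+ n * _]mulrC; apply: ler_wpM2r => //.
    by rewrite !mulr_ge0 ?exprn_ge0// ltW.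
  by move: H; rewrite ler_pM2l// ler_pM2l// mulr_gt0.
- move=> al be Aal albe beA.
  apply: le_trans (lower _ _ _ _ b0 s_gt0 Aal albe beA).
  rewrite lee_fin.
  set x := s ^+ n * b ^+ n.-1 in sb *.
  have -> : kap * P / (2 * VG) * (be - al) = (2 * VG)^-1 * (kap * ((be - al) * P)) by ring.
  rewrite -mulrA; apply: ler_wpM2r; first by rewrite !mulr_ge0 ?subr_ge0// ltW.
  by rewrite -div1r ler_pdivrMr// mulr_gt0.
Qed.

End thin_metrics.

(** * The spectral estimate *)

Section test_functions.
Context {R : realType} {n : nat} {M : ptopologicalType}.
Variable S : smooth_structure R n M.
Implicit Types (c : chart R n M) (p q : M) (f : M -> R).

Lemma change_comp c f p (h : R -> R) (l : R) : dom c p -> smooth_in c f p ->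
  (forall k, Ck k setT (fun z : 'rV[R]_1 => h (z 0 0))) -> is_derive (f p) 1 h l ->
  smooth_in c (h \o f) p /\ dchart c (h \o f) p = l *: dchart c f p.
Proof.
move=> cp [V [F [oV Vp CF FE]]] Ch dh.
pose Fr (y : 'rV[R]_n) : 'rV[R]_1 := \row_(j < 1) F y.
pose H (z : 'rV[R]_1) := h (z 0 0).
have HF : H \o Fr = fun y => h (F y) by apply/funext => y; rewrite /H /Fr /= mxE.
have CFr k j : Ck k V (fun y => Fr y 0 j).
  have /C_infinityE/(_ k) := CF; apply: Ck_eq => // y _; by rewrite mxE.
have ChF : C_infinity V (fun y => h (F y)).
  apply/C_infinityE => k; rewrite -HF.
  exact: (Ck_comp oV openT (fun _ _ => I) (CFr k) (Ch k)).
have hFE y : chart_image c y -> V y -> h (F y) = ((h \o f) \o param c) y.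
  by move=> cy Vy; rewrite FE.
split; first by exists V, (fun y => h (F y)).
apply/colP => i; rewrite !mxE.
rewrite (rpartialE i (image_half_open c) (image_coord cp) oV Vp ChF hFE).
rewrite (rpartialE i (image_half_open c) (image_coord cp) oV Vp CF FE).
have d := is_derive_comp (W := setT) (G := H) (f := Fr) openT (fun _ _ => I) i (Ch 1%N) (CFr 1%N) Vp.
rewrite -HF /partial (@derive_val _ _ _ _ _ _ _ d) big_ord1.
have dH : is_derive (Fr (coord c p)) (basis_vector ord0) H l.
  apply: is_derive_scalar; rewrite /Fr mxE FE//; last exact: image_coord.
  by rewrite /= coordK.
have -> : partial ord0 H (Fr (coord c p)) = l by exact: (@derive_val _ _ _ _ _ _ _ dH).
have -> : (fun y => Fr y 0 ord0) = F by apply/funext => y; rewrite mxE.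
exact: mulrC.
Qed.

Lemma smooth_function_comp f (h h' : R -> R) : smooth_function S f ->
  (forall k, Ck k setT (fun z : 'rV[R]_1 => h (z 0 0))) ->
  (forall s : R, is_derive s 1 h (h' s)) -> smooth_function S (h \o f).
Proof.
move=> /smooth_functionP sf Ch dh; apply/smooth_functionP => c p Sc cp.
by have [] := change_comp cp (sf c p Sc cp) Ch (dh (f p)).
Qed.

Lemma differential_comp f (h h' : R -> R) p : smooth_function S f ->
  (forall k, Ck k setT (fun z : 'rV[R]_1 => h (z 0 0))) ->
  (forall s : R, is_derive s 1 h (h' s)) ->
  differential S (h \o f) p = h' (f p) *: differential S f p.
Proof.
move=> /smooth_functionP sf Ch dh; have [Sc cp] := chart_atP S p.
by have [_] := change_comp cp (sf _ p Sc cp) Ch (dh (f p)).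
Qed.

Lemma smooth_function_cst (a : R) : smooth_function S (fun=> a).
Proof.
apply/smooth_functionP => c p Sc cp.
exact: (smooth_in_global cp (fun k => Ck_cst k setT a)).
Qed.

Lemma differential_cst (a : R) p : differential S (fun=> a) p = 0.
Proof.
apply/colP => i; rewrite !mxE /rpartial.
by under eq_fun do rewrite subrr mulr0; exact: lim_cst.
Qed.

Lemma smooth_function_continuous f p : smooth_function S f -> {for p, continuous f}.
Proof.
move=> /smooth_functionP sf; have [Sp cp] := chart_atP S p.
exact: (smooth_in_continuous cp (sf _ _ Sp cp)).
Qed.

Lemma continuous_measurable f : continuous f ->
  measurable_fun [set: borel M] (f : borel M -> measurableTypeR R).
Proof. by move=> cf; exact: (continuous_open_measurable openT (fun p _ => cf p)). Qed.

Lemma measurable_covector_differential f : smooth_function S f ->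
  measurable_covector S (differential S f).
Proof.
move=> sf c Sc i.
have mc : measurable_fun (dom c : set (borel M))
    (fun p : borel M => (dchart c f p i 0 : measurableTypeR R)).
  apply: (continuous_open_measurable (dom_open c)) => p cp.
  apply: (smooth_in_continuous cp).
  have sr := smooth_at_rpartial i (image_half_open c) (image_coord cp)
    ((smooth_functionP S f).1 sf _ _ Sc cp).
  apply: (smooth_at_near openT I) sr => y cy _.
  by rewrite /= /dchart mxE (image_param cy).2.
apply: eq_measurable_fun mc => p /set_mem cp.
by rewrite -(jacobian_differential Sc cp sf).
Qed.

Lemma smooth_H1 (g : riemannian_metric S) (v : {measure set (borel M) -> \bar R}) f :
  smooth_function S f -> H1 g v (f, differential S f).
Proof.
move=> sf; split => /=.
- by apply: continuous_measurable => p; exact: smooth_function_continuous.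
- exact: measurable_covector_differential.
- exists (fun=> f); split => //.
    under eq_fun do under eq_integral do rewrite subrr expr0n.
    by under eq_fun do rewrite integral0; exact: cvg_cst.
  have E p : sqnorm g (fun q => differential S f q - differential S f q) p = 0.
    by rewrite /sqnorm subrr trmx0 !mul0mx mxE.
  under eq_fun do under eq_integral do rewrite E.
  by under eq_fun do rewrite integral0; exact: cvg_cst.
Qed.

Lemma is_derive_bump_affine (t w s : R) :
  is_derive s 1 (fun y => flat_bump ((y - t) / w)) (flat_bump' ((s - t) / w) / w).
Proof.
have d1 : is_derive s (1 : R) (fun y : R => y - t) 1.
  rewrite -[X in is_derive _ _ _ X]subr0.
  exact: (is_deriveB (is_derive_id _ _) (is_derive_cst _ _ _)).
have d : is_derive s (1 : R) (fun y : R => w^-1 *: (y - t) : R) w^-1.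
  rewrite -[X in is_derive _ _ _ X]mulr1; exact: is_deriveZ.
have := @is_derive1_comp _ _ (fun y : R => w^-1 *: (y - t) : R) s _ _
  (is_derive_bump (w^-1 * (s - t))) d.
rewrite (_ : _ \o _ = fun y : R => flat_bump ((y - t) / w)); last first.
  by apply/funext => y; rewrite /= /GRing.scale /= mulrC.
by rewrite (mulrC _ (s - t)).
Qed.

Lemma Ck_bump_affine k (t w : R) :
  Ck k setT (fun z : 'rV[R]_1 => flat_bump ((z 0 0 - t) / w)).
Proof.
apply: Ck_bump_comp; first exact: openT.
apply: CkM; [exact: openT| |exact: Ck_cst].
by apply: CkD; [exact: openT|exact: Ck_coord|exact: Ck_cst].
Qed.

End test_functions.

(** The integral of a nonnegative function is a supremum over the simple functions below it, which
    is monotone without measurability. This spares measurability proofs for the integrands of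
    Rayleigh quotients. *)
Lemma le_integral_nonmeasurable d (T : measurableType d) (R : realType)
    (mu : {measure set T -> \bar R}) (f h : T -> \bar R) :
  (forall x, 0 <= h x)%E -> (forall x, f x <= h x)%E ->
  (\int[mu]_x f x <= \int[mu]_x h x)%E.
Proof.
move=> h0 fh; rewrite integralE.
have fp x : (0 <= f^\+ x)%E by rewrite funepos_ge0.
apply: (@le_trans _ _ (\int[mu]_x f^\+ x)%E).
  by rewrite -[leRHS]adde0 leeD2l// leeNl oppe0 integral_ge0// => x _; exact: funeneg_ge0.
rewrite !ge0_integralTE//; apply: le_ereal_sup => _ [q qf <-]; exists q => //= x.
by apply: le_trans (qf x) _; rewrite funeposE ge_max fh h0.
Qed.

Lemma ediv_le (R : realType) (X Y : \bar R) (a b : R) :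
  (X <= a%:E)%E -> (b%:E <= Y)%E -> 0 <= a -> 0 < b -> (X / Y <= (a / b)%:E)%E.
Proof.
move=> Xa bY a0 b0; case: Y bY => [y| |] by_.
- rewrite lee_fin in by_.
  have y0 : 0 < y := lt_le_trans b0 by_.
  rewrite inver gt_eqF//.
  apply: (@le_trans _ _ (a%:E * (y^-1)%:E)%E).
    by apply: lee_wpmul2r => //; rewrite lee_fin invr_ge0 ltW.
  by rewrite -EFinM lee_fin ler_wpM2l// lef_pV2.
- by rewrite invey mule0 lee_fin divr_ge0// ltW.
- by [].
Qed.

Lemma sqr_sum_disjoint (R : comPzRingType) (I : finType) (x : I -> R) :
  (forall i j, i != j -> x i * x j = 0) -> (\sum_i x i) ^+ 2 = \sum_i x i ^+ 2.
Proof.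
move=> x0; rewrite expr2 big_distrlr; apply: eq_bigr => i _ /=.
rewrite (bigD1 i)//= big1 ?addr0 ?expr2// => j ji.
by rewrite x0// eq_sym.
Qed.

(** An index outside [B] carries more than [1 / N], and the total is at most 1, so at most [N] of
    the [2 * N] indices are outside. *)
Lemma light_half (R : realFieldType) (N : nat) (q : 'I_(2 * N) -> R) : (0 < N)%N ->
  (forall i, 0 <= q i) -> \sum_i q i <= 1 ->
  exists2 J : 'I_N -> 'I_(2 * N), injective J & forall i, q (J i) <= N%:R^-1.
Proof.
move=> N0 q0 q1; have NR : 0 < N%:R :> R by rewrite ltr0n.
pose B := [set i | q i <= N%:R^-1]%SET.
have cB : (N <= #|B|)%N.
  have cC : (#|~: B| <= N)%N.
    rewrite -(ler_nat R) -[leRHS]mul1r -ler_pdivrMr//.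
    apply: le_trans q1; rewrite (bigID (mem (~: B)))/=.
    apply: (@le_trans _ _ (\sum_(i in ~: B) q i)); last first.
      by rewrite lerDl sumr_ge0.
    rewrite mulr_natl -sumr_const; apply: ler_sum => i.
    by rewrite !inE -ltNge => /ltW.
  by have := cardsC B; rewrite card_ord; lia.
exists (fun i => enum_val (widen_ord cB i)).
  by move=> i j /enum_val_inj/(congr1 val) /= /val_inj.
by move=> i; have := enum_valP (widen_ord cB i); rewrite inE.
Qed.

Lemma integral_lincomb d (T : measurableType d) (R : realType)
    (mu : {measure set T -> \bar R}) (I : finType) (a : I -> R) (h : I -> T -> R) :
  (forall i, 0 <= a i) -> (forall i x, 0 <= h i x) ->
  (forall i, measurable_fun setT (h i)) ->
  (\int[mu]_x (\sum_i a i * h i x)%:E = \sum_i (a i)%:E * \int[mu]_x (h i x)%:E)%E.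
Proof.
move=> a0 h0 mh.
under eq_integral do rewrite -sumEFin.
rewrite ge0_integral_sum//.
- apply: eq_bigr => i _; under eq_integral do rewrite EFinM.
  rewrite ge0_integralZl//; [exact/measurable_EFinP|by move=> x _; rewrite lee_fin|].
  by rewrite lee_fin.
- by move=> i; apply/measurable_EFinP; exact: measurable_funM.
- by move=> i x _; rewrite lee_fin mulr_ge0.
Qed.

(** * Eigenvalue bound from disjoint bumps *)

Section upper_bound.
Context {R : realType} {n : nat} {M : ptopologicalType}.
Variables (S : smooth_structure R n M) (g : riemannian_metric S).
Variable v : {measure set (borel M) -> \bar R}.
Hypothesis v1 : v setT = 1%E.
Variables (f : M -> R) (A L c0 dl m : R).
Hypotheses (sf : smooth_function S f) (L0 : 0 < L) (c00 : 0 < c0) (dl0 : 0 <= dl).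
Hypothesis gradient_le : forall p,
  ((differential S f p)^T *m invmx (g p) *m differential S f p) 0 0 <= dl.
Hypothesis volume_slab : forall al be, A <= al -> al <= be -> be <= A + L ->
  ((c0 * (be - al))%:E <= v [set p | (al <= f p <= be)%R])%E.
Hypotheses (m0 : 0 < m) (mP : forall s : R, `|s| <= 2^-1 -> m <= flat_bump s).
Variable sigma : M -> R.
Hypotheses (dsigma : density sigma) (sigma1 : (\int[v]_p (sigma p)%:E = 1)%E).
Implicit Types (p : M).

(** The test space is the line of constants; it is one-dimensional modulo null functions because the
    volume is 1. *)
Lemma mu0_le0 : (mu g v 0 (fun=> 1%R) sigma <= 0)%E.
Proof.
pose e (i : 'I_1) : (M -> R) * (M -> 'cV[R]_n) := (fun=> 1, differential S (fun=> 1)).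
have lin a p : (lincomb e a).1 p = a ord0 by rewrite /lincomb/= big_ord1 mulr1.
apply: (@le_trans _ _ (ereal_sup (rayleigh g v (fun=> 1) sigma @`
   (range (lincomb e) `\` [set uw | null v uw])))).
  apply: ereal_inf_lbound; exists (range (lincomb e)) => //; exists e; split => //.
    by move=> i; apply: smooth_H1; exact: smooth_function_cst.
  move=> a [Z [mZ Z0 ZP]] i; rewrite (ord1 i); apply/eqP/negP => /negP a0.
  have ZT : Z = setT.
    by apply/seteqP; split => // p _; apply: ZP => E; case/eqP: a0; rewrite -(lin a p).
  by move: Z0; rewrite ZT v1 => /eqP; rewrite eqe oner_eq0.
apply: ge_ereal_sup => _ [_ [[a _ <-] _] <-].
rewrite /rayleigh [X in (X / _)%E](_ : _ = 0%E) ?mul0e//.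
under eq_integral => p _.
  rewrite (_ : sqnorm _ _ _ = 0); last first.
    rewrite /sqnorm /lincomb /= big_ord1 differential_cst scaler0.
    by rewrite trmx0 !mul0mx mxE.
  rewrite mul0r; over.
by rewrite integral0.
Qed.

Section bumps.
Variable k : nat.
Let N := k.+1.
(** Half the width of a slab: [2 * N] slabs of width [2 * w], centred at the [t i], fill the range
    from [A] to [A + L]. The bump [phi i] vanishes off [B i] and is at least [m] on the middle half
    [B' i]. *)
Let w := L / (4 * N%:R).
Let t (i : nat) : R := A + (2 * i%:R + 1) * w.
Let s (i : nat) p : R := (f p - t i) / w.
Let B (i : nat) : set (borel M) := [set p | `|s i p| < 1].
Let B' (i : nat) : set (borel M) := [set p | (t i - w / 2 <= f p <= t i + w / 2)%R].
Let phi (i : nat) p : R := flat_bump (s i p).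

Let w0 : 0 < w. Proof. by rewrite divr_gt0// mulr_gt0. Qed.

Let B_disjoint i j p : B i p -> B j p -> i = j.
Proof.
wlog ij : i j / (i < j)%N.
  move=> H Bi Bj; case: (ltngtP i j) => // ij; first exact: H.
  by apply/esym; exact: H.
rewrite /B /= => Bi Bj; exfalso.
have E : s i p - s j p = 2 * (j%:R - i%:R).
  by rewrite /s /t; field; rewrite gt_eqF.
have ij1 : (i%:R + 1 : R) <= j%:R by rewrite -[1]/(1%:R) -natrD ler_nat addn1.
move: Bi Bj; rewrite !ltr_norml => /andP[_ Bi] /andP[Bj _]; lra.
Qed.

Let phi_disjoint (i j : nat) p : i != j -> phi i p * phi j p = 0.
Proof.
move=> ij; rewrite /phi; have [si|si] := leP 1 `|s i p|.
  by rewrite flat_bump_eq0// mul0r.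
have [sj|sj] := leP 1 `|s j p|; first by rewrite [X in _ * X]flat_bump_eq0// mulr0.
by move/eqP : ij; have := B_disjoint si sj.
Qed.

Let B'_lower i p : B' i p -> m <= phi i p.
Proof.
rewrite /B' /= => /andP[h1 h2]; apply: mP.
rewrite /s normrM normfV (gtr0_norm w0) ler_pdivrMr// ler_norml.
by apply/andP; split; lra.
Qed.

Let smooth_phi i : smooth_function S (phi i).
Proof.
exact: (smooth_function_comp sf (fun k => Ck_bump_affine k (t i) w)
  (is_derive_bump_affine (t i) w)).
Qed.

Let differential_phi i p :
  differential S (phi i) p = (flat_bump' (s i p) / w) *: differential S f p.
Proof.
exact: (differential_comp p sf (fun k => Ck_bump_affine k (t i) w)
  (is_derive_bump_affine (t i) w)).
Qed.

Let mf : measurable_fun [set: borel M] (f : borel M -> measurableTypeR R).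
Proof.
by apply: continuous_measurable => p; exact: (smooth_function_continuous sf).
Qed.

Let mB i : measurable (B i).
Proof.
have mI : measurable (`](t i - w), (t i + w)[ : set (measurableTypeR R)).
  exact: measurable_itv.
have := mf measurableT mI; rewrite setTI; congr measurable.
apply/seteqP; split=> p; rewrite /B /s /= in_itv/= normrM normfV (gtr0_norm w0);
  rewrite ltr_pdivrMr// mul1r ltr_norml => /andP[h1 h2]; apply/andP; split; lra.
Qed.

Let mB' i : measurable (B' i).
Proof.
have mI : measurable (`[(t i - w / 2), (t i + w / 2)] : set (measurableTypeR R)).
  exact: measurable_itv.
by have := mf measurableT mI; rewrite setTI; congr measurable.
Qed.

Let vB' (i : 'I_(2 * N)) : ((c0 * w)%:E <= v (B' i))%E.
Proof.
have i0 : 0 <= i%:R :> R by [].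
have iN : i%:R + 1 <= 2 * N%:R :> R.
  by rewrite -natrM -[1]/(1%:R) -natrD ler_nat addn1.
have Lw : L = 4 * N%:R * w by rewrite /w; field; rewrite pnatr_eq0.
have iw : 0 <= i%:R * w by rewrite mulr_ge0// ltW.
have iNw : (i%:R + 1) * w <= 2 * N%:R * w by rewrite ler_pM2r.
have -> : c0 * w = c0 * ((t i + w / 2) - (t i - w / 2)) by field.
have w_gt0 := w0.
have h1 : A <= t i - w / 2 by rewrite /t; lra.
have h2 : t i - w / 2 <= t i + w / 2 by lra.
have h3 : t i + w / 2 <= A + L by rewrite /t Lw; lra.
exact: (volume_slab h1 h2 h3).
Qed.

Let sB i p : sigma p * \1_(B i) p = if `|s i p| < 1 then sigma p else 0.
Proof.
rewrite indicE; case: ifPn => si; last by rewrite memNset ?mulr0//; exact/negP.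
by rewrite mem_set ?mulr1.
Qed.

Let sigma_ge0 p : 0 <= sigma p. Proof. exact: ltW (dsigma.2 p). Qed.

Let Q i := (\int[v]_p (sigma p * \1_(B i) p)%:E)%E.

Let sB0 i p : 0 <= sigma p * \1_(B i) p.
Proof. by rewrite sB; case: ifP. Qed.

Let msB i : measurable_fun [set: borel M] (fun p : borel M => sigma p * \1_(B i) p).
Proof.
apply: measurable_funM; last exact: measurable_indic.
exact: (continuous_measurable dsigma.1).
Qed.

Let light_bumps : exists2 J : 'I_N -> 'I_(2 * N), injective J &
  forall i, (Q (J i) <= (N%:R^-1)%:E)%E.
Proof.
have Q0 i : (0 <= Q i)%E by apply: integral_ge0 => p _; rewrite lee_fin.
have Q1 i : (Q i <= 1)%E.
  rewrite -sigma1; apply: le_integral_nonmeasurable => p; rewrite lee_fin//.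
  by rewrite sB; case: ifP.
have QE i : Q i = (fine (Q i))%:E.
  by rewrite fineK// ge0_fin_numE// (le_lt_trans (Q1 i))// ltry.
have sQ : \sum_(i < 2 * N) fine (Q i) <= 1.
  rewrite -lee_fin -sumEFin; under eq_bigr do rewrite -QE -[Q _]mul1e.
  rewrite -(integral_lincomb v (a := fun=> 1) (h := fun (i : 'I_(2 * N)) p => sigma p * \1_(B i) p))//.
  rewrite -sigma1; apply: le_integral_nonmeasurable => p; rewrite lee_fin//.
  have [[j Bj]|nB] := pselect (exists j : 'I_(2 * N), B j p).
    rewrite (bigD1 j)//= big1 ?addr0 ?mul1r; first by rewrite sB; case: ifP.
    move=> i ij; rewrite sB ifF ?mulr0//; apply/negP => Bi.
    by case/eqP: ij; apply/val_inj; exact: B_disjoint Bi Bj.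
  rewrite big1// => i _; rewrite sB ifF ?mulr0//; apply/negP => Bi.
  by apply: nB; exists i.
have [J injJ JQ] := light_half (q := fun i : 'I_(2 * N) => fine (Q i)) (ltn0Sn k)
  (fun i => fine_ge0 (Q0 i)) sQ.
by exists J => // i; rewrite QE lee_fin.
Qed.

Section independent_family.
Variables (J : 'I_N -> 'I_(2 * N)) (injJ : injective J).
Hypothesis QJ : forall i, (Q (J i) <= (N%:R^-1)%:E)%E.
Let e i := (phi (J i), differential S (phi (J i))).
Implicit Type a : 'I_N -> R.

Let lincomb_sqr a p : (lincomb e a).1 p ^+ 2 = \sum_i a i ^+ 2 * phi (J i) p ^+ 2.
Proof.
rewrite /lincomb /= sqr_sum_disjoint; first by apply: eq_bigr => i _; rewrite exprMn.
move=> i j ij; rewrite mulrACA phi_disjoint ?mulr0//.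
by apply: contra ij => /eqP/val_inj/injJ ->.
Qed.

(** Only the middle halves [B'] are kept: there the bump is at least [m], and each has volume at
    least [c0 * w]. *)
Let denominator_ge a :
  ((m ^+ 2 * c0 * w * \sum_i a i ^+ 2)%:E <= \int[v]_p ((lincomb e a).1 p ^+ 2 * 1)%:E)%E.
Proof.
apply: (@le_trans _ _
    (\int[v]_p (\sum_(i < N) (m ^+ 2 * a i ^+ 2) * \1_(B' (J i)) p)%:E)%E); last first.
  apply: le_integral_nonmeasurable => p; rewrite lee_fin mulr1 ?sqr_ge0//.
  rewrite lincomb_sqr; apply: ler_sum => i _; rewrite indicE.
  have [/set_mem Bp|Bp] := boolP (p \in _); last by rewrite mulr0 mulr_ge0// sqr_ge0.
  rewrite mulr1 mulrC ler_wpM2l ?sqr_ge0//.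
  by apply: lerXn2r; rewrite ?nnegrE ?(ltW m0)// ?(le_trans (ltW m0)) ?B'_lower.
rewrite integral_lincomb; last 3 first.
- by move=> i; rewrite mulr_ge0 ?sqr_ge0.
- by move=> i p; rewrite indicE.
- by move=> i; exact: measurable_indic.
rewrite mulr_sumr -sumEFin; apply: lee_sum => i _.
rewrite integral_indic// setIT.
rewrite (_ : m ^+ 2 * c0 * w * a i ^+ 2 = m ^+ 2 * a i ^+ 2 * (c0 * w)); last by ring.
by rewrite EFinM lee_wpmul2l// lee_fin mulr_ge0 ?sqr_ge0.
Qed.

(** The bumps have slope at most [54 / w] in [f], the squared gradient of [f] is at most [dl], and
    each slab in use has [sigma]-mass at most [1 / N]. *)
Let numerator_le a :
  (\int[v]_p (sqnorm g (lincomb e a).2 p * sigma p)%:E <=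
   ((54 / w) ^+ 2 * dl / N%:R * \sum_i a i ^+ 2)%:E)%E.
Proof.
pose b i := a i ^+ 2 * ((54 / w) ^+ 2 * dl).
have b0 i : 0 <= b i by apply: mulr_ge0; [exact: sqr_ge0|apply: mulr_ge0; [exact: sqr_ge0|]].
apply: (@le_trans _ _ (\int[v]_p (\sum_(i < N) b i * (sigma p * \1_(B (J i)) p))%:E)%E).
  apply: le_integral_nonmeasurable => p; rewrite lee_fin.
    by apply: sumr_ge0 => i _; rewrite mulr_ge0.
  (* The differential of the combination is the sum of the [x i] times [df], and at most one [x i]
     is nonzero at [p]. *)
  pose x i := a i * (flat_bump' (s (J i) p) / w).
  have -> : sqnorm g (lincomb e a).2 p = (\sum_i x i) ^+ 2 *
      ((differential S f p)^T *m invmx (g p) *m differential S f p) 0 0.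
    rewrite /sqnorm /lincomb /=; under eq_bigr do rewrite differential_phi scalerA.
    rewrite -scaler_suml; set y := \sum_i _; set X := differential S f p.
    have -> : (y *: X)^T = y *: X^T by exact: linearZ.
    by rewrite -!scalemxAl -scalemxAr scalerA mxE expr2.
  rewrite sqr_sum_disjoint; last first.
    move=> i j ij; rewrite /x.
    have [si|si] := leP 1 `|s (J i) p|; first by rewrite flat_bump'_eq0// !(mul0r, mulr0).
    have [sj|sj] := leP 1 `|s (J j) p|.
      by rewrite [X in _ * (_ * (X / _))]flat_bump'_eq0// !(mul0r, mulr0).
    by case/eqP: ij; apply/injJ/val_inj; exact: B_disjoint si sj.
  apply: (@le_trans _ _ ((\sum_i x i ^+ 2) * dl * sigma p)).
    by rewrite ler_wpM2r// ler_wpM2l// sumr_ge0// => i _; rewrite sqr_ge0.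
  rewrite -mulrA mulr_suml; apply: ler_sum => i _; rewrite sB /x /b.
  case: ltP => [si|si]; last by rewrite flat_bump'_eq0// mul0r mulr0 expr0n/= mul0r mulr0.
  rewrite exprMn -mulrA -mulrA ler_wpM2l ?sqr_ge0// mulrA.
  rewrite ler_wpM2r// ler_wpM2r//.
  have := flat_bump'_bound (s (J i) p); set y := flat_bump' _; move: y => y yb.
  rewrite [(y / w) ^+ 2]exprMn [(54 / w) ^+ 2]exprMn -(real_normK (num_real y)).
  apply: ler_wpM2r; first by rewrite exprn_ge0 ?invr_ge0 ?(ltW w0).
  by apply: lerXn2r; rewrite ?nnegrE.
rewrite integral_lincomb// mulr_sumr -sumEFin; apply: lee_sum => i _.
rewrite (_ : _ * a i ^+ 2 = b i * N%:R^-1); last by rewrite /b; ring.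
by rewrite (EFinM (b i)); apply: lee_wpmul2l; [rewrite lee_fin|exact: QJ].
Qed.

Let lincomb_independent a : null v (lincomb e a) -> forall i, a i = 0.
Proof.
move=> [Z [mZ Z0 ZP]] i; apply/eqP/negP => /negP a0.
have BZ : B' (J i) `<=` Z.
  move=> p Bp; apply: ZP => E; have := lincomb_sqr a p.
  rewrite E expr0n /= => /esym/eqP; rewrite psumr_eq0; last first.
    by move=> j _; rewrite mulr_ge0// sqr_ge0.
  move=> /allP/(_ i); rewrite mem_index_enum => /(_ isT)/=.
  rewrite mulf_eq0 !expf_eq0/= (negbTE a0)/= gt_eqF//.
  exact: lt_le_trans m0 (B'_lower Bp).
have vZ : (v (B' (J i)) <= v Z)%E := le_measure v (mem_set (mB' (J i))) (mem_set mZ) BZ.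
rewrite Z0 in vZ; have := le_trans (vB' (J i)) vZ.
by rewrite lee_fin leNgt mulr_gt0// w0.
Qed.

Lemma mu_le_bumps : (mu g v k (fun=> 1%R) sigma <=
  ((54 / w) ^+ 2 * dl / N%:R / (m ^+ 2 * c0 * w))%:E)%E.
Proof.
apply: (@le_trans _ _ (ereal_sup (rayleigh g v (fun=> 1) sigma @`
   (range (lincomb e) `\` [set uw | null v uw])))).
  apply: ereal_inf_lbound; exists (range (lincomb e)) => //; exists e; split => //.
  by move=> i; exact: (smooth_H1 g v (smooth_phi (J i))).
apply: ge_ereal_sup => _ [_ [[a _ <-] na] <-].
have a2 : 0 < \sum_i a i ^+ 2.
  rewrite lt_neqAle sumr_ge0 ?andbT; last by move=> i _; rewrite sqr_ge0.
  apply/eqP => /esym/eqP; rewrite psumr_eq0; last by move=> i _; rewrite sqr_ge0.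
  move=> /allP a0; apply: na; apply: aeW => p; rewrite /lincomb /= big1// => i _.
  by have := a0 i; rewrite mem_index_enum expf_eq0 => /(_ isT)/= /eqP ->; rewrite mul0r.
have b0 : 0 < m ^+ 2 * c0 * w by exact: (mulr_gt0 (mulr_gt0 (exprn_gt0 2 m0) c00) w0).
have n0 : 0 <= (54 / w) ^+ 2 * dl / N%:R.
  by rewrite divr_ge0// mulr_ge0// sqr_ge0.
have := ediv_le (numerator_le a) (denominator_ge a).
rewrite -mulf_div divff ?mulr1 ?gt_eqF//.
by apply; [rewrite mulr_ge0// ltW|exact: mulr_gt0].
Qed.

End independent_family.

(** Substitution of [w = L / (4 * N)]: the factor [w^-3] gives [64 * N^3 / L^3], and the light mass
    removes one power of [N]. *)
Lemma mu_le : (mu g v k (fun=> 1%R) sigma <=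
  (54 ^+ 2 * 64 / (m ^+ 2 * c0 * L ^+ 3) * k.+1%:R ^+ 2 * dl)%:E)%E.
Proof.
have [J injJ JQ] := light_bumps; have := mu_le_bumps injJ JQ.
congr (_ <= _%:E)%E; rewrite /w /N; have : k.+1%:R != 0 :> R by [].
move: (k.+1%:R : R) => x x0; field.
by rewrite x0 !gt_eqF.
Qed.

End bumps.
End upper_bound.

Unset Implicit Arguments.

Theorem theorem5p2 (R : realType) (n : nat) (hn : (2 <= n)%N) :
  exists C : R,
  forall (M : ptopologicalType) (S : smooth_structure R n M),
    hausdorff_space M -> compact [set: M] ->
  exists (g : R -> riemannian_metric S)
         (v : R -> {measure set (borel M) -> \bar R}),
  forall eps : R, 0 < eps ->
    [/\ is_volume (g eps) (v eps),
        v eps [set: borel M] = 1%E &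
        forall k : nat,
          (mu_extremal (g eps) (v eps) k <=
             (C * k%:R ^+ 2 * eps `^ (2 * ((n%:R - 1) / n%:R)))%:E)%E].
Proof.
exists 1 => M S hM cM.
have [f [A [L [c0 [sf L0 c00 thin]]]]] := thin_metrics S hM cM hn.
have [m m0 mP] := @flat_bump_lower R.
pose K := 54 ^+ 2 * 64 / (m ^+ 2 * c0 * L ^+ 3).
have K0 : 0 < K by rewrite divr_gt0 ?mulr_gt0 ?exprn_gt0.
pose E (eps : R) := eps `^ (2 * ((n%:R - 1) / n%:R)).
(* The family is a function on all reals, so the choice is made for every [eps], with positivity as
   a premise inside. *)
suff /choice[gv gvP] : forall eps : R, exists gv :
    riemannian_metric S * {measure set (borel M) -> \bar R}, 0 < eps ->
    [/\ is_volume gv.1 gv.2, gv.2 [set: borel M] = 1%E &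
      forall k : nat, (mu_extremal gv.1 gv.2 k <= (1 * k%:R ^+ 2 * E eps)%:E)%E].
  by exists (fun eps => (gv eps).1), (fun eps => (gv eps).2).
move=> eps.
(* The value 1 is a placeholder for [eps <= 0], where [thin] still needs a positive argument. *)
have [|g [v [gv v1 grad slab]]] := thin (if 0 < eps then E eps / (4 * K) else 1).
  by case: ifP => [eps0|_] //; apply: divr_gt0; [exact: powR_gt0|exact: mulr_gt0].
exists (g, v) => eps0 /=; split => // k.
rewrite eps0 in grad.
have E0 : 0 < E eps by exact: powR_gt0.
have dl0 : 0 <= E eps / (4 * K) by apply/ltW/divr_gt0 => //; exact: mulr_gt0.
apply: ge_ereal_sup => _ [sigma [dsigma +] <-].
rewrite v1 inve1 mul1e => sigma1.
case: k => [|k].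
  rewrite expr0n/= mulr0 mul0r; exact: (mu0_le0 g v1 sigma).
apply: (le_trans (mu_le sf L0 c00 dl0 grad slab m0 mP dsigma sigma1 k.+1)).
rewrite lee_fin -/K mul1r.
(* The eigenvalue index is [k.+1], so [k.+2] bumps are used; the 4 in [dl] absorbs
   [(k + 2)^2 <= 4 * (k + 1)^2]. *)
have -> : K * k.+2%:R ^+ 2 * (E eps / (4 * K)) = k.+2%:R ^+ 2 / 4 * E eps.
  by field; rewrite gt_eqF.
rewrite ler_pM2r// -natr1 -(natr1 k).
have : 0 <= k%:R :> R by []; nra.
Qed.
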